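(* Let $(\mathcal L,[\cdot_\lambda\cdot],\alpha)$ be a multiplicative Hom-Lie conformal algebra and $(\rho,\mathcal M,\beta)$ a representation of it. Then the graded space $C^*_{\beta,\alpha}(\mathcal M,\mathcal L)=\bigoplus_{p\ge1}C^p_{\beta,\alpha}(\mathcal M,\mathcal L)$ (with $C^p_{\beta,\alpha}(\mathcal M,\mathcal L)$ in degree $p$) together with the bracket $\{\!\{-,-\}\!\}$ is a graded Lie algebra. Moreover, a $\mathbb C$-linear map $\mathcal T:\mathcal M\to\mathcal L$ satisfying $\alpha\mathcal T=\mathcal T\beta$ is an $\mathcal O$-operator on $(\mathcal L,[\cdot_\lambda\cdot],\alpha)$ with respect to the representation $(\rho,\mathcal M,\beta)$ if and only if $\mathcal T\in C^1_{\beta,\alpha}(\mathcal M,\mathcal L)$ and $\mathcal T$ is a Maurer–Cartan element of $(C^*_{\beta,\alpha}(\mathcal M,\mathcal L),\{\!\{-,-\}\!\})$, i.e. $\{\!\{\mathcal T,\mathcal T\}\!\}=0$.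
   Context: All vector spaces and tensor products are over $\mathbb C$; $\lambda,\mu,\lambda_i$ are formal variables. Expressions such as $[y_{-\lambda-\partial}x]$ mean: expand $[y_\mu x]=\sum_k\mu^kc_k$ and take $\sum_k(-\lambda-\partial)^kc_k$. A Hom-Lie conformal algebra $(\mathcal L,[\cdot_\lambda\cdot],\alpha)$ is a $\mathbb C[\partial]$-module with a $\mathbb C$-bilinear map $\mathcal L\otimes\mathcal L\to\mathcal L[\lambda]$ and a $\mathbb C$-linear $\alpha$ with $\alpha\partial=\partial\alpha$, such that $[\partial x_\lambda y]=-\lambda[x_\lambda y]$, $[x_\lambda\partial y]=(\partial+\lambda)[x_\lambda y]$, $[x_\lambda y]=-[y_{-\lambda-\partial}x]$, $[\alpha(x)_\lambda[y_\mu z]]=[[x_\lambda y]_{\lambda+\mu}\alpha(z)]+[\alpha(y)_\mu[x_\lambda z]]$; it is multiplicative if $\alpha([x_\lambda y])=[\alpha(x)_\lambda\alpha(y)]$. $gc(\mathcal M)$ is the space of $\mathbb C$-linear maps $\varphi_\lambda:\mathcal M\to\mathcal M[\lambda]$ with $\varphi_\lambda(\partial m)=(\partial+\lambda)\varphi_\lambda(m)$, with $(\partial\varphi)_\lambda=-\lambda\varphi_\lambda$. A representation is a triple $(\rho,\mathcal M,\beta)$ with $\mathcal M$ a $\mathbb C[\partial]$-module, $\beta:\mathcal M\to\mathcal M$ $\mathbb C$-linear with $\beta\partial=\partial\beta$, $\rho:\mathcal L\to gc(\mathcal M)$ $\mathbb C[\partial]$-linear, such that $\beta(\rho(x)_\lambda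 m)=\rho(\alpha(x))_\lambda\beta(m)$ and $\rho([x_\lambda y])_{\lambda+\mu}\beta(m)=\rho(\alpha(x))_\lambda\rho(y)_\mu m-\rho(\alpha(y))_\mu\rho(x)_\lambda m$. A $\mathbb C[\partial]$-module homomorphism $\mathcal T:\mathcal M\to\mathcal L$ is an $\mathcal O$-operator if $\mathcal T\beta=\alpha\mathcal T$ and $[\mathcal T(m)_\lambda\mathcal T(n)]=\mathcal T(\rho(\mathcal T(m))_\lambda n-\rho(\mathcal T(n))_{-\partial-\lambda}m)$ for all $m,n\in\mathcal M$. Cochains. For $\mathbb C[\partial]$-modules $V,W$ with $\mathbb C$-linear endomorphisms $\gamma,\gamma'$ commuting with $\partial$, let $C^p_{\gamma,\gamma'}(V,W)$ ($p\ge1$) be the space of $\mathbb C$-linear maps $f_{\lambda_1,\dots,\lambda_{p-1}}:V^{\otimes p}\to W[\lambda_1,\dots,\lambda_{p-1}]$ such that (i) $\gamma'(f(v_1,\dots,v_p))=f(\gamma(v_1),\dots,\gamma(v_p))$; (ii) replacing $v_i$ by $\partial v_i$ multiplies the value by $-\lambda_i$ if $i\le p-1$ and by $\partial+\lambda_1+\cdots+\lambda_{p-1}$ if $i=p$; (iii) for every permutation $\tau$, $f_{\lambda_1,\dots,\lambda_{p-1}}(v_1,\dots,v_p)=\operatorname{sgn}(\tau)f_{\lambda_{\tau(1)},\dots,\lambda_{\tau(p-1)}}(v_{\tau(1)},\dots,v_{\tau(p)})|_{\lambda_p=-\lambda_1-\cdots-\lambda_{p-1}-\partial}$. In particular $C^p_{\beta,\alpha}(\mathcal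 M,\mathcal L)$ is defined, and with $E=\mathcal L\oplus\mathcal M$, $\gamma=\alpha+\beta$ (i.e. $\gamma(x,a)=(\alpha(x),\beta(a))$), put $C^n_\gamma(E,E):=C^n_{\gamma,\gamma}(E,E)$. Convention: in a formula with $N$ arguments and free variables $\lambda_1,\dots,\lambda_{N-1}$, $\lambda_N$ stands for $-\lambda_1-\cdots-\lambda_{N-1}-\partial$, with $\partial$ acting from the left on the total value. For $f\in C^m_\gamma(E,E)$, $g\in C^n_\gamma(E,E)$, $$(f\circledcirc g)_{\lambda_1,\dots,\lambda_{m+n-2}}(e_1,\dots,e_{m+n-1})=\sum_{\tau\in S_{n,m-1}}\operatorname{sgn}(\tau)f_{\lambda_{\tau(1)}+\cdots+\lambda_{\tau(n)},\lambda_{\tau(n+1)},\dots,\lambda_{\tau(m+n-2)}}\big(g_{\lambda_{\tau(1)},\dots,\lambda_{\tau(n-1)}}(e_{\tau(1)},\dots,e_{\tau(n)}),\gamma^{n-1}(e_{\tau(n+1)}),\dots,\gamma^{n-1}(e_{\tau(m+n-1)})\big),$$ with $S_{n,m-1}$ the permutations with $\tau(1)<\cdots<\tau(n)$, $\tau(n+1)<\cdots<\tau(n+m-1)$ (when $m=1$ the outer $f$ carries no parameter), and $[f,g]^{\alpha+\beta}_{NR}=f\circledcirc g-(-1)^{(m-1)(n-1)}g\circledcirc f$. Let $m_c+\rho\in C^2_\gamma(E,E)$ be $(m_c+\rho)_\lambda((x,a),(y,b))=([x_\lambda y],\rho(x)_\lambda b-\rho(y)_{-\partial-\lambda}a)$.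 Identify $f\in C^p_{\beta,\alpha}(\mathcal M,\mathcal L)$ with the element $((x_1,a_1),\dots,(x_p,a_p))\mapsto(f(a_1,\dots,a_p),0)$ of $C^p_\gamma(E,E)$. For $f\in C^q_{\beta,\alpha}(\mathcal M,\mathcal L)$ and $g\in C^p_{\beta,\alpha}(\mathcal M,\mathcal L)$ define $$\{\!\{f,g\}\!\}=(-1)^q\,[[m_c+\rho,f]^{\alpha+\beta}_{NR},g]^{\alpha+\beta}_{NR}\in C^{p+q}_{\beta,\alpha}(\mathcal M,\mathcal L).$$ For $\mathcal T\in C^1_{\beta,\alpha}(\mathcal M,\mathcal L)$ this gives $\{\!\{\mathcal T,\mathcal T\}\!\}_\lambda(m,n)=2\big(\mathcal T(\rho(\mathcal Tm)_\lambda n)-\mathcal T(\rho(\mathcal Tn)_{-\partial-\lambda}m)-[\mathcal T(m)_\lambda\mathcal T(n)]\big)$. *)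

(* Defs.v *)
From HB Require Import structures.
From mathcomp Require Import all_boot all_order all_algebra all_fingroup finmap.
From mathcomp Require Import boolp functions reals complex.
From mathcomp.multinomials Require Import monalg.

Set Implicit Arguments.
Unset Strict Implicit.
Unset Printing Implicit Defensive.

Import GRing.Theory.
Local Open Scope ring_scope.

(** A C[∂]-module is a vector space [W] together with a linear endomorphism
    [dW], the action of ∂. *)

(** ** W[λ_1, ..., λ_n]: finitely supported families of vectors indexed by
    the commutative monomials in n variables *)

Definition pol (K : fieldType) (n : nat) (W : lmodType K) : Type :=
  {malg W['X_{1..n}]}.

HB.instance Definition _ (K : fieldType) n (W : lmodType K) :=
  GRing.Zmodule.copy (pol n W) {malg W['X_{1..n}]}.

Definition mapc (K : fieldType) n (W W' : lmodType K) (F : W -> W')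
    (P : pol n W) : pol n W' :=
  [malg k in msupp P => F P@_k].

Lemma mapcE (K : fieldType) n (W W' : lmodType K) (F : W -> W') (P : pol n W) k :
  F 0 = 0 -> (mapc F P)@_k = F P@_k.
Proof. by move=> F0; rewrite mcoeffE; case: msuppP. Qed.

(** multiplication by the i-th variable *)
HB.lock Definition mulX (K : fieldType) n (W : lmodType K) (i : 'I_n)
    (P : pol n W) : pol n W :=
  \sum_(k <- msupp P) << P@_k *g mmul k (ucm i) >>.

(** If [P] is the sum of the λ^k c_k, then [subst A F P] is the sum of the
    A^k (F c_k): the variables are replaced by the operators [A i] (which
    commute pairwise wherever this is used), acting from the left on the
    value of [F]. *)
HB.lock Definition subst (K : fieldType) n (W : lmodType K) (U : zmodType)
    (A : 'I_n -> U -> U) (F : W -> U) (P : pol n W) : U :=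
  \sum_(k <- msupp P) foldr (fun i => iter (k i) (A i)) (F P@_k) (enum 'I_n).

Section Polynomials.
Variables (K : fieldType) (n : nat).

Section Scale.
Variable W : lmodType K.
Definition pscale (a : K) (P : pol n W) : pol n W := mapc ( *:%R a) P.

Let pscaleE a (P : pol n W) k : (pscale a P)@_k = a *: P@_k.
Proof. by rewrite mapcE // scaler0. Qed.

Let pscaleA a b (P : pol n W) : pscale a (pscale b P) = pscale (a * b) P.
Proof. by apply/malgP => k; rewrite !pscaleE scalerA. Qed.

Let pscale1 : left_id 1 pscale.
Proof. by move=> P; apply/malgP => k; rewrite pscaleE scale1r. Qed.

Let pscaleDr : right_distributive pscale +%R.
Proof.
by move=> a P Q; apply/malgP => k; rewrite !(pscaleE, mcoeffD) scalerDr.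
Qed.

Let pscaleDl (P : pol n W) : {morph pscale^~ P : a b / a + b}.
Proof.
by move=> a b; apply/malgP => k; rewrite !(pscaleE, mcoeffD) scalerDl.
Qed.

HB.instance Definition _ := GRing.Zmodule_isLmodule.Build K (pol n W)
  pscaleA pscale1 pscaleDr pscaleDl.
End Scale.

Definition polC (W : lmodType K) (w : W) : pol n W := w%:MP.

(** With n+1 arguments and n free variables: the operator on W[λ_1, ..., λ_n]
    given by λ_i for i <= n, and by - λ_1 - ... - λ_n - ∂ for i = n+1. *)
Definition lam (W : lmodType K) (dW : W -> W) (i : 'I_n.+1) (P : pol n W) : pol n W :=
  if unlift ord_max i is Some j then mulX j P
  else - (\sum_(j < n) mulX j P) - mapc dW P.

End Polynomials.

(** [P] with its n variables replaced by operators on W[λ_1, ..., λ_n'] *)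
Definition eval (K : fieldType) n n' (W : lmodType K)
    (A : 'I_n -> pol n' W -> pol n' W) (P : pol n W) : pol n' W :=
  subst A (@polC K n' W) P.

Definition eval1 (K : fieldType) n' (W : lmodType K)
    (A : pol n' W -> pol n' W) (P : pol 1 W) : pol n' W :=
  eval (fun=> A) P.

(** P(λ) |-> P(-λ-∂) *)
Definition flip (K : fieldType) (W : lmodType K) (dW : W -> W) (P : pol 1 W) :
    pol 1 W :=
  eval1 (lam dW ord_max) P.

Section HomLieConformal.
Variables (K : fieldType) (L M : lmodType K).
Variables (dL : {linear L -> L}) (dM : {linear M -> M}).

(** In two variables, λ and μ are the following operators. *)
Definition la (W : lmodType K) : pol 2 W -> pol 2 W := mulX ord0.
Definition mu (W : lmodType K) : pol 2 W -> pol 2 W := mulX ord_max.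
Definition lamu (W : lmodType K) (P : pol 2 W) : pol 2 W := la P + mu P.

Record is_hom_lie_conformal (br : L -> L -> pol 1 L) (alpha : {linear L -> L}) :
    Prop := {
  hlc_linearl : forall y, linear (br^~ y);
  hlc_linearr : forall x, linear (br x);
  hlc_alpha_d : forall x, alpha (dL x) = dL (alpha x);
  hlc_dl : forall x y, br (dL x) y = - mulX ord0 (br x y);
  hlc_dr : forall x y, br x (dL y) = mapc dL (br x y) + mulX ord0 (br x y);
  hlc_skew : forall x y, br x y = - flip dL (br y x);
  hlc_jacobi : forall x y z,
    subst (fun=> @mu L) (fun c => eval1 (@la L) (br (alpha x) c)) (br y z) =
      subst (fun=> @la L) (fun c => eval1 (@lamu L) (br c (alpha z))) (br x y)
      + subst (fun=> @la L) (fun c => eval1 (@mu L) (br (alpha y) c)) (br x z) }.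

Definition is_multiplicative (br : L -> L -> pol 1 L) (alpha : {linear L -> L}) :
    Prop :=
  forall x y, mapc alpha (br x y) = br (alpha x) (alpha y).

(** membership in gc(M) *)
Definition is_gc (phi : M -> pol 1 M) : Prop :=
  linear phi /\
  forall m, phi (dM m) = mapc dM (phi m) + mulX ord0 (phi m).

Record is_representation (br : L -> L -> pol 1 L) (alpha : {linear L -> L})
    (rho : L -> M -> pol 1 M) (beta : {linear M -> M}) : Prop := {
  rep_beta_d : forall m, beta (dM m) = dM (beta m);
  rep_gc : forall x, is_gc (rho x);
  rep_linear : forall m, linear (rho^~ m);
  rep_d : forall x m, rho (dL x) m = - mulX ord0 (rho x m);
  rep_beta : forall x m, mapc beta (rho x m) = rho (alpha x) (beta m);
  rep_bracket : forall x y m,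
    subst (fun=> @la M) (fun c => eval1 (@lamu M) (rho c (beta m))) (br x y) =
      subst (fun=> @mu M) (fun c => eval1 (@la M) (rho (alpha x) c)) (rho y m)
      - subst (fun=> @la M) (fun c => eval1 (@mu M) (rho (alpha y) c)) (rho x m)
  }.

Definition is_O_operator (br : L -> L -> pol 1 L) (alpha : {linear L -> L})
    (rho : L -> M -> pol 1 M) (beta : {linear M -> M}) (T : {linear M -> L}) :
    Prop :=
  [/\ forall m, T (dM m) = dL (T m),
      forall m, T (beta m) = alpha (T m)
    & forall m n, br (T m) (T n) =
        mapc T (rho (T m) n - flip dM (rho (T n) m))].

End HomLieConformal.

(** ** Cochains.  A linear map on the tensor power of V is given as a multilinear
    map on tuples.  To avoid degree 0, maps are indexed by n = p - 1: elements
    of [raw n V W] have n+1 arguments and values in W[λ_1, ..., λ_n]. *)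

Definition raw (K : fieldType) (n : nat) (V W : lmodType K) : Type :=
  {ffun 'I_n.+1 -> V} -> pol n W.

HB.instance Definition _ (K : fieldType) n (V W : lmodType K) :=
  GRing.Lmodule.copy (raw n V W) ({ffun 'I_n.+1 -> V} -> pol n W).

Definition upd n (V : Type) (v : {ffun 'I_n.+1 -> V}) (i : 'I_n.+1) (x : V) :
    {ffun 'I_n.+1 -> V} :=
  [ffun j => if j == i then x else v j].

(** [is_cochain dV dW gV gW f]: [f] belongs to C^{n+1}_{gV,gW}(V,W). *)
Record is_cochain (K : fieldType) (V W : lmodType K) (dV : V -> V) (dW : W -> W)
    (gV : V -> V) (gW : W -> W) n (f : raw n V W) : Prop := {
  coch_linear : forall v i, linear (fun x => f (upd v i x));
  coch_twist : forall v, mapc gW (f v) = f [ffun i => gV (v i)];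
  coch_d : forall v (i : 'I_n),
    let i' := lift ord_max i in f (upd v i' (dV (v i'))) = - mulX i (f v);
  coch_d_last : forall v,
    f (upd v ord_max (dV (v ord_max))) = mapc dW (f v) + \sum_(i < n) mulX i (f v);
  coch_alt : forall (t : 'S_n.+1) v,
    f v = (-1) ^+ odd_perm t *:
          eval (fun i : 'I_n => lam dW (t (lift ord_max i)))
               (f [ffun i => v (t i)]) }.

(** increasing on the first n+1 positions and on the remaining ones *)
Definition shuffle N (n : nat) (t : 'S_N.+1) : bool :=
  [forall i : 'I_N.+1, forall j : 'I_N.+1,
    (i < j)%N && ((j <= n) || (n < i))%N ==> (t i < t j)%N].

Section NijenhuisRichardson.
Variables (K : fieldType) (E : lmodType K) (dE gE : E -> E).

(** f ⊚ g for f of arity m+1 and g of arity n+1; the result has arity m+n+1,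
    so [N] is meant to be m+n (it is a separate parameter so that f ⊚ g and
    g ⊚ f have literally the same type).  Positions in 1..m+n+1 are numbered
    from 0: g takes the positions 0..n, its n parameters being at 0..n-1; the
    slot j >= 1 of f takes the position n+j, and so does its parameter number
    j for 1 <= j < m. *)
Definition circ N m n (f : raw m E E) (g : raw n E E) : raw N E E := fun e =>
  \sum_(t : 'S_N.+1 | shuffle n t) (-1) ^+ odd_perm t *:
    subst (fun i : 'I_n => lam dE (t (inord i)))
      (fun c => eval
         (fun (j : 'I_m) (P : pol N E) =>
            if j == 0 :> nat then \sum_(i < n.+1) lam dE (t (inord i)) P
            else lam dE (t (inord (n + j))) P)
         (f [ffun j : 'I_m.+1 => if j == 0 :> nat then c
                                 else iter n gE (e (t (inord (n + j))))]))
      (g [ffun i : 'I_n.+1 => e (t (inord i))]).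

Arguments circ N {m n} f g.

Definition nr N m n (f : raw m E E) (g : raw n E E) : raw N E E := fun e =>
  circ N f g e - (-1) ^+ (m * n) *: circ N g f e.

End NijenhuisRichardson.

Arguments nr {K E} dE gE N {m n} f g.

Section DerivedBracket.
Variables (K : fieldType) (L M : lmodType K).
Variables (dL : {linear L -> L}) (dM : {linear M -> M}).
Variables (br : L -> L -> pol 1 L) (alpha : {linear L -> L}).
Variables (rho : L -> M -> pol 1 M) (beta : {linear M -> M}).

Local Notation E := (L * M)%type.

Definition dsum (f : L -> L) (g : M -> M) (e : E) : E := (f e.1, g e.2).

(** the element m_c + ρ of C^2(E,E) *)
Definition mc_rho : raw 1 E E := fun e =>
  let: (x, a) := e ord0 in
  let: (y, b) := e ord_max in
  mapc (fun z : L => (z, 0) : E) (br x y)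
  + mapc (fun c : M => (0, c) : E) (rho x b - flip dM (rho y a)).

Definition embed n (f : raw n M L) : raw n E E := fun e =>
  mapc (fun x : L => (x, 0) : E) (f [ffun i => (e i).2]).

Definition nrE N m n (f : raw m E E) (g : raw n E E) : raw N E E :=
  nr (dsum dL dM) (dsum alpha beta) N f g.

Arguments nrE N {m n} f g.

(** (-1)^p [[m_c + ρ, f], g] in C^{p+q}(E,E), for f of arity p and g of
    arity q *)
Definition derived p q (f : raw p.-1 M L) (g : raw q.-1 M L) :
    raw (p + q).-1 E E :=
  (-1) ^+ p *: nrE (p + q).-1 (nrE p mc_rho (embed f)) (embed g).

(** The same as a map on M with values in L; that it is identified with
    [derived f g] through [embed] has to be proved. *)
Definition dbr p q (f : raw p.-1 M L) (g : raw q.-1 M L) :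
    raw (p + q).-1 M L :=
  fun a => mapc (fun e : E => e.1) (derived f g [ffun i => (0, a i)]).

(** C^p_{β,α}(M,L) for p >= 1, and 0 in degree 0 *)
Definition cochains p (f : raw p.-1 M L) : Prop :=
  if p == 0%N then f = 0 else is_cochain dM dL beta alpha f.

(** a linear map M -> L as a map of arity 1, with values in L = L[] *)
Definition raw1 (T : M -> L) : raw 1.-1 M L := fun v => polC 0 (T (v ord0)).

End DerivedBracket.

Arguments dbr {K L M} dL dM br alpha rho beta p q f g.
Arguments cochains {K L M} dL dM alpha beta p f.

(** ** Graded Lie algebras: a graded subspace [S] of the graded vector space [U]
    and a bracket of degree 0 on it *)

Definition gcast (K : fieldType) (U : nat -> lmodType K) p q (e : p = q)
  (x : U p) : U q := ecast i (U i) e x.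

Record is_graded_lie (K : fieldType) (U : nat -> lmodType K)
    (S : forall p, U p -> Prop) (b : forall p q, U p -> U q -> U (p + q)%N) :
    Prop := {
  gl_zero : forall p, S p 0;
  gl_comb : forall p a (x y : U p), S p x -> S p y -> S p (a *: x + y);
  gl_closed : forall p q (x : U p) (y : U q),
    S p x -> S q y -> S (p + q)%N (b p q x y);
  gl_linearl : forall p q a (x x' : U p) (y : U q),
    S p x -> S p x' -> S q y ->
    b p q (a *: x + x') y = a *: b p q x y + b p q x' y;
  gl_linearr : forall p q a (x : U p) (y y' : U q),
    S p x -> S q y -> S q y' ->
    b p q x (a *: y + y') = a *: b p q x y + b p q x y';
  gl_skew : forall p q (x : U p) (y : U q), S p x -> S q y ->
    b p q x y = - ((-1) ^+ (p * q) *: gcast (addnC q p) (b q p y x));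
  gl_jacobi : forall p q r (x : U p) (y : U q) (z : U r),
    S p x -> S q y -> S r z ->
    b p (q + r)%N x (b q r y z) =
      gcast (esym (addnA p q r)) (b (p + q)%N r (b p q x y) z)
      + (-1) ^+ (p * q) *:
          gcast (addnCA q p r) (b q (p + r)%N y (b p r x z)) }.

(* Main.v *)
(** Each cochain f of arity n+1 on E = L ⊕ M is encoded by an ordinary alternating
    multiadditive map.  Let B be the free commutative ring on x_0, ..., x_N and
    y_0, ..., y_N with the derivation D y_j = x_j y_j, D x_j = 0, and let X be the
    cokernel of ∂ + D on E ⊗ B.  In X a variable λ attached to an argument
    c x^a y^b becomes multiplication by the linear form \sum_j b_j x_j, and
    conformal sesquilinearity says exactly that f descends to a map
    [hat f] : X^(n+1) -> X, for which the last variable - λ_1 - ... - λ_n - ∂ is no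
    longer special.  Reading the coefficient of y_0 ... y_N in
    [hat f (v_0 y_0, ..., v_N y_N)] recovers f.  The conformal insertion ⊚ becomes
    the ordinary (Hom-twisted) insertion of alternating maps, whose associator is
    graded symmetric by induction on the number of arguments.  Hence the
    Nijenhuis-Richardson bracket satisfies the graded Jacobi identity.

    The axioms of a Hom-Lie conformal algebra and of a representation give
    [m_c + ρ, m_c + ρ] = 0, so the bracket derived from m_c + ρ is graded Lie on
    the cochains from M to L, which commute with each other.  Giving L weight 0
    and M weight 1, m_c + ρ preserves the weight while a cochain of arity p from
    M to L lowers it by p; therefore the derived bracket of two such cochains
    only sees M-components and takes values in L.  For T of arity 1 the bracket
    {{T, T}} is twice the defect of T from being an O-operator, and 2 is
    invertible. *)

From HB Require Import structures.
Require Import Defs.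
From mathcomp Require Import all_boot all_order all_algebra all_fingroup finmap.
From mathcomp Require Import boolp functions reals complex zify.
From mathcomp.multinomials Require Import monalg.
Import GRing.Theory.
Local Open Scope ring_scope.

Set Implicit Arguments.
Unset Strict Implicit.
Unset Printing Implicit Defensive.

(** * Insertion of functions on sequences *)

(** The obstacle is the last variable: - λ_1 - ... - λ_n - ∂ is an operator on the value, so
    permuting arguments or nesting cochains substitutes operators into values, and an induction on
    the arguments has no uniform step. With D y_j = x_j y_j the element y_j behaves like exp(x_j t):
    D acts on y^b as \sum_j b_j x_j, and exponents add under multiplication. The value of an inner
    cochain therefore carries the sum of the variables of its arguments, which is exactly the
    parameter that ⊚ prescribes for the outer cochain.

    N is a parameter throughout: a cochain of arity n + 1 is recovered at N = n, while inside an
    iterated bracket it has to act on the X that belongs to the arity of the result.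

    On X insertion is a recursion that hands each argument to one of two maps, and abelian groups
    suffice for it. Linearity over K and over the x_j returns only to come back to cochains.
    Alternation is a change of sign under transposition, so the Jacobi identity applied to the
    square-zero element yields 2 [P, [P, F]] = 0, and X must have no 2-torsion. *)

(* The tactic [zmodule] decides additive identities by comparing coefficients. *)
Inductive zexpr := ZVar of nat | ZZero | ZAdd of zexpr & zexpr | ZOpp of zexpr.

Fixpoint zeval (X : zmodType) (env : seq X) e :=
  match e with
  | ZVar i => env`_i
  | ZZero => 0
  | ZAdd a b => zeval env a + zeval env b
  | ZOpp a => - zeval env a
  end.

Fixpoint zcoef e i : int :=
  match e with
  | ZVar j => (i == j)%:R
  | ZZero => 0
  | ZAdd a b => zcoef a i + zcoef b i
  | ZOpp a => - zcoef a i
  end.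

Lemma zevalE (X : zmodType) (env : seq X) e :
  zeval env e = \sum_(i < size env) env`_i *~ zcoef e i.
Proof.
elim: e => [j||a IHa b IHb|a IHa] /=.
- case: (ltnP j (size env)) => hj; last first.
    rewrite nth_default // big1 // => i _; case: eqP => [ij|_]; last by rewrite mulr0z.
    by move: (ltn_ord i); rewrite ij ltnNge hj.
  rewrite (bigD1 (Ordinal hj)) //= eqxx mulr1z big1 ?addr0 // => i ij.
  case: eqP => [e|_]; last by rewrite mulr0z.
  by case/eqP: ij; apply: val_inj.
- by rewrite big1 // => i _; rewrite mulr0z.
- by rewrite IHa IHb -big_split; apply: eq_bigr => i _; rewrite mulrzDr.
- by rewrite IHa -sumrN; apply: eq_bigr => i _; rewrite mulrNz.
Qed.

Lemma zeval_eq (X : zmodType) (env : seq X) a b :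
  all (fun i => zcoef a i == zcoef b i) (iota 0 (size env)) ->
  zeval env a = zeval env b.
Proof.
move=> /allP h; rewrite !zevalE; apply: eq_bigr => i _.
by congr (_ *~ _); apply/eqP/h; rewrite mem_iota ltn_ord.
Qed.

Ltac zmem x l :=
  lazymatch l with
  | nil => constr:(false)
  | cons ?y ?l' =>
    match constr:(true) with
    | _ => let _ := match constr:(true) with _ => unify x y end in constr:(true)
    | _ => zmem x l'
    end
  end.
Ltac zatoms l t :=
  lazymatch t with
  | @GRing.add _ ?a ?b => let l1 := zatoms l a in zatoms l1 b
  | @GRing.opp _ ?a => zatoms l a
  | @GRing.zero _ => l
  | ?x => lazymatch zmem x l with true => l | false => constr:(cons x l) end
  end.
Ltac zindex x l :=
  lazymatch l with
  | cons ?y ?l' =>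
    match constr:(true) with
    | _ => let _ := match constr:(true) with _ => unify x y end in constr:(O)
    | _ => let n := zindex x l' in constr:(S n)
    end
  end.
Ltac zreify l t :=
  lazymatch t with
  | @GRing.add _ ?a ?b =>
      let a' := zreify l a in let b' := zreify l b in constr:(ZAdd a' b')
  | @GRing.opp _ ?a => let a' := zreify l a in constr:(ZOpp a')
  | @GRing.zero _ => constr:(ZZero)
  | ?x => let n := zindex x l in constr:(ZVar n)
  end.
Ltac zmodule :=
  lazymatch goal with
  | |- @eq ?T ?a ?b =>
    let l0 := zatoms (@nil T) a in let l := zatoms l0 b in
    let a' := zreify l a in let b' := zreify l b in
    refine (@zeval_eq _ l a' b' _); vm_compute; reflexivity
  end.

(** * Signs and additive maps *)

Section Sign.
Variable X : zmodType.
(** Signs are booleans because [X] is only an abelian group, with no scalars to multiply by. *)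
Definition sg (b : bool) (x : X) : X := if b then - x else x.
Lemma sgD b x y : sg b (x + y) = sg b x + sg b y.
Proof. by case: b; rewrite //= opprD. Qed.
Lemma sgN b x : sg b (- x) = - sg b x.
Proof. by case: b. Qed.
Lemma sg0 b : sg b 0 = 0.
Proof. by case: b; rewrite //= oppr0. Qed.
Lemma sgA b c x : sg b (sg c x) = sg (b (+) c) x.
Proof. by case: b; case: c; rewrite //= opprK. Qed.
Lemma sg_sum b (I : Type) (r : seq I) (P : pred I) F :
  sg b (\sum_(i <- r | P i) F i) = \sum_(i <- r | P i) sg b (F i).
Proof. by case: b; rewrite //= sumrN. Qed.
End Sign.

Lemma scale_sg (R : nzRingType) (V : lmodType R) (b : bool) (v : V) :
  (-1) ^+ b *: v = sg b v.
Proof. by rewrite scaler_sign. Qed.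

Section Morph.
Variables (U V : zmodType) (f : U -> V).
Definition addf := {morph f : x y / x + y}.
Hypothesis fD : addf.
Lemma addf0 : f 0 = 0.
Proof. by apply: (addrI (f 0)); rewrite -fD !addr0. Qed.
Lemma addfN x : f (- x) = - f x.
Proof. by apply: (addrI (f x)); rewrite -fD !subrr addf0. Qed.
Lemma addf_sg b x : f (sg b x) = sg b (f x).
Proof. by case: b; rewrite //= addfN. Qed.
Lemma addf_sum (I : Type) (r : seq I) (P : pred I) F :
  f (\sum_(i <- r | P i) F i) = \sum_(i <- r | P i) f (F i).
Proof. exact: (big_morph f fD addf0). Qed.
Lemma addf_muln x n : f (x *+ n) = f x *+ n.
Proof. by elim: n => [|n IHn]; rewrite ?mulr0n ?addf0 // !mulrS fD IHn. Qed.
End Morph.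

Section SeqFunctions.
Variable X : zmodType.
Implicit Types (F G H : seq X -> X) (phi psi : X -> X) (s : seq X).

Definition contr x F : seq X -> X := fun s => F (x :: s).

Definition multiadd (U : zmodType) (F : seq X -> U) :=
  forall s1 x y s2, F (s1 ++ (x + y) :: s2) = F (s1 ++ x :: s2) + F (s1 ++ y :: s2).
Definition altern (T : Type) (U : zmodType) (F : seq T -> U) :=
  forall (s1 : seq T) x y (s2 : seq T), F (s1 ++ x :: y :: s2) = - F (s1 ++ y :: x :: s2).
(* [i] counts the arguments that have already been contracted *)
Definition arity i p F := forall s, (size s + i != p)%N -> F s = 0.
Definition parity b F := forall s, odd (size s) != b -> F s = 0.

Lemma multiadd_contr x F : multiadd F -> multiadd (contr x F).
Proof. by move=> h s1; apply: (h (x :: s1)). Qed.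
Lemma altern_contr x F : altern F -> altern (contr x F).
Proof. by move=> h s1; apply: (h (x :: s1)). Qed.
Lemma arity_contr x i p F : arity i p F -> arity i.+1 p (contr x F).
Proof. by move=> h s hs; apply: h; rewrite addSnnS. Qed.
Lemma parity_contr x b F : parity b F -> parity (~~ b) (contr x F).
Proof. by move=> h s hs; apply: h => /=; move: hs; case: odd; case: b. Qed.
Lemma arity_parity p F : arity 0 p F -> parity (odd p) F.
Proof. by move=> h s hs; apply: h; apply: contraNN hs => /eqP<-; rewrite addn0. Qed.

(* The signed shuffle sum defining an insertion: each argument [x] goes either to
   [G] or, as [phi x], to [F].  [b] is the parity of the number of arguments [G]
   still expects; the further minus sign arises because [phi x] is put before
   the value of [G]. *)
Fixpoint comp b phi F G s : X :=
  if s is x :: s' then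
    comp (~~ b) phi F (contr x G) s' - sg b (comp b phi (contr (phi x) F) G s')
  else F [:: G [::]].

(** Atoms are compared by unification, which would otherwise unfold the recursion of [comp]. *)
Ltac zm := with_strategy opaque [comp] zmodule.

Lemma comp_ext b phi psi F F' G G' s : (forall t, F t = F' t) ->
  (forall t, G t = G' t) -> (forall x, phi x = psi x) ->
  comp b phi F G s = comp b psi F' G' s.
Proof.
move=> hF hG hp; elim: s b F F' G G' hF hG => [|x s IHs] b F F' G G' hF hG /=.
  by rewrite hF hG.
rewrite (IHs _ F F' _ (contr x G')) // ?(IHs _ _ (contr (psi x) F') _ G') //.
- by move=> t; rewrite /contr hp hF.
- by move=> t; rewrite /contr hG.
Qed.

Lemma compDl b phi F F' G s :
  comp b phi (fun t => F t + F' t) G s = comp b phi F G s + comp b phi F' G s.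
Proof.
elim: s b F F' G => [|x s IHs] b F F' G //=.
rewrite IHs (_ : contr (phi x) _ = fun t => contr (phi x) F t + contr (phi x) F' t) //.
rewrite IHs sgD; zm.
Qed.

Lemma compMl (m : X -> X) b phi F G s : addf m ->
  comp b phi (fun t => m (F t)) G s = m (comp b phi F G s).
Proof.
move=> hm; elim: s b F G => [|x s IHs] b F G //=.
rewrite IHs (_ : contr (phi x) _ = fun t => m (contr (phi x) F t)) //.
by rewrite IHs hm (addfN hm) (addf_sg hm).
Qed.

Lemma compDr b phi F G G' s : multiadd F ->
  comp b phi F (fun t => G t + G' t) s = comp b phi F G s + comp b phi F G' s.
Proof.
elim: s b F G G' => [|x s IHs] b F G G' hF /=; first exact: (hF [::]).
rewrite (_ : contr x _ = fun t => contr x G t + contr x G' t) //.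
by rewrite !IHs ?sgD //; [zm | apply: multiadd_contr].
Qed.

(** Each contraction of [F] puts its argument in front, so the value of [G] ends up in the last slot
    of [F]; only there must [m] be exchanged with [m']. *)
Lemma compMr (m m' : X -> X) b phi F G s : (forall s1 x, F (s1 ++ [:: m x]) = m' (F (s1 ++ [:: x]))) ->
  addf m' ->
  comp b phi F (fun t => m (G t)) s = m' (comp b phi F G s).
Proof.
move=> hF hm; elim: s b F G hF => [|x s IHs] b F G hF /=; first exact: (hF [::]).
rewrite (_ : contr x _ = fun t => m (contr x G t)) // !IHs //.
  by rewrite hm (addfN hm) (addf_sg hm).
by move=> s1 y; apply: (hF (phi x :: s1)).
Qed.

Lemma sg_addf b : addf (@sg X b).
Proof. by move=> x y; rewrite sgD. Qed.

Lemma multiadd_sg (c : bool) F s1 x s2 : multiadd F ->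
  F (s1 ++ sg c x :: s2) = sg c (F (s1 ++ x :: s2)).
Proof. by move=> h; apply: (addf_sg (f := fun x => F (s1 ++ x :: s2))) => y z. Qed.

Lemma comp_sgl b c phi F G s :
  comp b phi (fun t => sg c (F t)) G s = sg c (comp b phi F G s).
Proof. exact/compMl/sg_addf. Qed.

Lemma comp_sgr b c phi F G s : multiadd F ->
  comp b phi F (fun t => sg c (G t)) s = sg c (comp b phi F G s).
Proof. by move=> hF; apply: compMr => [s1 x|]; [apply: multiadd_sg|apply: sg_addf]. Qed.

Lemma compNl b phi F G s : comp b phi (fun t => - F t) G s = - comp b phi F G s.
Proof. exact: (comp_sgl b true). Qed.

Lemma compNr b phi F G s : multiadd F ->
  comp b phi F (fun t => - G t) s = - comp b phi F G s.
Proof. exact: (comp_sgr b true). Qed.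

Lemma compBl b phi F F' G s :
  comp b phi (fun t => F t - F' t) G s = comp b phi F G s - comp b phi F' G s.
Proof. by rewrite (compDl b phi F (fun t => - F' t)) compNl. Qed.

Lemma compBr b phi F G G' s : multiadd F ->
  comp b phi F (fun t => G t - G' t) s = comp b phi F G s - comp b phi F G' s.
Proof. by move=> hF; rewrite (compDr b phi G (fun t => - G' t)) // compNr. Qed.

Lemma comp_multiadd b phi F G : addf phi -> multiadd F -> multiadd G ->
  multiadd (comp b phi F G).
Proof.
move=> hphi hF hG s1; elim: s1 b F G hF hG => [|z s1 IHs] b F G hF hG x y s2 /=.
  have -> : comp (~~ b) phi F (contr (x + y) G) s2 =
     comp (~~ b) phi F (contr x G) s2 + comp (~~ b) phi F (contr y G) s2.
    by rewrite -compDr //; apply: comp_ext => // t; apply: (hG [::]).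
  have -> : comp b phi (contr (phi (x + y)) F) G s2 =
     comp b phi (contr (phi x) F) G s2 + comp b phi (contr (phi y) F) G s2.
    by rewrite -compDl; apply: comp_ext => // t; rewrite hphi; apply: (hF [::]).
  by rewrite sgD; zm.
rewrite !IHs ?sgD //; try exact: multiadd_contr.
by zm.
Qed.

Lemma contr_swap F x y s : altern F -> contr x (contr y F) s = - contr y (contr x F) s.
Proof. by move=> h; apply: (h [::]). Qed.

(** If both arguments go to the same map, its own alternation applies. The two terms that separate
    them are interchanged, with opposite signs because [b] flips when an argument goes to [G]. *)
Lemma comp_altern b phi F G : multiadd F -> altern F -> altern G ->
  altern (comp b phi F G).
Proof.
move=> hM hF hG s1; elim: s1 b F G hM hF hG => [|z s1 IHs] b F G hM hF hG x y s2 /=.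
  rewrite (@comp_ext _ _ phi F F (contr y (contr x G)) (fun t => - contr x (contr y G) t)) //; last first.
    by move=> t; apply: contr_swap.
  rewrite (@comp_ext _ _ phi (contr (phi y) (contr (phi x) F))
     (fun t => - contr (phi x) (contr (phi y) F) t) G G) //; last first.
    by move=> t; apply: contr_swap.
  rewrite compNr // compNl.
  by case: b => /=; zm.
rewrite !(fun b F G h1 h2 h3 => IHs b F G h1 h2 h3 x y) ?sgN //;
  try by [apply: multiadd_contr | apply: altern_contr].
by zm.
Qed.

(** The value of [G] fills one slot of [F], hence the successor. *)
Lemma comp_arity b phi F G i j p q : multiadd F -> arity i p F -> arity j q G ->
  forall s, (size s + i + j).+1 != (p + q)%N -> comp b phi F G s = 0.
Proof.
move=> hM hF hG s; elim: s b F G i j hM hF hG => [|x s IHs] b F G i j hM hF hG /= hs.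
  case: (eqVneq (size (@nil X) + j)%N q) => [ej|/hG->]; last first.
    by apply: (@addf0 _ _ (fun z => F [:: z])) => y z; apply: (hM [::]).
  by apply: hF => /=; apply: contraNN hs => /eqP <-; rewrite -ej; apply/eqP => /=; lia.
rewrite (IHs _ _ _ i j.+1) ?(IHs _ _ _ i.+1 j) ?sg0 ?subr0 //.
- exact: multiadd_contr.
- exact: arity_contr.
- by apply: contraNN hs => /eqP <-; apply/eqP; lia.
- exact: arity_contr.
- by apply: contraNN hs => /eqP <-; apply/eqP; lia.
Qed.

Lemma comp_twist b phi gam F G s :
  (forall x, gam (phi x) = phi (gam x)) -> addf gam ->
  (forall s, gam (F s) = F (map gam s)) -> (forall s, gam (G s) = G (map gam s)) ->
  gam (comp b phi F G s) = comp b phi F G (map gam s).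
Proof.
move=> hp hg.
(* Contraction turns equivariance into a relation between [contr x F] and [contr (gam x) F], so the
   induction runs over pairs of maps. *)
suff aux : forall s b F F' G G', (forall s, gam (F s) = F' (map gam s)) ->
   (forall s, gam (G s) = G' (map gam s)) ->
   gam (comp b phi F G s) = comp b phi F' G' (map gam s) by exact: aux.
elim=> [|x s' IHs] b' F1 F' G1 G' h1 h2 /=; first by rewrite h1 /= h2.
rewrite hg (addfN hg) (addf_sg hg) (IHs _ _ F' _ (contr (gam x) G')) //.
  by rewrite (IHs _ _ (contr (phi (gam x)) F') _ G') // => t; rewrite h1 /= hp.
by move=> t; rewrite h2.
Qed.

Definition slotlin (m : X -> X) F :=
  forall s1 x s2, F (s1 ++ m x :: s2) = m (F (s1 ++ x :: s2)).

Lemma comp_slotlin m b phi F G : addf m -> (forall x, phi (m x) = m (phi x)) ->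
  slotlin m F -> slotlin m G -> slotlin m (comp b phi F G).
Proof.
move=> mD mphi hF hG s1; elim: s1 b F G hF hG => [|y s1 IHs] b F G hF hG x s2 /=.
  rewrite mD (addfN mD) (addf_sg mD); congr (_ - sg b _).
    rewrite -(@compMr m m) //; first by apply: comp_ext => // t; apply: (hG [::]).
  rewrite -(@compMl m) //; apply: comp_ext => // t; rewrite /contr mphi; exact: (hF [::]).
rewrite mD (addfN mD) (addf_sg mD).
rewrite !IHs // => t1; [exact: (hF (phi y :: t1)) | exact: (hG (y :: t1))].
Qed.

Section Weights.
Variable W : int -> X -> Prop.
Hypothesis W0 : forall k, W k 0.
Hypothesis WB : forall k x y, W k x -> W k y -> W k (x - y).

(** [F] lowers the total weight by [w]. The weights are listed along with the elements because an
    element need not determine its weight: 0 has all of them. *)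
Definition shifts w F := forall ps : seq (int * X),
  (forall p, p \in ps -> W p.1 p.2) -> W (\sum_(p <- ps) p.1 - w) (F (map snd ps)).

Lemma contr_shifts w k x F : W k x -> shifts w F -> shifts (w - k) (contr x F).
Proof.
move=> hx hF ps hps.
have := hF ((k, x) :: ps); rewrite big_cons /= (_ : _ + _ - w = \sum_(p <- ps) p.1 - (w - k)).
  by apply=> p; rewrite inE => /orP[/eqP->|/hps].
by rewrite opprB addrCA addrA addrAC.
Qed.

Lemma comp_shifts b phi w v F G : (forall k x, W k x -> W k (phi x)) ->
  shifts w F -> shifts v G -> shifts (w + v) (comp b phi F G).
Proof.
move=> hphi hF hG ps; elim: ps b w v F G hF hG => [|[k x] ps IHs] b w v F G hF hG hps /=.
  rewrite big_nil add0r.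
  (* Contraction by an element of weight k lowers the shift by k; with no arguments left, the value
     of [G] has weight - v. *)
  have := hF [:: (- v, G [::])]; rewrite big_seq1 /= opprD addrC; apply=> p.
  rewrite inE => /eqP -> /=.
  by have := hG [::]; rewrite big_nil add0r; apply=> ?; rewrite in_nil.
have hx : W k x by apply: (hps (k, x)); rewrite inE eqxx.
have {}hps p : p \in ps -> W p.1 p.2 by move=> hp; apply: hps; rewrite inE hp orbT.
rewrite big_cons /=.
have e1 : k + \sum_(j <- ps) j.1 - (w + v) = \sum_(j <- ps) j.1 - (w + (v - k)) by lia.
have e2 : k + \sum_(j <- ps) j.1 - (w + v) = \sum_(j <- ps) j.1 - ((w - k) + v) by lia.
apply: WB; first by rewrite e1; apply: IHs => //; apply: contr_shifts.
have h : W (k + \sum_(j <- ps) j.1 - (w + v)) (comp b phi (contr (phi x) F) G (map snd ps)).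
  by rewrite e2; apply: IHs => //; apply: contr_shifts => //; apply: hphi.
by case: b {hF hG} h => //= h; have := WB (W0 _) h; rewrite sub0r.
Qed.
End Weights.

(* The associator of [comp] is graded symmetric in its last two arguments.  The
   contractions of an equivariant map are no longer equivariant, hence the pairs
   [G], [G'] and [H], [H']. *)
Lemma comp_assoc b c phi psi F G G' H H' s :
  addf phi -> addf psi -> (forall x, phi (psi x) = psi (phi x)) ->
  multiadd F -> altern F -> multiadd G' -> multiadd H' ->
  parity b G -> parity b G' -> parity c H -> parity c H' ->
  (forall t, psi (G t) = G' (map psi t)) -> (forall t, phi (H t) = H' (map phi t)) ->
  comp c psi (comp b phi F G') H s
  - comp (~~ (b (+) c)) (phi \o psi) F (comp c psi G' H) s =
  sg (~~ b && ~~ c) (comp b phi (comp c psi F H') G s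
  - comp (~~ (b (+) c)) (phi \o psi) F (comp b phi H' G) s).
Proof.
move=> hphi hpsi hC.
elim: s b c F G G' H H' => [|x s IHs] b c F G G' H H' hF aF hG hH pG pG' pH pH' eG eH /=.
  (* With no arguments left the nested insertions cancel, and only [F] at the values [G' [::]] and
     [H' [::]] survives. By parity this vanishes unless [b] and [c] are both false, and then
     alternation of [F] matches the two sides. *)
  have := eG [::]; have := eH [::]; rewrite /= /contr => -> ->.
  rewrite !(aF [::] (G' [::])).
  case: (boolP b) pG' => hb pG'.
    rewrite (pG' [::]) // (_ : F [:: H' [::]; 0] = 0); last first.
      by apply: (@addf0 _ _ (fun z => F [:: H' [::]; z])) => y z; apply: (hF [:: H' [::]]).
    by rewrite /=; case: c {pH pH'} => /=; zm.
  case: (boolP c) pH' => hc pH' /=; last by zm.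
  rewrite (pH' [::]) // (_ : F [:: 0; G' [::]] = 0); last first.
    by apply: (@addf0 _ _ (fun z => F [:: z; G' [::]])) => y z; apply: (hF [::]).
  by zm.
have E1 b' c' phi' psi' F1 G1 H1 y : comp c' psi' (contr y (comp b' phi' F1 G1)) H1 s =
    comp c' psi' (comp (~~ b') phi' F1 (contr y G1)) H1 s
    - sg b' (comp c' psi' (comp b' phi' (contr (phi' y) F1) G1) H1 s).
  rewrite -comp_sgl -compBl; exact: comp_ext.
have E2 b' c' phi' psi' F1 G1 H1 y : multiadd F1 ->
    comp b' phi' F1 (contr y (comp c' psi' G1 H1)) s =
    comp b' phi' F1 (comp (~~ c') psi' G1 (contr y H1)) s
    - sg c' (comp b' phi' F1 (comp c' psi' (contr (psi' y) G1) H1) s).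
  by move=> h; rewrite -comp_sgr // -compBr //; exact: comp_ext.
rewrite !E1 !E2 //.
(* The three instances send [x] to [H], to [G] and to [F]. In the last case it arrives twisted by
   both [phi] and [psi], in an order that depends on the side; they commute. *)
have I1 := IHs b (~~ c) F G G' (contr x H) (contr (phi x) H').
have I2 := IHs (~~ b) c F (contr x G) (contr (psi x) G') H H'.
have I3 := IHs b c (contr (phi (psi x)) F) G G' H H'.
move: I1 I2 I3; rewrite -!hC.
move=> /(_ hF aF hG (multiadd_contr _ hH) pG pG' (parity_contr _ pH) (parity_contr _ pH') eG (fun t => eH (x :: t))) I1.
move=> /(_ hF aF (multiadd_contr _ hG) hH (parity_contr _ pG) (parity_contr _ pG') pH pH' (fun t => eG (x :: t)) eH) I2.
move=> /(_ (multiadd_contr _ hF) (altern_contr _ aF) hG hH pG pG' pH pH' eG eH) I3.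
move: I1 I2 I3; rewrite !addbN !addNb !negbK /=.
clear => I1 I2 I3.
transitivity ((comp (~~ c) psi (comp b phi F G') (contr x H) s
   - comp (b (+) c) (phi \o psi) F (comp (~~ c) psi G' (contr x H)) s)
  - sg c (comp c psi (comp (~~ b) phi F (contr (psi x) G')) H s
     - comp (b (+) c) (phi \o psi) F (comp c psi (contr (psi x) G') H) s)
  + sg (b (+) c) (comp c psi (comp b phi (contr (phi (psi x)) F) G') H s
  - comp (~~ (b (+) c)) (phi \o psi) (contr (phi (psi x)) F) (comp c psi G' H) s)).
  by case: b I1 I2 I3; case: c => /= *; zm.
by rewrite I1 I2 I3; case: b I1 I2 I3; case: c => /= *; zm.
Qed.
End SeqFunctions.

(** * Alternating maps and derived brackets *)

Section GradedBracket.
Variables (X : zmodType) (gam : X -> X).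
Hypothesis gamD : addf gam.
Implicit Types (F G H : seq X -> X) (s : seq X) (m n k : nat).

(** [m] is the arity minus one, the degree in which insertion is additive. *)
Record alt_map m F : Prop := AltMap {
  alt_add : multiadd F;
  alt_alt : altern F;
  alt_arity : arity 0 m.+1 F;
  alt_gam : forall s, gam (F s) = F (map gam s) }.

(** [G] has n + 1 arguments: this gives the initial parity, and the exponent n of the twist. *)
Definition pcirc n F G : seq X -> X := comp (~~ odd n) (iter n gam) F G.
Definition pnr m n F G : seq X -> X := fun s =>
  pcirc n F G s - sg (odd m && odd n) (pcirc m G F s).

Lemma addf_iter n : addf (iter n gam).
Proof. by elim: n => [|n IHn] x y //=; rewrite IHn gamD. Qed.

Lemma iter_commute n x : gam (iter n gam x) = iter n gam (gam x).
Proof. by rewrite -iterS iterSr. Qed.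

Lemma alt_map_iter m F n s : alt_map m F ->
  iter n gam (F s) = F (map (iter n gam) s).
Proof.
move=> hF; elim: n => [|n IHn] /=; first by rewrite map_id.
by rewrite IHn (alt_gam hF) -map_comp.
Qed.

Lemma alt_map0 m : alt_map m (fun=> 0).
Proof.
split=> //.
- by move=> s1 x y s2; rewrite addr0.
- by move=> s1 x y s2; rewrite oppr0.
- by move=> s; rewrite (addf0 gamD).
Qed.

Lemma alt_map_sg m b F : alt_map m F -> alt_map m (fun s => sg b (F s)).
Proof.
move=> [h1 h2 h3 h4]; split.
- by move=> s1 x y s2; rewrite h1 sgD.
- by move=> s1 x y s2; rewrite h2 sgN.
- by move=> s hs; rewrite h3 ?sg0.
- by move=> s; rewrite (addf_sg gamD) h4.
Qed.

Lemma alt_mapD m F G : alt_map m F -> alt_map m G -> alt_map m (fun s => F s + G s).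
Proof.
move=> [h1 h2 h3 h4] [k1 k2 k3 k4]; split.
- by move=> s1 x y s2; rewrite h1 k1; zmodule.
- by move=> s1 x y s2; rewrite h2 k2; zmodule.
- by move=> s hs; rewrite h3 ?k3 ?addr0.
- by move=> s; rewrite gamD h4 k4.
Qed.

Lemma pcirc_alt m n F G : alt_map m F -> alt_map n G ->
  alt_map (m + n) (pcirc n F G).
Proof.
move=> [h1 h2 h3 h4] [k1 k2 k3 k4]; split.
- by apply: comp_multiadd => //; apply: addf_iter.
- exact: comp_altern.
- move=> s hs; apply: (comp_arity (i := 0) (j := 0) _ _ h1 h3 k3).
  by apply: contraNN hs => /eqP h; apply/eqP; lia.
- by move=> s; apply: comp_twist => // x; rewrite iter_commute.
Qed.

Lemma pnr_alt m n F G : alt_map m F -> alt_map n G -> alt_map (m + n) (pnr m n F G).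
Proof.
move=> hF hG.
have h : alt_map (m + n) (pcirc m G F) by rewrite addnC; apply: pcirc_alt.
exact: (alt_mapD (pcirc_alt hF hG) (alt_map_sg true (alt_map_sg (odd m && odd n) h))).
Qed.

Lemma pcirc_assoc m n k F G H s : alt_map m F -> alt_map n G -> alt_map k H ->
  pcirc k (pcirc n F G) H s - pcirc (n + k) F (pcirc k G H) s =
  sg (odd n && odd k)
    (pcirc n (pcirc k F H) G s - pcirc (n + k) F (pcirc n H G) s).
Proof.
move=> hF hG hH.
have e F1 G1 t : pcirc (n + k) F1 G1 t =
    comp (~~ (~~ odd n (+) ~~ odd k)) (iter n gam \o iter k gam) F1 G1 t.
  rewrite /pcirc oddD addNb addbN negbK; apply: comp_ext => // x.
  by rewrite iterD.
have par m' F' : alt_map m' F' -> parity (~~ odd m') F'.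
  by move=> h; apply: (arity_parity (p := m'.+1)); case: h.
rewrite !e.
(* Uncontracted maps are equivariant, so each one serves as its own primed partner. *)
have := @comp_assoc _ (~~ odd n) (~~ odd k) (iter n gam) (iter k gam) F G G H H s.
rewrite !negbK; apply; try exact: addf_iter; try exact: par; try by [case: hF|case: hG|case: hH].
- by move=> x; rewrite -!iterD addnC.
- by move=> t; apply: alt_map_iter hG.
- by move=> t; apply: alt_map_iter hH.
Qed.

Lemma pnr_skew m n F G s : pnr m n F G s = - sg (odd m && odd n) (pnr n m G F s).
Proof. by rewrite /pnr andbC; case: andb => /=; zmodule. Qed.

Lemma pcircBl n b F F' G s :
  pcirc n (fun t => F t - sg b (F' t)) G s = pcirc n F G s - sg b (pcirc n F' G s).
Proof. by rewrite /pcirc compBl comp_sgl. Qed.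

Lemma pcircBr n b F G G' s : multiadd F ->
  pcirc n F (fun t => G t - sg b (G' t)) s = pcirc n F G s - sg b (pcirc n F G' s).
Proof. by move=> h; rewrite /pcirc compBr // comp_sgr. Qed.

(** The commutator of a graded pre-Lie product is a Lie bracket: the identity is a signed sum of the
    associator symmetries with [F], [G] and [H] in turn as the outer map. *)
Lemma pnr_jacobi m n k F G H s : alt_map m F -> alt_map n G -> alt_map k H ->
  pnr m (n + k) F (pnr n k G H) s =
  pnr (m + n) k (pnr m n F G) H s +
  sg (odd m && odd n) (pnr n (m + k) G (pnr m k F H) s).
Proof.
move=> hF hG hH.
have a1 := pcirc_assoc s hF hG hH.
have a2 := pcirc_assoc s hG hF hH.
have a3 := pcirc_assoc s hH hF hG.
have mF := alt_add hF; have mG := alt_add hG; have mH := alt_add hH.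
rewrite /pnr !pcircBl !pcircBr //.
have {a1}-> := canRL (subrK _) a1; have {a2}-> := canRL (subrK _) a2.
have {a3}-> := canRL (subrK _) a3.
rewrite !oddD.
by case: (odd m); case: (odd n); case: (odd k); rewrite /=; zmodule.
Qed.

Lemma pnr_ext m n F F' G G' s : (forall t, F t = F' t) -> (forall t, G t = G' t) ->
  pnr m n F G s = pnr m n F' G' s.
Proof. by move=> /funext-> /funext->. Qed.

Lemma pnr_sgr m n b F G s : multiadd F ->
  pnr m n F (fun t => sg b (G t)) s = sg b (pnr m n F G s).
Proof.
move=> h; rewrite /pnr /pcirc comp_sgl comp_sgr //.
by case: b; case: andb => /=; zmodule.
Qed.

Lemma pnr0r m n F s : multiadd F -> pnr m n F (fun=> 0) s = 0.
Proof.
move=> h; have := pnr_sgr m n true (fun=> 0) s h.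
have := compDr (~~ odd n) (iter n gam) (fun=> 0) (fun=> 0) s h.
have := compDl (~~ odd m) (iter m gam) (fun=> 0) (fun=> 0) F s.
rewrite /pnr /pcirc.
have -> : (fun _ : seq X => 0 + 0 : X) = (fun=> 0) by apply/funext => t; rewrite addr0.
move=> e1 e2 _; rewrite -(addrI _ (etrans (addr0 _) e1)) -(addrI _ (etrans (addr0 _) e2)).
by rewrite sg0 subr0.
Qed.

Lemma pnr0l m n G s : multiadd G -> pnr m n (fun=> 0) G s = 0.
Proof. by move=> h; rewrite pnr_skew pnr0r // sg0 oppr0. Qed.

Lemma pcirc_pair P a b c : alt_map 1 P ->
  pcirc 1 P P [:: a; b; c] =
    P [:: P [:: a; b]; gam c] - P [:: P [:: a; c]; gam b] + P [:: P [:: b; c]; gam a].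
Proof.
move=> [PD PA PZ _].
have z1 x : P [:: x] = 0 by apply: PZ.
have z3 x y z : P [:: x; y; z] = 0 by apply: PZ.
rewrite /pcirc /= /contr /= !z1 !z3 (PA [::] (gam a)) (PA [::] (gam b)) (PA [::] (gam c)).
by rewrite (PZ [:: _; _; _; _]) //=; zmodule.
Qed.

Lemma pnr_morphr (f : X -> X) m n F G s : addf f -> slotlin f F ->
  pnr m n F (fun t => f (G t)) s = f (pnr m n F G s).
Proof.
move=> fD fF; rewrite /pnr /pcirc (compMl _ _ _ _ _ fD) (@compMr _ f f) //.
by rewrite fD (addfN fD) (addf_sg fD).
Qed.

Lemma pnrDr m n F G G' s : multiadd F ->
  pnr m n F (fun t => G t + G' t) s = pnr m n F G s + pnr m n F G' s.
Proof. by move=> FD; rewrite /pnr /pcirc compDl compDr // sgD; zmodule. Qed.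

Lemma pnr_pair P F u v : alt_map 1 P -> alt_map 0 F ->
  pnr 1 0 P F [:: u; v] = P [:: F [:: u]; v] + P [:: u; F [:: v]] - F [:: P [:: u; v]].
Proof.
move=> [PD PA PZ _] [FD _ FZ _].
have z1 x : P [:: x] = 0 by apply: PZ.
have z3 x y z : P [:: x; y; z] = 0 by apply: PZ.
have f2 x y : F [:: x; y] = 0 by apply: FZ.
have f3 x y z : F [:: x; y; z] = 0 by apply: FZ.
rewrite /pnr /pcirc /= /contr /= !z1 !z3 !f2 !f3 (PA [::] (F _)) /=.
by zmodule.
Qed.

(** * The bracket derived from an element of square zero *)

Section Derived.
Variable P : seq X -> X.
Hypothesis hP : alt_map 1 P.
Hypothesis PP : forall s, pnr 1 1 P P s = 0.
Hypothesis two : forall x : X, x + x = 0 -> x = 0.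

(* [p] and [q] are the arities, whereas [pnr] is indexed by arities minus one *)
Definition pder p q F G : seq X -> X := fun s =>
  sg (odd p) (pnr p q.-1 (pnr 1 p.-1 P F) G s).

(** [P] has odd degree, so Jacobi reads [P, [P, F]] = [[P, P], F] - [P, [P, F]], that is 2 [P,
    [P, F]] = 0. *)
Lemma pnr_square m F s : alt_map m F -> pnr 1 m.+1 P (pnr 1 m P F) s = 0.
Proof.
move=> hF; apply: two.
have := pnr_jacobi s hP hP hF; rewrite add1n /= => {1}->.
rewrite (pnr_ext _ _ _ (G' := F) PP) // pnr0l; last by case: hF.
by rewrite add0r addNr.
Qed.

(** As [F, G] = 0, the Jacobi identity for [P], [F], [G] gives [[P, F], G] = ± [F, [P, G]], and skew
    symmetry of the ambient bracket reorders the right side. *)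
Lemma pder_skew p q F G s : (0 < p)%N -> (0 < q)%N ->
  alt_map p.-1 F -> alt_map q.-1 G -> (forall t, pnr p.-1 q.-1 F G t = 0) ->
  pder p q F G s = - sg (odd p && odd q) (pder q p G F s).
Proof.
case: p q => // p [] // q _ _ hF hG FG; rewrite /pder /=.
have := pnr_jacobi s hP hF hG.
rewrite (pnr_ext _ _ _ (F' := P) _ FG) // pnr0r ?add1n; last by case: hP.
rewrite (pnr_skew p) /=.
by case: (odd p); case: (odd q) => /= /esym /eqP; rewrite addr_eq0 => /eqP ->; zmodule.
Qed.

(** [P, -] is a differential and maps the derived bracket of [F] and [G], up to sign, to [[P, F],
    [P, G]]. The claim thereby becomes the ambient Jacobi identity for [P, F], [P, G] and [H]. *)
Lemma pder_jacobi p q r F G H s : (0 < p)%N -> (0 < q)%N -> (0 < r)%N ->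
  alt_map p.-1 F -> alt_map q.-1 G -> alt_map r.-1 H ->
  pder p (q + r) F (pder q r G H) s =
  pder (p + q) r (pder p q F G) H s +
  sg (odd p && odd q) (pder q (p + r) G (pder p r F H) s).
Proof.
case: p q r => // p [] // q [] // r _ _ _ hF hG hH.
have dF := pnr_alt hP hF; have dG := pnr_alt hP hG; have dH := pnr_alt hP hH.
rewrite add1n in dF dG dH.
have e : forall t, pnr 1 (p + q).+1 P (pder p.+1 q.+1 F G) t =
     pnr p.+1 q.+1 (pnr 1 p P F) (pnr 1 q P G) t.
  move=> t; rewrite pnr_sgr; last by case: hP.
  have := pnr_jacobi t hP dF hG; rewrite addSn add1n /= => ->.
  rewrite (pnr_ext _ _ _ (G' := G) (fun t => pnr_square t hF)) // pnr0l; last by case: hG.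
  by rewrite add0r sgA addbb.
rewrite /pder !addSn !addnS /= (pnr_ext _ _ _ (G' := H) e) //.
rewrite !pnr_sgr; try by [case: dF | case: dG].
have := pnr_jacobi s dF dG hH; rewrite !addSn !addnS => /= ->.
rewrite !oddD /=.
by case: (odd p); case: (odd q) => /=; zmodule.
Qed.
End Derived.
End GradedBracket.

(** * Polynomials with vector coefficients *)

(* [mulu] and [mono] are locked, since deciding by conversion that two monomials
   differ does not terminate in practice *)
HB.lock Definition mulu n (k : 'X_{1..n}) (i : 'I_n) : 'X_{1..n} := mmul k (ucm i).

Lemma muluE n (k : 'X_{1..n}) i j : mulu k i j = (k j + (i == j))%N.
Proof. by rewrite unlock cmM cmU. Qed.

Lemma muluC n (k : 'X_{1..n}) i j : mulu (mulu k i) j = mulu (mulu k j) i.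
Proof. by apply/eqP/cmP => l; rewrite !muluE addnAC. Qed.

HB.lock Definition mono (G : zmodType) (I : choiceType) (k : I) (c : G) : {malg G[I]} :=
  << c *g k >>.

Section LinearExtension.
Variables (G : zmodType) (I : choiceType) (U : zmodType).
Implicit Types (h : G -> I -> U) (g : {malg G[I]}).

Definition lext h g : U := \sum_(k <- msupp g) h g@_k k.
Definition coefD h := forall k, addf (h^~ k).

Lemma lextEw h g (d : {fset I}) : coefD h -> (msupp g `<=` d)%fset ->
  lext h g = \sum_(k <- d) h g@_k k.
Proof.
move=> hD le; rewrite /lext (big_fset_incl _ le) // => k _ hk.
by rewrite mcoeff_outdom // (addf0 (hD k)).
Qed.

Lemma lextU h c k : coefD h -> lext h (mono k c) = h c k.
Proof.
by move=> hD; rewrite mono.unlock (lextEw hD msuppU_le) big_seq_fset1 mcoeffUU.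
Qed.

Lemma lextD h : coefD h -> addf (lext h).
Proof.
move=> hD x y.
rewrite (lextEw hD (msuppD_le x y)) (lextEw hD (fsubsetUl (msupp x) (msupp y))).
rewrite (lextEw hD (fsubsetUr (msupp x) (msupp y))) -big_split /=.
by apply: eq_bigr => k _; rewrite mcoeffD hD.
Qed.

Lemma lext_ext h h' g : (forall c k, h c k = h' c k) -> lext h g = lext h' g.
Proof. by move=> e; apply: eq_bigr => k _; apply: e. Qed.

Lemma lextDl h h' g : lext (fun c k => h c k + h' c k) g = lext h g + lext h' g.
Proof. by rewrite /lext -big_split. Qed.

Lemma malg_eq (f f' : {malg G[I]} -> U) g : addf f -> addf f' ->
  (forall c k, f (mono k c) = f' (mono k c)) -> f g = f' g.
Proof.
move=> fD fD' e; rewrite [g]monalgE (addf_sum fD) (addf_sum fD').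
by apply: eq_bigr => k _; have := e g@_k k; rewrite mono.unlock.
Qed.
End LinearExtension.

Lemma lext_morph (G : zmodType) (I : choiceType) (U V : zmodType) (m : U -> V)
    (h : G -> I -> U) (g : {malg G[I]}) : addf m ->
  m (lext h g) = lext (fun c k => m (h c k)) g.
Proof. by move=> mD; rewrite /lext (addf_sum mD). Qed.

Lemma addf_malgU (G : zmodType) (I : choiceType) (k : I) :
  addf (fun c : G => mono k c : {malg G[I]}).
Proof. by rewrite mono.unlock => x y; apply: monalgUD. Qed.

Lemma addf_comp' (U V W : zmodType) (f : V -> W) (g : U -> V) :
  addf f -> addf g -> addf (fun x => f (g x)).
Proof. by move=> fD gD x y /=; rewrite gD fD. Qed.

Lemma addf_iter' (U : zmodType) (A : U -> U) n : addf A -> addf (iter n A).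
Proof. by move=> AD; elim: n => [|n IHn] x y //=; rewrite IHn AD. Qed.

Lemma addf_add (U V : zmodType) (f g : U -> V) :
  addf f -> addf g -> addf (fun x => f x + g x).
Proof. by move=> fD gD x y; rewrite fD gD addrACA. Qed.

Lemma addf_opp (U V : zmodType) (f : U -> V) : addf f -> addf (fun x => - f x).
Proof. by move=> fD x y; rewrite fD opprD. Qed.

Lemma addf_bigsum (U V : zmodType) (I : Type) (r : seq I) (P : pred I) (f : I -> U -> V) :
  (forall i, addf (f i)) -> addf (fun x => \sum_(i <- r | P i) f i x).
Proof. by move=> fD x y; rewrite -big_split; apply: eq_bigr => i _; rewrite fD. Qed.

Lemma addf_linear (K : pzRingType) (U V : lmodType K) (f : U -> V) : linear f -> addf f.
Proof. by move=> h x y; have := h 1 x y; rewrite !scale1r. Qed.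

Section Substitution.
Variables (K : fieldType) (n : nat).

Lemma polCE (W : lmodType K) (c : W) : polC n c = mono (mone : 'X_{1..n}) c.
Proof. by rewrite mono.unlock. Qed.

Section Basic.
Variable W : lmodType K.
Implicit Types (P Q : pol n W).

Lemma mapcU (W' : lmodType K) (F : W -> W') c k : addf F ->
  mapc F (mono k c : pol n W) = mono k (F c).
Proof.
move=> FD; apply/malgP => j; rewrite mono.unlock mapcE ?(addf0 FD) // !mcoeffU.
by case: eqP; rewrite ?mulr1n ?mulr0n ?(addf0 FD).
Qed.

Lemma addf_mapc (W' : lmodType K) (F : W -> W') : addf F -> addf (@mapc K n W W' F).
Proof.
move=> FD P Q; apply/malgP => j.
by rewrite mcoeffD !mapcE ?(addf0 FD) // mcoeffD FD.
Qed.

Lemma mapc_polC (W' : lmodType K) (F : W -> W') c : addf F ->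
  mapc F (polC n c) = polC n (F c).
Proof. by move=> FD; rewrite !polCE mapcU //. Qed.

Lemma mapc_comp (W' W'' : lmodType K) (F : W' -> W'') (F' : W -> W') P :
  addf F -> addf F' -> mapc F (mapc F' P) = mapc (F \o F') P.
Proof.
move=> h h'; apply/malgP => j; have h0 := addf0 h; have h0' := addf0 h'.
by rewrite !mapcE //= h0' h0.
Qed.

Lemma mapc_ext (W' : lmodType K) (F F' : W -> W') P :
  (forall c, F c = F' c) -> mapc F P = mapc F' P.
Proof. by move=> /funext ->. Qed.

Lemma addf_polC : addf (@polC K n W).
Proof. by move=> x y; rewrite !polCE addf_malgU. Qed.

Lemma mulXE i P : mulX i P = lext (fun c k => mono (mulu k i) c) P.
Proof. by rewrite unlock; apply: eq_bigr => k _; rewrite mono.unlock mulu.unlock. Qed.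

Lemma addf_mulX i : addf (@mulX K n W i).
Proof.
move=> P Q; rewrite !mulXE; apply: lextD => k; exact: addf_malgU.
Qed.

Lemma mulXU i c k : mulX i (mono k c : pol n W) = mono (mulu k i) c.
Proof. by rewrite mulXE lextU // => j; exact: addf_malgU. Qed.

Lemma mulXC i j P : mulX i (mulX j P) = mulX j (mulX i P).
Proof.
apply: (@malg_eq _ _ _ (fun P : pol n W => mulX i (mulX j P))
    (fun P => mulX j (mulX i P))) => [||c k].
- by apply: addf_comp'; exact: addf_mulX.
- by apply: addf_comp'; exact: addf_mulX.
by rewrite !mulXU muluC.
Qed.

End Basic.

Lemma mulX_mapc (W W' : lmodType K) (F : W -> W') i (P : pol n W) : addf F ->
  mapc F (mulX i P) = mulX i (mapc F P).
Proof.
move=> FD; apply: (@malg_eq _ _ _ (fun P => mapc F (mulX i P))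
    (fun P => mulX i (mapc F P))) => [||c k].
- exact: (addf_comp' (addf_mapc FD) (@addf_mulX W i)).
- exact: (addf_comp' (@addf_mulX W' i) (addf_mapc FD)).
by rewrite mulXU !mapcU // mulXU.
Qed.

Section Operators.
Variables (W : lmodType K) (U : zmodType).
Variables (A : 'I_n -> U -> U).
Hypothesis AD : forall i, addf (A i).
Implicit Types (F : W -> U) (P : pol n W).

(** The exponent is a bare function, so that it may come from a monomial of [pol] as well as from
    the x-part of a key. *)
Definition opmon (k : 'I_n -> nat) (u : U) : U :=
  foldr (fun i => iter (k i) (A i)) u (enum 'I_n).

Lemma substE F P : subst A F P = lext (fun c (k : 'X_{1..n}) => opmon k (F c)) P.
Proof. by rewrite unlock. Qed.

Lemma addf_opmon k : addf (opmon k).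
Proof.
rewrite /opmon => x y; elim: (enum 'I_n) => //= i s ->.
exact: addf_iter'.
Qed.

Lemma substU F c k : addf F -> subst A F (mono (k : 'X_{1..n}) c) = opmon k (F c).
Proof.
move=> FD; rewrite substE lextU // => j x y.
by rewrite FD addf_opmon.
Qed.

Lemma addf_subst F : addf F -> addf (@subst K n W U A F).
Proof.
move=> FD P Q; rewrite !substE; apply: lextD => j x y.
by rewrite FD addf_opmon.
Qed.

Lemma subst_polC F c : addf F -> subst A F (polC n c) = F c.
Proof.
move=> FD; rewrite polCE substU // /opmon.
by elim: (enum 'I_n) => //= i s ->; rewrite cm1.
Qed.

Hypothesis AC : forall i j u, A i (A j u) = A j (A i u).

Lemma iter_AC i j m u : A i (iter m (A j) u) = iter m (A j) (A i u).
Proof. by elim: m => //= m IHm; rewrite AC IHm. Qed.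

Lemma opmonX (k k' : 'I_n -> nat) i u :
  (forall j, k' j = (k j + (i == j))%N) -> opmon k' u = A i (opmon k u).
Proof.
move=> kk'; rewrite /opmon.
have : uniq (enum 'I_n) by apply: enum_uniq.
have : i \in enum 'I_n by rewrite mem_enum.
elim: (enum 'I_n) => //= j s IHs; rewrite inE => /orP[/eqP <-|hi] /andP[js us].
  rewrite kk' eqxx addn1 /=; congr (A i (iter _ _ _)).
  have {us IHs} : i \notin s by [].
  elim: s {js} => //= l s IHs; rewrite inE negb_or => /andP[il si].
  by rewrite IHs // kk' (negPf il) addn0.
rewrite IHs // iter_AC kk'.
by case: eqP hi js => [->->//|]; rewrite addn0.
Qed.

Lemma subst_mulX F i P : addf F -> subst A F (mulX i P) = A i (subst A F P).
Proof.
move=> FD; apply: (@malg_eq _ _ _ (fun P => subst A F (mulX i P))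
    (fun P => A i (subst A F P))) => [||c k].
- by apply: addf_comp'; [apply: addf_subst | apply: addf_mulX].
- by apply: addf_comp' => //; apply: addf_subst.
- by rewrite mulXU !substU //; apply: opmonX => j; rewrite muluE.
Qed.

End Operators.

Section Functoriality.
Variables (W : lmodType K) (U : zmodType).
Implicit Types (F : W -> U) (P : pol n W).

Lemma subst_ext (A A' : 'I_n -> U -> U) F F' P : (forall i u, A i u = A' i u) ->
  (forall c, F c = F' c) -> subst A F P = subst A' F' P.
Proof.
move=> eA /funext->; congr subst; apply/funext => i; apply/funext => u.
exact: eA.
Qed.

Lemma subst_morph (V : zmodType) (m : U -> V) (A : 'I_n -> U -> U) A' F P :
  addf m -> (forall i u, m (A i u) = A' i (m u)) ->
  m (subst A F P) = subst A' (fun c => m (F c)) P.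
Proof.
move=> mD mA; rewrite !substE lext_morph //; apply: lext_ext => c k.
rewrite /opmon; elim: (enum 'I_n) => //= i s <-.
by elim: (k i) => //= j IHj; rewrite mA IHj.
Qed.

Lemma substDl (A : 'I_n -> U -> U) F F' P : (forall i, addf (A i)) ->
  subst A (fun c => F c + F' c) P = subst A F P + subst A F' P.
Proof.
move=> AD; rewrite !substE -lextDl; apply: lext_ext => c k.
exact: addf_opmon.
Qed.

Lemma subst0l (A : 'I_n -> U -> U) P : (forall i, addf (A i)) ->
  subst A (fun=> 0) P = 0.
Proof.
move=> AD; have := @substDl A (fun=> 0) (fun=> 0) P AD.
have -> : (fun _ : W => 0 + 0 : U) = (fun=> 0) by apply/funext => t; rewrite addr0.
by move=> e; rewrite -(addrI _ (etrans (addr0 _) e)).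
Qed.

Lemma subst_mapc (W' : lmodType K) (A : 'I_n -> U -> U) (F : W' -> U) (m : W -> W') P :
  (forall i, addf (A i)) -> addf F -> addf m ->
  subst A F (mapc m P) = subst A (fun c => F (m c)) P.
Proof.
move=> AD FD mD; have FmD : addf (fun c => F (m c)) by apply: addf_comp'.
apply: (@malg_eq _ _ _ (fun P => subst A F (mapc m P))
   (fun P => subst A (fun c => F (m c)) P)) => [||c k].
- by apply: addf_comp'; [apply: addf_subst | apply: addf_mapc].
- exact: addf_subst.
- by rewrite mapcU // !substU.
Qed.

(** [D] is what ∂ becomes after the substitution; the last variable then turns into - \sum_j A_j - D
    like any other expression in the variables and ∂. *)
Lemma subst_lam (dW : W -> W) (A : 'I_n -> U -> U) (D : U -> U) F P (i : 'I_n.+1) :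
  (forall i, addf (A i)) -> (forall i j u, A i (A j u) = A j (A i u)) ->
  addf F -> addf dW -> addf D -> (forall c, F (dW c) = D (F c)) ->
  (forall i u, D (A i u) = A i (D u)) ->
  subst A F (lam dW i P) =
    if unlift ord_max i is Some j then A j (subst A F P)
    else - (\sum_j A j (subst A F P)) - D (subst A F P).
Proof.
move=> AD AC FD dD DD FdW DA; rewrite /lam.
case: unlift => [j|]; first by rewrite subst_mulX.
have SD := addf_subst AD FD.
rewrite SD !(addfN SD) (addf_sum SD).
congr (- _ - _); first by apply: eq_bigr => j _; rewrite subst_mulX.
rewrite subst_mapc // (subst_morph (m := D) (A' := A)) //.
exact: subst_ext.
Qed.

End Functoriality.

Section Lam.
Variables (W : lmodType K) (dW : W -> W).
Hypothesis dD : addf dW.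
Lemma addf_lam i : addf (@lam K n W dW i).
Proof.
rewrite /lam; case: unlift => [j|]; first exact: addf_mulX.
apply: addf_add; apply: addf_opp; last exact: addf_mapc.
by apply: addf_bigsum => j; apply: addf_mulX.
Qed.

Lemma lamC i j (P : pol n W) : lam dW i (lam dW j P) = lam dW j (lam dW i P).
Proof.
have e1 l (Q : pol n W) : lam dW ord_max (mulX l Q) = mulX l (lam dW ord_max Q).
  rewrite /lam unlift_none (addf_mulX (W := W)) !(addfN (@addf_mulX W l)).
  rewrite (addf_sum (@addf_mulX W l)) mulX_mapc //; congr (- _ - _).
  by apply: eq_bigr => m _; rewrite mulXC.
case: (unliftP ord_max i) => [i'|] ->; case: (unliftP ord_max j) => [j'|] -> //.
- by rewrite /lam !liftK mulXC.
- by rewrite {1 4}/lam !liftK e1.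
- by rewrite {2 3}/lam !liftK e1.
Qed.

Lemma lam_mapc (T : W -> W) i (P : pol n W) : addf T -> (forall c, T (dW c) = dW (T c)) ->
  mapc T (lam dW i P) = lam dW i (mapc T P).
Proof.
move=> TD Td; have mD := addf_mapc TD.
rewrite /lam; case: unlift => [j|]; first exact: mulX_mapc.
rewrite mD !(addfN mD) (addf_sum mD); congr (- _ - _).
  by apply: eq_bigr => j _; exact: mulX_mapc.
by rewrite !mapc_comp //; apply: mapc_ext => c; apply: Td.
Qed.
End Lam.
End Substitution.

(** * Coinvariants *)

Section MultilinearExtension.
Variables (G : zmodType) (I : choiceType) (U : zmodType).
Implicit Types (h : seq (G * I) -> U) (s : seq {malg G[I]}) (t : seq (G * I)).

Fixpoint mext h s : U :=
  if s is u :: s' then lext (fun c k => mext (fun t => h ((c, k) :: t)) s') u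
  else h [::].

Definition slotadd h := forall t1 c c' k t2,
  h (t1 ++ (c + c', k) :: t2) = h (t1 ++ (c, k) :: t2) + h (t1 ++ (c', k) :: t2).

Definition item (p : G * I) : {malg G[I]} := (mono (p.2) (p.1)).

Lemma mext_sum (J : Type) (r : seq J) (h : J -> seq (G * I) -> U) s :
  mext (fun t => \sum_(j <- r) h j t) s = \sum_(j <- r) mext (h j) s.
Proof.
elim: s h => //= u s IHs h; rewrite /lext exchange_big /=.
by apply: eq_bigr => k _; rewrite IHs.
Qed.

Lemma mextDl h h' s : mext (fun t => h t + h' t) s = mext h s + mext h' s.
Proof.
elim: s h h' => //= u s IHs h h'; rewrite -lextDl; apply: lext_ext => c k.
by rewrite IHs.
Qed.

Lemma slotadd_cons h p : slotadd h -> slotadd (fun t => h (p :: t)).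
Proof. by move=> hD t1 c c' k t2; apply: (hD (p :: t1)). Qed.

Lemma coefD_mext h s : slotadd h -> coefD (fun c k => mext (fun t => h ((c, k) :: t)) s).
Proof.
by move=> hD k c c'; rewrite -mextDl; congr mext; apply/funext => t; apply: (hD [::]).
Qed.

Lemma mext_add h : slotadd h -> forall s1 x y s2,
  mext h (s1 ++ (x + y) :: s2) = mext h (s1 ++ x :: s2) + mext h (s1 ++ y :: s2).
Proof.
move=> hD s1; elim: s1 h hD => [|u s1 IHs] h hD x y s2 /=.
  by rewrite lextD //; apply: coefD_mext.
rewrite -lextDl; apply: lext_ext => c k; apply: IHs; exact: slotadd_cons.
Qed.

Lemma mext_item h t : slotadd h -> mext h (map item t) = h t.
Proof.
elim: t h => [|[c k] t IHt] h hD //=.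
rewrite lextU ?IHt //; [exact: slotadd_cons | exact: coefD_mext].
Qed.

Lemma mext_morph (m : U -> U) h s : addf m -> m (mext h s) = mext (fun t => m (h t)) s.
Proof.
move=> mD; elim: s h => //= u s IHs h; rewrite lext_morph //.
by apply: lext_ext => c k; rewrite IHs.
Qed.

Lemma mext_alt h : altern h -> altern (mext h).
Proof.
move=> hA s1; elim: s1 h hA => [|u s1 IHs] h hA x y s2 /=.
  rewrite /lext exchange_big /= -sumrN; apply: eq_bigr => k _.
  rewrite -sumrN; apply: eq_bigr => k' _.
  rewrite (mext_morph (m := -%R)); last exact: addf_opp.
  by congr mext; apply/funext => t; apply: (hA [::]).
rewrite (lext_morph (m := -%R)); last exact: addf_opp.
apply: lext_ext => c k; apply: IHs => t1; exact: (hA ((c, k) :: t1)).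
Qed.

Lemma lext_mext h s w :
  lext (fun c k => mext (fun t => h ((c, k) :: t)) s) w =
  mext (fun t => lext (fun c k => h ((c, k) :: t)) w) s.
Proof. by rewrite /lext mext_sum. Qed.

(** An exchange of an operator in one slot with one on the values need only be checked on monomials.
    It serves for the total derivation (with [m] zero), for scalars and for the x_j. *)
Lemma mext_slot h (T : {malg G[I]} -> {malg G[I]}) (m : U -> U) : slotadd h ->
  addf T -> addf m ->
  (forall t1 c k t2, lext (fun c' k' => h (t1 ++ (c', k') :: t2)) (T (mono k c)) =
     m (h (t1 ++ (c, k) :: t2))) ->
  forall s1 u s2, mext h (s1 ++ T u :: s2) = m (mext h (s1 ++ u :: s2)).
Proof.
move=> hD TD mD hT s1; elim: s1 h hD hT => [|v s1 IHs] h hD hT u s2 /=; last first.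
  rewrite lext_morph //; apply: lext_ext => c k; apply: IHs; first exact: slotadd_cons.
  move=> t1; exact: (hT ((c, k) :: t1)).
have LD : addf (lext (fun c k => mext (fun t => h ((c, k) :: t)) s2)).
  by apply: lextD; apply: coefD_mext.
apply: (malg_eq (f := fun u => lext _ (T u)) (f' := fun u => m (lext _ u))) => [||c k].
- exact: addf_comp' LD TD.
- exact: addf_comp' mD LD.
rewrite lext_mext lextU; last exact: coefD_mext.
rewrite mext_morph //; congr mext; apply/funext => t; exact: (hT [::]).
Qed.

End MultilinearExtension.

Lemma addf_scale (K : pzRingType) (V : lmodType K) (a : K) : addf (fun v : V => a *: v).
Proof. by move=> x y; rewrite scalerDr. Qed.

(** * The cokernel of ∂ + D *)

Section Coinvariants.
Variables (K : fieldType) (E : lmodType K) (dE : E -> E) (N : nat).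

(* [mono (a, b) c] stands for c x^a y^b, and [tau] for the total derivation
   extending ∂ by y_j |-> x_j y_j; [coinv] is its cokernel. *)
Definition expo := {ffun 'I_N.+1 -> nat}.
Definition key : choiceType := (expo * expo)%type.
Definition kadd (a b : key) : key :=
  ([ffun i => a.1 i + b.1 i]%N, [ffun i => a.2 i + b.2 i]%N).
Definition kzero : key := ([ffun=> 0%N], [ffun=> 0%N]).
Definition delta (j : 'I_N.+1) : expo := [ffun i => (i == j) : nat].
Definition xkey j : key := (delta j, [ffun=> 0%N]).
Definition ykey j : key := ([ffun=> 0%N], delta j).

Lemma kaddA : associative kadd.
Proof. by move=> a b c; congr pair; apply/ffunP => i; rewrite !ffunE addnA. Qed.
Lemma kaddC : commutative kadd.
Proof. by move=> a b; congr pair; apply/ffunP => i; rewrite !ffunE addnC. Qed.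
Lemma kadd0 : left_id kzero kadd.
Proof. by move=> [a b]; congr pair; apply/ffunP => i; rewrite !ffunE add0n. Qed.
HB.instance Definition _ := Monoid.isComLaw.Build key kzero kadd kaddA kaddC kadd0.

Definition ksum (ks : seq key) : key := \big[kadd/kzero]_(k <- ks) k.

Definition cur := {malg E[key]}.

Definition xmul j (u : cur) : cur := lext (fun c k => (mono (kadd k (xkey j)) c)) u.
Definition cmap (T : E -> E) (u : cur) : cur := lext (fun c k => (mono k (T c))) u.
Definition dtot (u : cur) : cur :=
  lext (fun c k => \sum_j (mono (kadd k (xkey j)) c) *+ k.2 j) u.
Definition tau (u : cur) : cur := cmap dE u + dtot u.

Lemma addf_xmul j : addf (xmul j).
Proof. by apply: lextD => k x y; apply: addf_malgU. Qed.
Lemma addf_cmap T : addf T -> addf (cmap T).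
Proof. by move=> TD; apply: lextD => k x y; rewrite TD; apply: addf_malgU. Qed.
Lemma coefD_dtot :
  coefD (fun (c : E) (k : key) => \sum_j (mono (kadd k (xkey j)) c) *+ k.2 j : cur).
Proof.
move=> k x y; rewrite -big_split; apply: eq_bigr => j _.
by rewrite addf_malgU mulrnDl.
Qed.
Lemma addf_dtot : addf dtot.
Proof. exact: (lextD coefD_dtot). Qed.

Lemma xmulU j c k : xmul j (mono k c) = (mono (kadd k (xkey j)) c).
Proof. by rewrite /xmul lextU // => k' x y; apply: addf_malgU. Qed.
Lemma cmapU T c k : addf T -> cmap T (mono k c) = (mono k (T c)).
Proof. by move=> TD; rewrite /cmap lextU // => k' x y; rewrite TD; apply: addf_malgU. Qed.
Lemma dtotU c k : dtot (mono k c) = \sum_j (mono (kadd k (xkey j)) c) *+ k.2 j.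
Proof. by rewrite /dtot lextU //; apply: coefD_dtot. Qed.

Hypothesis dD : addf dE.

Lemma addf_tau : addf tau.
Proof. by apply: addf_add; [apply: addf_cmap | apply: addf_dtot]. Qed.

Lemma tauU c k :
  tau (mono k c) = (mono k (dE c)) + \sum_j (mono (kadd k (xkey j)) c) *+ k.2 j.
Proof. by rewrite /tau cmapU // dtotU. Qed.

Lemma tau_xmul j u : tau (xmul j u) = xmul j (tau u).
Proof.
apply: (malg_eq (f := fun u => tau (xmul j u)) (f' := fun u => xmul j (tau u))) => [||c k].
- exact: addf_comp' addf_tau (addf_xmul j).
- exact: addf_comp' (addf_xmul j) addf_tau.
rewrite xmulU !tauU addf_xmul xmulU (addf_sum (@addf_xmul j)); congr (_ + _).
apply: eq_bigr => i _; rewrite (addf_muln (@addf_xmul j)) xmulU.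
rewrite !ffunE addn0 -!kaddA (kaddC (xkey j)).
by [].
Qed.

Lemma tau_cmap T u : addf T -> (forall c, T (dE c) = dE (T c)) ->
  tau (cmap T u) = cmap T (tau u).
Proof.
move=> TD Td; have TD' := addf_cmap TD.
apply: (malg_eq (f := fun u => tau (cmap T u)) (f' := fun u => cmap T (tau u))) => [||c k].
- exact: addf_comp' addf_tau TD'.
- exact: addf_comp' TD' addf_tau.
rewrite cmapU // !tauU TD' cmapU // Td (addf_sum TD'); congr (_ + _).
by apply: eq_bigr => i _; rewrite (addf_muln TD') cmapU.
Qed.

(** Additivity of ∂ is an argument so that the closure instance, and with it the quotient group, can
    be attached to [img dD]. *)
Definition img (_ : addf dE) : {pred cur} := fun u => `[< exists w, u = tau w >].

Fact img_zmod_closed : zmod_closed (img dD).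
Proof.
split; first by apply/asboolP; exists 0; rewrite (addf0 addf_tau).
move=> _ _ /asboolP[u ->] /asboolP[v ->]; apply/asboolP; exists (u - v).
by rewrite addf_tau (addfN addf_tau).
Qed.
HB.instance Definition _ := GRing.isZmodClosed.Build cur (img dD) img_zmod_closed.

Local Notation Q := (Quotient.quot (img dD : zmodClosed cur)).
Definition coinv : zmodType := Q.
Definition pr (u : cur) : coinv := (\pi_Q u)%qT.
Definition rp (x : coinv) : cur := generic_quotient.repr (x : Q).

Lemma rpK x : pr (rp x) = x.
Proof. exact: (@reprK _ Q). Qed.

Lemma addf_pr : addf pr.
Proof. by move=> x y; rewrite /pr raddfD. Qed.

Lemma pr_eq u v : pr u = pr v -> exists w, u - v = tau w.
Proof.
move/eqP; rewrite /pr -Quotient.idealrBE => h.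
by move: (h : img dD (u - v)) => /asboolP.
Qed.

Lemma pr_tau w : pr (tau w) = 0.
Proof.
rewrite -(addf0 addf_pr); apply/eqP; rewrite /pr -Quotient.idealrBE subr0.
by apply/asboolP; exists w.
Qed.

Lemma pr_rp u : exists w, rp (pr u) = u + tau w.
Proof.
have [w e] := pr_eq (rpK (pr u)); exists w.
by rewrite -e addrC subrK.
Qed.

Lemma coinv_ext (U : zmodType) (f f' : coinv -> U) x : addf f -> addf f' ->
  (forall c k, f (pr (mono k c)) = f' (pr (mono k c))) -> f x = f' x.
Proof.
move=> fD fD' e; rewrite -[x]rpK.
apply: (malg_eq (f := fun u => f (pr u)) (f' := fun u => f' (pr u))) => //.
- exact: addf_comp' fD addf_pr.
- exact: addf_comp' fD' addf_pr.
Qed.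

Definition qop (T : cur -> cur) (x : coinv) : coinv := pr (T (rp x)).

Section InducedOperator.
Variable T : cur -> cur.
Hypotheses (TD : addf T) (Tt : forall u, tau (T u) = T (tau u)).

Lemma qop_pr u : qop T (pr u) = pr (T u).
Proof.
rewrite /qop; have [w ->] := pr_rp u.
by rewrite TD addf_pr -Tt pr_tau addr0.
Qed.

Lemma addf_qop : addf (qop T).
Proof.
move=> x y; rewrite -[x]rpK -[y]rpK -addf_pr !qop_pr TD.
by rewrite addf_pr.
Qed.
End InducedOperator.

Definition qx j : coinv -> coinv := qop (xmul j).
Definition qmap T : coinv -> coinv := qop (cmap T).

Lemma qxE j u : qx j (pr u) = pr (xmul j u).
Proof. exact: (qop_pr (@addf_xmul j) (@tau_xmul j)). Qed.
Lemma addf_qx j : addf (qx j).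
Proof. exact: (addf_qop (@addf_xmul j) (@tau_xmul j)). Qed.
Lemma qxU j c k : qx j (pr (mono k c)) = pr (mono (kadd k (xkey j)) c).
Proof. by rewrite qxE xmulU. Qed.

Lemma qxC i j x : qx i (qx j x) = qx j (qx i x).
Proof.
apply: (coinv_ext (f := fun x => qx i (qx j x)) (f' := fun x => qx j (qx i x))) => [||c k].
- exact: addf_comp' (@addf_qx i) (@addf_qx j).
- exact: addf_comp' (@addf_qx j) (@addf_qx i).
by rewrite !qxU -!kaddA (kaddC (xkey i)).
Qed.

Section CoefficientMap.
Variable T : E -> E.
Hypotheses (TD : addf T) (Td : forall c, T (dE c) = dE (T c)).
Lemma qmapE u : qmap T (pr u) = pr (cmap T u).
Proof. apply: qop_pr; [exact: addf_cmap | by move=> v; apply: tau_cmap]. Qed.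
Lemma addf_qmap : addf (qmap T).
Proof. apply: addf_qop; [exact: addf_cmap | by move=> v; apply: tau_cmap]. Qed.
Lemma qmapU c k : qmap T (pr (mono k c)) = pr (mono k (T c)).
Proof. by rewrite qmapE cmapU. Qed.
Lemma qmap_qx j x : qmap T (qx j x) = qx j (qmap T x).
Proof.
apply: (coinv_ext (f := fun x => qmap T (qx j x)) (f' := fun x => qx j (qmap T x))) => [||c k].
- exact: addf_comp' addf_qmap (@addf_qx j).
- exact: addf_comp' (@addf_qx j) addf_qmap.
by rewrite qxU !qmapU qxU.
Qed.
End CoefficientMap.

Definition lform (a : expo) (x : coinv) : coinv := \sum_j qx j x *+ a j.

Lemma addf_lform a : addf (lform a).
Proof. by apply: addf_bigsum => j x y; rewrite addf_qx mulrnDl. Qed.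

Lemma lformC a j x : lform a (qx j x) = qx j (lform a x).
Proof.
rewrite /lform (addf_sum (@addf_qx j)); apply: eq_bigr => i _.
by rewrite (addf_muln (@addf_qx j)) qxC.
Qed.

Lemma lform_comm a (m : coinv -> coinv) x : addf m ->
  (forall j x, m (qx j x) = qx j (m x)) -> m (lform a x) = lform a (m x).
Proof.
move=> mD mX; rewrite /lform (addf_sum mD); apply: eq_bigr => j _.
by rewrite (addf_muln mD) mX.
Qed.

Lemma lform_lform a b x : lform a (lform b x) = lform b (lform a x).
Proof.
by apply: lform_comm => [|j y]; [exact: addf_lform | exact: lformC].
Qed.

Lemma lform_delta j x : lform (delta j) x = qx j x.
Proof.
rewrite /lform (bigD1 j) //= ffunE eqxx mulr1n big1 ?addr0 // => i ij.
by rewrite ffunE (negPf ij).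
Qed.

Lemma lformD (a b : expo) x : lform [ffun i => a i + b i]%N x = lform a x + lform b x.
Proof. by rewrite -big_split; apply: eq_bigr => j _; rewrite ffunE mulrnDr. Qed.

Lemma lform_ksum ks x :
  lform (ksum ks).2 x = \sum_(k <- ks) lform k.2 x.
Proof.
rewrite /ksum; elim: ks => [|k ks IHks]; rewrite ?big_nil ?big_cons.
  by rewrite /lform big1 // => j _; rewrite ffunE.
by rewrite -IHks -lformD.
Qed.

(** This is the relation imposed by the cokernel, as D multiplies y^b by \sum_j b_j x_j. *)
Lemma pr_d c k : pr (mono k (dE c)) = - lform k.2 (pr (mono k c)).
Proof.
apply/eqP; rewrite -addr_eq0 /lform; apply/eqP.
rewrite -[RHS](pr_tau (mono k c)) tauU addf_pr (addf_sum addf_pr); congr (_ + _).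
by apply: eq_bigr => j _; rewrite (addf_muln addf_pr) qxU.
Qed.

Lemma multiadd_ext (U : zmodType) (F F' : seq coinv -> U) s :
  multiadd F -> multiadd F' ->
  (forall t : seq (E * key), F (map (pr \o @item _ _) t) = F' (map (pr \o @item _ _) t)) ->
  F s = F' s.
Proof.
elim: s F F' => [|x s IHs] F F' FD FD' e; first exact: (e [::]).
apply: (coinv_ext (f := fun x => F (x :: s)) (f' := fun x => F' (x :: s))).
- by move=> a b; apply: (FD [::]).
- by move=> a b; apply: (FD' [::]).
move=> c k; apply: (IHs (fun s => F (_ :: s)) (fun s => F' (_ :: s))).
- by move=> s1; apply: (FD (_ :: s1)).
- by move=> s1; apply: (FD' (_ :: s1)).
- by move=> t; apply: (e ((c, k) :: t)).
Qed.

Section Descent.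
Variables (U : zmodType) (h : seq (E * key) -> U).
Hypotheses (hD : slotadd h)
  (ht : forall s1 w s2, mext h (s1 ++ tau w :: s2) = 0).

Lemma mext_pr us vs : map pr us = map pr vs -> mext h us = mext h vs.
Proof.
suff aux s1 : map pr us = map pr vs -> mext h (s1 ++ us) = mext h (s1 ++ vs).
  exact: (aux [::]).
elim: us vs s1 => [|u us IHus] [|v vs] s1 //= [] euv evs.
have [w e] := pr_eq euv; rewrite -[u](subrK v) e mext_add // ht add0r.
by rewrite -!cat_rcons; apply: IHus.
Qed.

Definition descend (s : seq coinv) : U := mext h (map rp s).

Lemma descend_pr us : descend (map pr us) = mext h us.
Proof. by apply: mext_pr; rewrite -!map_comp; apply: eq_map => x /=; rewrite rpK. Qed.

Lemma descend_item t : descend (map (pr \o @item _ _) t) = h t.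
Proof. by rewrite map_comp descend_pr mext_item. Qed.

Lemma descend_add : multiadd descend.
Proof.
move=> s1 x y s2; rewrite -[x]rpK -[y]rpK -addf_pr.
have e s : map pr (map rp s) = s by elim: s => //= z s ->; rewrite rpK.
rewrite -(e s1) -(e s2) -!map_cons -!map_cat !descend_pr.
by rewrite mext_add // /descend !map_cat.
Qed.

Lemma descend_alt : altern h -> altern descend.
Proof.
by move=> hA s1 x y s2; rewrite /descend !map_cat /= (mext_alt hA).
Qed.

Lemma descend_slot (T : cur -> cur) (m : U -> U) : addf T ->
  (forall u, tau (T u) = T (tau u)) -> addf m ->
  (forall t1 c k t2, lext (fun c' k' => h (t1 ++ (c', k') :: t2)) (T (mono k c)) =
     m (h (t1 ++ (c, k) :: t2))) ->
  forall s1 x s2, descend (s1 ++ qop T x :: s2) = m (descend (s1 ++ x :: s2)).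
Proof.
move=> TD Tt mD hT s1 x s2; rewrite -[x]rpK qop_pr //.
have e s : map pr (map rp s) = s by elim: s => //= z s ->; rewrite rpK.
rewrite -(e s1) -(e s2) -!map_cons -!map_cat !descend_pr.
by rewrite (mext_slot hD TD mD hT) /descend map_cat.
Qed.

End Descent.
End Coinvariants.

(** * Cochains as alternating maps *)

Section Hat.
Variables (K : fieldType) (E : lmodType K) (dE : E -> E).
Hypothesis dlin : linear dE.
Let dD : addf dE := addf_linear dlin.
Variable N : nat.
Local Notation key := (key N).
Local Notation X := (coinv N dD).
Local Notation pr := (pr (N := N) dD).
Local Notation lform := (@lform K E dE N dD).
Local Notation qx := (@qx K E dE N dD).
Local Notation qmap := (@qmap K E dE N dD).
Local Notation kzero := (kzero N).

Section Rho.
Variable n : nat.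
Implicit Types (ks : seq key) (P : pol n E) (cs : seq E).

Definition vec cs : {ffun 'I_n.+1 -> E} := [ffun i : 'I_n.+1 => nth 0 cs i].

(* On y^b the derivation y_j |-> x_j y_j is multiplication by \sum_j b_j x_j; this
   form is the value of the variable λ attached to an argument c x^a y^b. *)
Definition at_keys ks P : X :=
  subst (fun i : 'I_n => lform (nth kzero ks i).2) (fun c => pr (mono (ksum ks) c)) P.

Lemma addf_mono_pr k : addf (fun c => pr (mono k c)).
Proof. exact: (addf_comp' (addf_pr dD) (@addf_malgU _ _ _)). Qed.

Lemma addf_at_keys ks : addf (at_keys ks).
Proof. by apply: addf_subst => [i|]; [exact: addf_lform | exact: addf_mono_pr]. Qed.

Lemma at_keys_polC ks c : at_keys ks (polC n c) = pr (mono (ksum ks) c).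
Proof.
by rewrite /at_keys subst_polC // => [i|]; [exact: addf_lform | exact: addf_mono_pr].
Qed.

Lemma at_keys_lam ks i P : size ks = n.+1 ->
  at_keys ks (lam dE i P) = lform (nth kzero ks i).2 (at_keys ks P).
Proof.
(* By [pr_d], ∂ acts as minus the form of the total key. The last variable becomes that form minus
   those of the first n keys, which leaves the form of the last key. *)
move=> sz; rewrite /at_keys (subst_lam (D := fun x => - lform (ksum ks).2 x)) //.
- case: (unliftP ord_max i) => [j|] ->; first by rewrite lift_max.
  rewrite opprK lform_ksum (big_nth kzero) sz big_mkord big_ord_recr /=.
  by rewrite addKr.
- by move=> j; exact: addf_lform.
- by move=> j j' u; exact: lform_lform.
- exact: addf_mono_pr.
- by apply: addf_opp; exact: addf_lform.
- by move=> c; rewrite pr_d.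
- move=> j u; rewrite (addfN (addf_lform _)); congr (- _); exact: lform_lform.
Qed.

Lemma at_keys_mulX ks (i : 'I_n) P :
  at_keys ks (mulX i P) = lform (nth kzero ks i).2 (at_keys ks P).
Proof.
rewrite /at_keys subst_mulX //.
- by move=> j; exact: addf_lform.
- by move=> j j' u; exact: lform_lform.
- exact: addf_mono_pr.
Qed.

Lemma ksum_xkey ks1 k j ks2 :
  ksum (ks1 ++ kadd k (xkey j) :: ks2) = kadd (ksum (ks1 ++ k :: ks2)) (xkey j).
Proof.
by rewrite /ksum !big_cat !big_cons /= -!kaddA (kaddC (xkey j)).
Qed.

Lemma at_keys_xkey ks1 k j ks2 P :
  at_keys (ks1 ++ kadd k (xkey j) :: ks2) P = qx j (at_keys (ks1 ++ k :: ks2) P).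
Proof.
rewrite /at_keys (subst_morph (m := qx j) (A' := fun i : 'I_n => lform (nth kzero (ks1 ++ k :: ks2) i).2)).
- apply: subst_ext => [i u|c]; last by rewrite qxU ksum_xkey.
  congr (lform _ u); rewrite !nth_cat; case: ltnP => // _.
  by case: (_ - _)%N => //=; apply/ffunP => l; rewrite !ffunE addn0.
- exact: addf_qx.
- by move=> i u; rewrite -lformC.
Qed.

Lemma at_keys_mapc (T : E -> E) ks P : addf T -> (forall c, T (dE c) = dE (T c)) ->
  qmap T (at_keys ks P) = at_keys ks (mapc T P).
Proof.
move=> TD Td; rewrite /at_keys subst_mapc //.
- rewrite (subst_morph (m := qmap T) (A' := fun i : 'I_n => lform (nth kzero ks i).2)).
  + by apply: subst_ext => // c; rewrite qmapU.
  + exact: addf_qmap.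
  + move=> i u; apply: lform_comm; first exact: addf_qmap.
    by move=> j y; exact: qmap_qx.
- by move=> i; exact: addf_lform.
- exact: addf_mono_pr.
Qed.

(** Every variable, the last one included, is the form of its key, so the change of variables under
    a permutation is a mere permutation of the keys; their sum does not change. *)
Lemma at_keys_perm (t : 'S_n.+1) ks ks' P : size ks = n.+1 ->
  ksum ks' = ksum ks -> (forall i : 'I_n.+1, nth kzero ks' i = nth kzero ks (t i)) ->
  at_keys ks (eval (fun i : 'I_n => lam dE (t (lift ord_max i))) P) = at_keys ks' P.
Proof.
move=> sz eS et; rewrite /eval.
rewrite (subst_morph (m := at_keys ks)
  (A' := fun i : 'I_n => lform (nth kzero ks (t (lift ord_max i))).2)).
- apply: subst_ext => [i u|c]; last by rewrite at_keys_polC eS.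
  by rewrite -et lift_max.
- exact: addf_at_keys.
- by move=> i u; exact: at_keys_lam.
Qed.

Lemma vec_upd s1 c s2 (i : 'I_n.+1) : i = size s1 :> nat ->
  vec (s1 ++ c :: s2) = upd (vec (s1 ++ 0 :: s2)) i c.
Proof.
move=> e; apply/ffunP => j; rewrite !ffunE; case: eqVneq => [->|ne].
  by rewrite e nth_cat ltnn subnn.
rewrite !nth_cat; case: ltnP => // h.
have : (j - size s1 != 0)%N.
  by rewrite subn_eq0 -ltnNge ltn_neqAle h andbT -e eq_sym.
by case: (_ - _)%N.
Qed.

Lemma updK v (i : 'I_n.+1) (x y : E) : upd (upd v i x) i y = upd v i y.
Proof. by apply/ffunP => j; rewrite !ffunE; case: eqP. Qed.

End Rho.

Variables (gE : E -> E).
Hypotheses (glin : linear gE) (gd : forall c, gE (dE c) = dE (gE c)).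

Section HatOf.
Variables (n : nat) (f : raw n E E).
Implicit Types (t : seq (E * key)).

(** Lists of the wrong length get 0, so that cochains of all arities become functions on the same
    sequences. *)
Definition hitem t : X :=
  if size t == n.+1 then at_keys (unzip2 t) (f (vec n (unzip1 t))) else 0.
Definition hat : seq X -> X := @descend _ _ _ _ dD _ hitem.

Hypothesis hf : is_cochain dE dE gE gE f.

(** The two sesquilinearity conditions are one: ∂ + λ_1 + ... + λ_n is - λ_{n+1}. *)
Lemma coch_slot v i : f (upd v i (dE (v i))) = - lam dE i (f v).
Proof.
rewrite /lam; case: (unliftP ord_max i) => [j|] ->; first exact: (coch_d hf).
by rewrite opprB opprK addrC (coch_d_last hf) addrC.
Qed.

Lemma hitem_cat t1 c k t2 (hs : (size t1 + size t2 == n)%N) :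
  hitem (t1 ++ (c, k) :: t2) = at_keys (unzip2 t1 ++ k :: unzip2 t2)
    (f (vec n (unzip1 t1 ++ c :: unzip1 t2))).
Proof.
rewrite /hitem size_cat /= addnS eqSS hs /unzip1 /unzip2 !map_cat //.
Qed.

Lemma hitem_size t : size t != n.+1 -> hitem t = 0.
Proof. by rewrite /hitem => /negPf ->. Qed.

Lemma slot_ord t1 t2 : (size t1 + size t2 == n)%N ->
  exists i : 'I_n.+1, i = size (@unzip1 E key t1) :> nat.
Proof.
move=> /eqP e; have h : (size t1 < n.+1)%N by rewrite -e ltnS leq_addr.
by exists (Ordinal h); rewrite /= size_map.
Qed.

Lemma hitem_add : slotadd hitem.
Proof.
move=> t1 c c' k t2; case: (boolP (size t1 + size t2 == n)%N) => hs; last first.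
  by rewrite !hitem_size ?addr0 // size_cat /= addnS eqSS.
rewrite !hitem_cat // -addf_at_keys; congr at_keys.
have [i hi] := slot_ord hs.
rewrite (vec_upd (c + c') _ hi). rewrite (vec_upd c _ hi) (vec_upd c' _ hi).
exact: (addf_linear (coch_linear hf _ _)).
Qed.

(** In slot i, ∂ contributes - λ_i, which is minus the form of the key there, and D contributes that
    same form. *)
Lemma hitem_tau s1 w s2 : mext hitem (s1 ++ tau dE w :: s2) = 0.
Proof.
apply: (mext_slot (m := fun=> 0) hitem_add (addf_tau (N := N) dD)) => [x y|t1 c k t2].
  by rewrite addr0.
case: (boolP (size t1 + size t2 == n)%N) => hs; last first.
  by rewrite /lext big1 // => k' _; rewrite hitem_size // size_cat /= addnS eqSS.
have LD : coefD (fun c k => hitem (t1 ++ (c, k) :: t2)).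
  by move=> k' c' c''; rewrite hitem_add.
rewrite tauU // (lextD LD) (addf_sum (lextD LD)) lextU //.
have [i hi] := slot_ord hs.
under eq_bigr => j _ do
  rewrite (addf_muln (lextD LD)) lextU // hitem_cat // at_keys_xkey -hitem_cat //.
rewrite !hitem_cat // (vec_upd (dE c) _ hi).
have -> : upd (vec n (unzip1 t1 ++ 0 :: unzip1 t2)) i (dE c) =
   upd (vec n (unzip1 t1 ++ c :: unzip1 t2)) i (dE (vec n (unzip1 t1 ++ c :: unzip1 t2) i)).
  by rewrite {3}/vec ffunE hi nth_cat ltnn subnn /= (vec_upd c _ hi) updK.
rewrite coch_slot (addfN (addf_at_keys _)) at_keys_lam.
  by rewrite hi nth_cat !size_map ltnn subnn /= addNr.
by rewrite size_cat /= !size_map addnS (eqP hs).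
Qed.

Lemma hat_add : multiadd hat.
Proof. by apply: descend_add => //; [exact: hitem_add | exact: hitem_tau]. Qed.

Lemma hat_item t : hat (map (pr \o @item _ _) t) = hitem t.
Proof. by apply: descend_item; [exact: hitem_add | exact: hitem_tau]. Qed.

Lemma nth_swap (T : Type) (x0 : T) s1 a b s2 m (i j : 'I_m) : i = size s1 :> nat -> j = (size s1).+1 :> nat ->
  forall l : 'I_m, nth x0 (s1 ++ b :: a :: s2) l =
    nth x0 (s1 ++ a :: b :: s2) (tperm i j l).
Proof.
move=> hi hj l; rewrite !nth_cat.
case: tpermP => [->|->|/eqP li /eqP lj].
- by rewrite hi hj ltnn subnn ltnNge leqnSn /= subSnn.
- by rewrite hi hj ltnn subnn ltnNge leqnSn /= subSnn.
case: ltnP => // h.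
have : (l - size s1 != 0)%N.
  by rewrite subn_eq0 -ltnNge ltn_neqAle h andbT -hi eq_sym.
have : (l - size s1 != 1)%N.
  apply: contraNN lj => /eqP e; apply/eqP/val_inj => /=; rewrite hj; lia.
by case: (_ - _)%N => [|[]].
Qed.

Lemma hitem_alt : altern hitem.
Proof.
move=> t1 [c k] [c' k'] t2; case: (boolP (size t1 + size t2 + 2 == n.+1)%N) => [/eqP hs|hs]; last first.
  rewrite !hitem_size ?oppr0 // size_cat /=;
    by apply: contraNN hs => /eqP <-; rewrite !addnS addn0.
have hi : (size t1 < n.+1)%N by lia.
have hj : ((size t1).+1 < n.+1)%N by lia.
pose i := Ordinal hi; pose j := Ordinal hj.
have ij : i != j by rewrite -val_eqE /= neq_ltn ltnSn.
have sz (T : Type) (a b : T) (u1 u2 : seq T) : size u1 = size t1 -> size u2 = size t2 ->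
   size (u1 ++ a :: b :: u2) = n.+1 by rewrite size_cat /= => -> ->; rewrite -hs !addnS addn0.
rewrite /hitem !sz // eqxx /unzip1 /unzip2 !map_cat /=.
rewrite (coch_alt hf (tperm i j)) odd_tperm ij /= expr1 scaleN1r (addfN (addf_at_keys _)).
congr (- _); rewrite (at_keys_perm (ks' := unzip2 t1 ++ k' :: k :: unzip2 t2)).
- congr (at_keys _ (f _)); apply/ffunP => l; rewrite !ffunE.
  by rewrite -(@nth_swap _ 0 _ _ _ _ _ i j) //= size_map.
- by rewrite sz ?size_map.
- by rewrite /ksum !big_cat !big_cons /= !(kaddC k) !(kaddC k') -!kaddA (kaddC k).
- by move=> l; apply: nth_swap; rewrite /= size_map.
Qed.

Lemma hat_alt : altern hat.
Proof. by apply: descend_alt; exact: hitem_alt. Qed.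

Lemma hat_size s : size s != n.+1 -> hat s = 0.
Proof.
move=> hs; rewrite /hat /descend.
have : size (map (@rp _ _ _ _ dD) s) != n.+1 by rewrite size_map.
move: (map _ _) => us {}hs.
suff aux h : (forall t, size t = size us -> h t = 0) -> mext h us = 0 :> X.
  by apply: aux => t e; apply: hitem_size; rewrite e.
elim: us {hs} h => [|u us IHus] h hh /=; first exact: hh.
by rewrite /lext big1 // => k _; apply: IHus => t e; apply: hh; rewrite /= e.
Qed.
End HatOf.
End Hat.

(** * Shuffles *)

Section LiftPerm.
Variables (n : nat) (p q : 'I_n.+1).

Lemma lift_perm_bij : {on [pred t : 'S_n.+1 | t p == q], bijective (lift_perm p q)}.
Proof.
(* [ulsf i s] is [s] with [i] removed from the source and [s i] from the target; the default [k] is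
   never reached. *)
pose ulsf i (s : 'S_n.+1) k := odflt k (unlift (s i) (s (lift i k))).
have ulsfK i (s : 'S_n.+1) k : lift (s i) (ulsf i s k) = s (lift i k).
  rewrite /ulsf; have := neq_lift i k.
  by rewrite -(can_eq (permK s)) => /unlift_some[] ? ? ->.
have inj_ulsf : injective (ulsf p _).
  move=> s; apply: can_inj (ulsf (s p) s^-1%g) _ => k'.
  by rewrite {1}/ulsf ulsfK !permK liftK.
exists (fun s => perm (inj_ulsf s)) => [s _ | s].
  by apply/permP => k'; rewrite permE /ulsf lift_perm_lift lift_perm_id liftK.
move/eqP => si0; apply/permP => k.
case: (unliftP p k) => [k'|] ->; rewrite ?lift_perm_id //.
by rewrite lift_perm_lift -si0 permE ulsfK.
Qed.

Lemma lift_permP (t : 'S_n.+1) : t p = q -> exists t', t = lift_perm p q t'.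
Proof.
have [g _ hg] := lift_perm_bij; move=> e.
by exists (g t); rewrite hg // inE e.
Qed.

Lemma sum_lift_perm (U : nmodType) (Q : pred 'S_n.+1) (F : 'S_n.+1 -> U) :
  \sum_(t | Q t && (t p == q)) F t =
  \sum_(t | Q (lift_perm p q t)) F (lift_perm p q t).
Proof.
rewrite (reindex (lift_perm p q)); last first.
  by have [g h1 h2] := lift_perm_bij; exists g => x; rewrite inE => h;
     [apply: h1 | apply: h2]; rewrite inE; case/andP: h.
by apply: eq_bigl => t; rewrite lift_perm_id eqxx andbT.
Qed.
End LiftPerm.

Section WordOf.
Variable T : Type.
Definition word n (z : 'I_n -> T) : seq T := [seq z i | i <- enum 'I_n].

Lemma size_word n (z : 'I_n -> T) : size (word z) = n.
Proof. by rewrite size_map size_enum_ord. Qed.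

Lemma nth_word n (z : 'I_n -> T) x0 (i : 'I_n) : nth x0 (word z) i = z i.
Proof. by rewrite (nth_map i) ?size_enum_ord // nth_ord_enum. Qed.

Lemma word_lift n (z : 'I_n.+1 -> T) (p : 'I_n.+1) :
  word z = take p (word (fun i => z (lift p i))) ++
    z p :: drop p (word (fun i => z (lift p i))).
Proof.
have hp : (p <= n)%N by rewrite -ltnS.
apply: (@eq_from_nth _ (z p)) => [|m].
  by rewrite size_cat /= size_take size_drop !size_word; case: ltnP; lia.
rewrite size_word => hi; rewrite -[m]/(nat_of_ord (Ordinal hi)) nth_word.
rewrite nth_cat size_take size_word.
have -> : (if (p < n)%N then p : nat else n) = p by case: ltnP; lia.
case: (unliftP p (Ordinal hi)) => [j ej|->]; last by rewrite ltnn subnn.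
have {}ej : m = bump p j by rewrite -[m]/(nat_of_ord (Ordinal hi)) ej.
have -> : Ordinal hi = lift p j by apply: val_inj.
rewrite [nat_of_ord _]/= -/(bump p j) /bump; case: (leqP p j) => h.
  by rewrite add1n ltnNge leqW //= subSn //= nth_drop subnKC // nth_word.
by rewrite add0n h nth_take // nth_word.
Qed.

Lemma word_lift0 n (z : 'I_n.+1 -> T) : word z = z ord0 :: word (fun i => z (lift ord0 i)).
Proof. by rewrite (word_lift z ord0) take0 drop0. Qed.

Lemma word_nil (z : 'I_0 -> T) : word z = [::].
Proof. by apply: size0nil; rewrite size_word. Qed.

Lemma word_ext n (z z' : 'I_n -> T) : (forall i, z i = z' i) -> word z = word z'.
Proof. by move=> h; apply: eq_map. Qed.

Lemma word_lift_perm n (z : 'I_n.+1 -> T) p (t : 'S_n) :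
  word (fun i => z (lift_perm p ord0 t i)) =
    take p (word (fun i => z (lift ord0 (t i)))) ++
    z ord0 :: drop p (word (fun i => z (lift ord0 (t i)))).
Proof.
rewrite (word_lift _ p) lift_perm_id.
by rewrite (@word_ext _ _ (fun i => z (lift ord0 (t i)))) // => i; rewrite lift_perm_lift.
Qed.
End WordOf.

Lemma map_word (T T' : Type) (f : T -> T') n (z : 'I_n -> T) :
  map f (word z) = word (fun i => f (z i)).
Proof. by rewrite /word -(map_comp f z). Qed.

Lemma big_word (T R : Type) (idx : R) (op : Monoid.com_law idx) (F : T -> R) n (z : 'I_n -> T) :
  \big[op/idx]_(x <- word z) F x = \big[op/idx]_i F (z i).
Proof. by rewrite big_map big_enum. Qed.

Lemma nth_word_inord (T : Type) (x0 : T) n (z : 'I_n.+1 -> T) i :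
  (i < n.+1)%N -> nth x0 (word z) i = z (inord i).
Proof. by move=> hi; rewrite -(nth_word z x0 (inord i)) inordK. Qed.

Lemma take_word (T : Type) n a b (z : 'I_n.+1 -> T) : n.+1 = (a + b)%N ->
  take a (word z) = word (fun i : 'I_a => z (inord i)).
Proof.
move=> e; apply: (@eq_from_nth _ (z ord0)) => [|i].
  by rewrite size_takel !size_word // e leq_addr.
rewrite size_takel ?size_word ?e ?leq_addr // => hi.
rewrite nth_take // nth_word_inord; last by rewrite e ltn_addr.
by rewrite -[X in nth _ _ X]/(nat_of_ord (Ordinal hi)) nth_word.
Qed.

Lemma drop_word (T : Type) n a b (z : 'I_n.+1 -> T) : n.+1 = (a + b)%N ->
  drop a (word z) = word (fun i : 'I_b => z (inord (a + i))).
Proof.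
move=> e; apply: (@eq_from_nth _ (z ord0)) => [|i].
  by rewrite size_drop !size_word e addKn.
have sb : (n.+1 - a = b)%N by rewrite e addKn.
rewrite size_drop size_word sb => hi.
rewrite nth_drop nth_word_inord; last by rewrite e ltn_add2l.
by rewrite -[X in nth _ _ X]/(nat_of_ord (Ordinal hi)) nth_word.
Qed.

Section Alternating.
Variables (T : Type) (U : zmodType) (H : seq T -> U).
Hypothesis HA : altern H.

Lemma altern_front s1 x s2 : H (s1 ++ x :: s2) = sg (odd (size s1)) (H (x :: s1 ++ s2)).
Proof.
elim/last_ind: s1 s2 => [|s1 y IHs] s2 //=.
rewrite size_rcons /= !cat_rcons HA IHs.
by case: odd; rewrite /= ?opprK.
Qed.
End Alternating.

Lemma altern_perm (T : Type) (U : zmodType) (H : seq T -> U) n (z : 'I_n -> T) (t : 'S_n) :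
  altern H -> H (word (fun i => z (t i))) = sg (odd_perm t) (H (word z)).
Proof.
elim: n H z t => [|n IHn] H z t HA.
  by rewrite permS0 odd_perm1 (@word_ext _ _ _ z) // => -[].
have [t' et] := @lift_permP _ (t^-1%g ord0) ord0 t (permKV t ord0).
move: et; set p := (t^-1)%g ord0 => ->.
rewrite word_lift_perm (altern_front HA) cat_take_drop odd_lift_perm /= addbF.
rewrite size_takel; last by rewrite size_word -ltnS ltn_ord.
rewrite word_lift0 (IHn (fun s => H (z ord0 :: s)) (fun i => z (lift ord0 i))) ?sgA //.
by move=> s1; apply: (HA (_ :: s1)).
Qed.

(** For k = n + 1 this is convertible to [shuffle n]. Unlike that predicate it admits an empty first
    block, which the induction below reaches. *)
Definition shuf n k (t : 'S_n) :=
  [forall i : 'I_n, forall j : 'I_n,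
    (i < j)%N && ((j < k) || (k <= i))%N ==> (t i < t j)%N].

Lemma shufP n k (t : 'S_n) :
  reflect (forall i j : 'I_n, (i < j)%N -> (j < k)%N || (k <= i)%N -> (t i < t j)%N) (shuf k t).
Proof.
apply: (iffP forallP) => [h i j ij hk|h i].
  by have /forallP /(_ j) := h i; rewrite ij hk.
by apply/forallP => j; apply/implyP => /andP[]; apply: h.
Qed.

Lemma lt_lift n (p : 'I_n.+1) (i j : 'I_n) : (lift p i < lift p j)%N = (i < j)%N.
Proof. by rewrite /= /bump; case: leqP; case: leqP; lia. Qed.

Lemma shuf_lift0 n k (t : 'S_n) : shuf k.+1 (lift_perm ord0 ord0 t) = shuf k t.
Proof.
apply/shufP/shufP => h i j.
  have := h (lift ord0 i) (lift ord0 j).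
  by rewrite !lift_perm_lift !lt_lift !lift0.
case: (unliftP ord0 i) => [i'|] ->; case: (unliftP ord0 j) => [j'|] -> //.
  by rewrite !lift_perm_lift !lt_lift !lift0 => *; apply: h.
by rewrite lift_perm_id lift_perm_lift.
Qed.

Lemma shuf_liftk n (k : 'I_n.+1) (t : 'S_n) : shuf k (lift_perm k ord0 t) = shuf k t.
Proof.
apply/shufP/shufP => h i j.
  have := h (lift k i) (lift k j); rewrite !lift_perm_lift !lt_lift => + ij hk; apply=> //.
  move: ij hk; rewrite /= /bump; case: leqP; case: leqP; lia.
case: (unliftP k i) => [i'|] ->; case: (unliftP k j) => [j'|] -> //.
- rewrite !lift_perm_lift !lt_lift => ij hk; apply: h => //.
  move: ij hk; rewrite /= /bump; case: leqP; case: leqP; lia.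
- by rewrite lift_perm_id /= /bump; case: leqP => /=; lia.
- by rewrite lift_perm_id lift_perm_lift.
- by rewrite ltnn.
Qed.

(** 0 is the least value, hence it starts one of the two increasing blocks. *)
Lemma shuf_zero n k (t : 'S_n.+1) (p : 'I_n.+1) : shuf k t -> t p = ord0 ->
  (p == 0 :> nat) || (p == k :> nat).
Proof.
move=> /shufP h tp; case: eqVneq => //= p0; apply/negPn/negP => pk.
have hp := ltn_ord p; have hq : (p.-1 < n.+1)%N by lia.
have h1 : (p.-1 < p)%N by lia.
have h2 : (p < k)%N || (k <= p.-1)%N by lia.
by have := h (Ordinal hq) p h1 h2; rewrite tp.
Qed.

(** * Shuffle sums as recursive insertion *)

Section ShuffleSum.
Variable X : zmodType.
Implicit Types (F G : seq X -> X) (phi : X -> X).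

Lemma comp_small b phi F G s : multiadd F ->
  (forall t, (size t <= size s)%N -> G t = 0) -> comp b phi F G s = 0.
Proof.
elim: s b F G => [|x s IHs] b F G FM hG /=.
  by rewrite hG //; apply: (@addf0 _ _ (fun z => F [:: z])) => y z; apply: (FM [::]).
rewrite !IHs ?sg0 ?subr0 //; first exact: multiadd_contr.
- by move=> t ht; apply: hG; apply: leqW.
- by move=> t ht; apply: hG.
Qed.

(** The shuffles are sorted by the position of 0. At the start of the first block z_0 goes to [G];
    at position k it goes to [F], with sign (-1)^k and one more sign for passing the value of [G].
    These are the two recursive terms of [comp]. *)
Lemma shuffle_comp n k phi F G (z : 'I_n -> X) : (k <= n)%N ->
  multiadd F -> altern F -> (forall s, size s != k -> G s = 0) ->
  \sum_(t : 'S_n | shuf k t) sg (odd_perm t)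
    (F (G (take k (word (fun i => z (t i)))) :: map phi (drop k (word (fun i => z (t i))))))
  = comp (odd k) phi F G (word z).
Proof.
elim: n k F G z => [|n IHn] k F G z hk FM FA hG.
  have -> : k = 0%N by lia.
  have e (z' : 'I_0 -> X) : word z' = [::] by apply: size0nil; rewrite size_word.
  rewrite e /= (big_pred1 1%g) => [|t]; first by rewrite odd_perm1 e.
  by rewrite permS0 /= eqxx; apply/shufP => -[].
rewrite word_lift0 /=.
set S := \sum_(t | _) _.
pose A (p : 'I_n.+1) := \sum_(t : 'S_n.+1 | shuf k t && (t p == ord0)) sg (odd_perm t)
    (F (G (take k (word (fun i => z (t i)))) :: map phi (drop k (word (fun i => z (t i)))))).
have SA : S = \sum_p A p.
  rewrite /S (partition_big (fun t : 'S_n.+1 => (t^-1)%g ord0) xpredT) //=.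
  apply: eq_bigr => p _; apply: eq_bigl => t; congr (_ && _).
  by rewrite -(can_eq (permK t)) permKV eq_sym.
have A0 (p : 'I_n.+1) : (p != 0 :> nat) -> (p != k :> nat) -> A p = 0.
  move=> p0 pk; rewrite /A big_pred0 // => t; apply/negP => /andP[ht /eqP tp].
  by have := shuf_zero ht tp; rewrite (negPf p0) (negPf pk).
have Ak (p : 'I_n.+1) : p = k :> nat -> A p =
   - sg (odd k) (comp (odd k) phi (contr (phi (z ord0)) F) G (word (fun i => z (lift ord0 i)))).
  move=> pk; rewrite /A sum_lift_perm -IHn //; first last.
  - exact: altern_contr.
  - exact: multiadd_contr.
  - by rewrite -pk -ltnS ltn_ord.
  rewrite -pk sg_sum -sumrN; apply: eq_big => [t|t _]; first by rewrite shuf_liftk.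
  rewrite odd_lift_perm /= addbF -sgA word_lift_perm.
  set w := word _.
  have sw : size (take p w) = p.
    by rewrite size_takel // size_word -ltnS ltn_ord.
  rewrite take_cat sw ltnn subnn take0 cats0 drop_cat sw ltnn subnn drop0 /=.
  by rewrite /contr (FA [::]) /= !sgN.
have Az (k' : nat) : k = k'.+1 -> A ord0 =
   comp (~~ odd k) phi F (contr (z ord0) G) (word (fun i => z (lift ord0 i))).
  move=> ek; rewrite /A sum_lift_perm ek /= negbK -IHn //; last 2 first.
  - by lia.
  - by move=> s hs; apply: hG => /=; rewrite ek eqSS.
  apply: eq_big => [t|t _]; first by rewrite shuf_lift0.
  by rewrite odd_lift_perm /= word_lift_perm take0 drop0 /=.
rewrite SA big_ord_recl.
(* For k = 0 the first block is empty and position 0 already starts the second one. *)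
case: (posnP k) => [k0|k_gt0].
  rewrite big1 => [|p _]; last by apply: A0; rewrite ?k0.
  rewrite addr0 (Ak ord0) // k0 /= [X in _ = X - _]comp_small ?sub0r // => t _.
  by apply: hG; rewrite k0.
have ek : k = k.-1.+1 by rewrite prednK.
rewrite (Az _ ek); congr (_ + _).
(* For k = n + 1 there is no second block; correspondingly, giving z_0 to [F] leaves too few
   arguments for [G]. *)
case: (ltnP k.-1 n) => kn.
  rewrite (bigD1 (Ordinal kn)) //= (Ak (lift ord0 (Ordinal kn))); last first.
    by rewrite lift0 /= -ek.
  rewrite big1 ?addr0 // => p hp; apply: A0; rewrite lift0 // ek eqSS.
  by apply: contraNN hp => /eqP e; apply/eqP/val_inj.
rewrite big1 => [|p _]; last first.
  by apply: A0; rewrite lift0 // ek eqSS; have := ltn_ord p; lia.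
rewrite comp_small ?sg0 ?oppr0 //; first exact: multiadd_contr.
move=> t; rewrite size_word => ht; apply: hG; rewrite ek neq_ltn.
by rewrite ltnS (leq_trans ht).
Qed.
End ShuffleSum.

(** * Recovering a cochain *)

Lemma subst_mulX_id (K : fieldType) n (W : lmodType K) (P : pol n W) :
  subst (fun i => @mulX K n W i) (@polC K n W) P = P.
Proof.
apply: (@malg_eq _ _ _ (fun P : pol n W => subst (fun i => @mulX K n W i) (@polC K n W) P) id) => //.
  by apply: addf_subst => [i|]; [exact: addf_mulX | exact: addf_polC].
move=> c k; rewrite substU; last 2 first.
- by move=> i; exact: addf_mulX.
- exact: addf_polC.
suff [k' [-> hk']] : exists k' : 'X_{1..n}, opmon (fun i => @mulX K n W i) k (polC n c) = mono k' c
    /\ forall j, k' j = k j.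
  by congr (mono _ c); apply/eqP/cmP.
rewrite polCE /opmon.
(* Strengthened to sublists of the variables: the exponent is that of [k] on the variables in [s]
   and 0 elsewhere. *)
have aux (s : seq 'I_n) : uniq s -> exists k' : 'X_{1..n},
    foldr (fun i => iter (k i) (@mulX K n W i)) (mono (mone : 'X_{1..n}) c) s = mono k' c
    /\ forall j, k' j = ((j \in s) * k j)%N.
  elim: s => [_|i s IHs /= /andP[ni us]].
    by exists mone; split=> // j; rewrite cm1.
  have [k1 [-> hk1]] := IHs us.
  have hm m (k2 : 'X_{1..n}) : exists k3 : 'X_{1..n},
     iter m (@mulX K n W i) (mono k2 c) = mono k3 c /\ forall j, k3 j = (k2 j + (i == j) * m)%N.
    elim: m => [|m [k3 [e3 h3]]] /=; first by exists k2; split=> // j; rewrite muln0 addn0.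
    exists (mulu k3 i); split; first by rewrite e3 mulXU.
    by move=> j; rewrite muluE h3 mulnS -addnA (addnC (_ * m)%N).
  have [k3 [e3 h3]] := hm (k i) k1; exists k3; split=> // j.
  rewrite h3 hk1 inE [j == i]eq_sym; case: eqVneq => [<-|_]; last by rewrite mul0n addn0.
  by rewrite (negPf ni) mul0n add0n.
have [k' [e h]] := aux _ (enum_uniq 'I_n); exists k'; split=> // j.
by rewrite h mem_enum mul1n.
Qed.

Section Reading.
Variables (K : fieldType) (E : lmodType K) (dE : E -> E).
Hypothesis dlin : linear dE.
Let dD : addf dE := addf_linear dlin.
Variable N : nat.
Local Notation key := (key N).
Local Notation X := (coinv N dD).
Local Notation pr := (pr (N := N) dD).
Local Notation lform := (@lform K E dE N dD).
Local Notation qx := (@qx K E dE N dD).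
Local Notation qmap := (@qmap K E dE N dD).
Local Notation hat f := (@hat K E dE dlin N _ f).
Local Notation ak := (@at_keys K E dE dlin N _).
Local Notation opl := (opmon (fun j : 'I_N.+1 => @lam K N E dE j)).

(* the component at y_0...y_N, on which ∂ is - x_0 - ... - x_N *)
Definition rdY (u : cur E N) : pol N E :=
  lext (fun c (k : key) => if k.2 == [ffun=> 1%N] then opl k.1 (polC N c) else 0) u.

Lemma rdY_coefD : coefD (fun c (k : key) =>
  if k.2 == [ffun=> 1%N] then opl k.1 (polC N c) else 0).
Proof.
move=> k c c'; case: eqP => _; last by rewrite addr0.
by rewrite addf_polC addf_opmon // => j; apply: addf_lam.
Qed.

Lemma addf_rdY : addf rdY.
Proof. exact: lextD rdY_coefD. Qed.

Lemma rdYU c k :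
  rdY (mono k c) = if k.2 == [ffun=> 1%N] then opl k.1 (polC N c) else 0.
Proof. exact: (lextU _ _ rdY_coefD). Qed.

Lemma rdY_xmul j u : rdY (xmul j u) = lam dE j (rdY u).
Proof.
have lD := addf_lam (n := N) dD j.
apply: (malg_eq (f := fun u => rdY (xmul j u)) (f' := fun u => lam dE j (rdY u))) => [||c k].
- exact: addf_comp' addf_rdY (@addf_xmul _ _ _ j).
- exact: addf_comp' lD addf_rdY.
rewrite xmulU !rdYU /=.
have -> : [ffun i => k.2 i + [ffun=> 0%N] i]%N = k.2.
  by apply/ffunP => i; rewrite !ffunE addn0.
case: eqP => _; last by rewrite (addf0 lD).
apply: opmonX => [i i' u'|i]; first exact: lamC.
by rewrite !ffunE eq_sym.
Qed.

Lemma rdY_cmap T u : addf T -> (forall c, T (dE c) = dE (T c)) ->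
  rdY (cmap T u) = mapc T (rdY u).
Proof.
move=> TD Td; have mD := addf_mapc (n := N) TD.
apply: (malg_eq (f := fun u => rdY (cmap T u)) (f' := fun u => mapc T (rdY u))) => [||c k].
- exact: addf_comp' addf_rdY (addf_cmap TD).
- exact: addf_comp' mD addf_rdY.
rewrite cmapU // !rdYU; case: eqP => _; last by rewrite (addf0 mD).
rewrite /opmon -mapc_polC //.
elim: (enum _) => //= i s ->; elim: (k.1 i) => //= m ->.
by rewrite -lam_mapc.
Qed.

Lemma sum_lam (P : pol N E) : \sum_j lam dE j P = - mapc dE P.
Proof.
rewrite big_ord_recr /= {2}/lam unlift_none addrA.
rewrite [X in X - _ - _](eq_bigr (fun j => mulX j P)) ?subrr ?sub0r //.
move=> j _; rewrite /lam; have -> : widen_ord (leqnSn N) j = lift ord_max j.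
  by apply: val_inj => /=; rewrite /bump leqNgt ltn_ord.
by rewrite liftK.
Qed.

(** On y_0 ... y_N the derivation D multiplies by x_0 + ... + x_N, which is read as λ_1 + ... +
    λ_{N+1} = - ∂ and cancels the ∂ on the coefficients. *)
Lemma rdY_tau u : rdY (tau dE u) = 0.
Proof.
apply: (malg_eq (f := fun u => rdY (tau dE u)) (f' := fun=> 0)) => [||c k].
- exact: addf_comp' addf_rdY (addf_tau (N := N) dD).
- by move=> x y; rewrite addr0.
rewrite tauU // addf_rdY (addf_sum addf_rdY).
under eq_bigr => j _ do rewrite (addf_muln addf_rdY) -xmulU rdY_xmul.
rewrite -cmapU // rdY_cmap // rdYU; case: eqP => [->|_]; last first.
  rewrite (addf0 (addf_mapc dD)) big1 ?addr0 // => j _.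
  by rewrite (addf0 (addf_lam _ _)) // mul0rn.
under eq_bigr => j _ do rewrite ffunE mulr1n.
by rewrite sum_lam subrr.
Qed.

Definition rd (x : X) : pol N E := rdY (rp x).

Lemma rd_pr u : rd (pr u) = rdY u.
Proof.
by rewrite /rd; have [w ->] := pr_rp dD u; rewrite addf_rdY rdY_tau addr0.
Qed.

Lemma addf_rd : addf rd.
Proof. by move=> x y; rewrite -[x]rpK -[y]rpK -addf_pr !rd_pr addf_rdY. Qed.

Lemma rd_qx j x : rd (qx j x) = lam dE j (rd x).
Proof. by rewrite -[x]rpK qxE !rd_pr rdY_xmul. Qed.

Lemma rd_qmap T x : addf T -> (forall c, T (dE c) = dE (T c)) ->
  rd (qmap T x) = mapc T (rd x).
Proof. by move=> TD Td; rewrite -[x]rpK qmapE // !rd_pr rdY_cmap. Qed.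

Definition ykeys : seq key := word (fun i : 'I_N.+1 => ykey i).

Lemma ksumE (ks : seq key) i :
  ((ksum ks).1 i = \sum_(k <- ks) k.1 i)%N /\ ((ksum ks).2 i = \sum_(k <- ks) k.2 i)%N.
Proof.
rewrite /ksum; elim: ks => [|k ks [IH1 IH2]]; first by rewrite !big_nil !ffunE.
by rewrite !big_cons !ffunE IH1 IH2.
Qed.

Lemma ksum_ykeys : ksum ykeys = ([ffun=> 0%N], [ffun=> 1%N]).
Proof.
rewrite [LHS]surjective_pairing; congr pair; apply/ffunP => l; rewrite ffunE.
  rewrite (ksumE _ _).1 big_map big_enum big1 //= => i _.
  by rewrite ffunE.
rewrite (ksumE _ _).2 big_map big_enum (bigD1 l) //= ffunE eqxx big1 ?addn0 // => i il.
by rewrite ffunE eq_sym (negPf il).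
Qed.

Lemma rd_mono c : rd (pr (mono (ksum ykeys) c)) = polC N c.
Proof.
rewrite rd_pr rdYU ksum_ykeys /= eqxx /opmon.
by elim: (enum _) => //= i s ->; rewrite ffunE.
Qed.

(** For the keys y_0, ..., y_N the form of the i-th key is x_i, read back as the i-th variable, and
    the total key is the monomial y_0 ... y_N that [rd] selects. *)
Lemma rd_at_keys P : rd (ak ykeys P) = P.
Proof.
rewrite /at_keys (subst_morph (m := rd) (A' := fun i : 'I_N => @mulX K N E i)).
- rewrite -[RHS]subst_mulX_id; apply: subst_ext => // c; exact: rd_mono.
- exact: addf_rd.
move=> i u.
have -> : nth (kzero N) ykeys i = ykey (lift ord_max i).
  by rewrite -(nth_word (fun i => ykey i) (kzero N)) lift_max.
by rewrite lform_delta rd_qx /lam liftK.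
Qed.

Variables (gE : E -> E).
Hypotheses (glin : linear gE) (gd : forall c, gE (dE c) = dE (gE c)).
Let gD : addf gE := addf_linear glin.

Lemma scale_d a c : a *: dE c = dE (a *: c).
Proof.
by have := dlin a c 0; rewrite (addf0 dD) !addr0.
Qed.

(** [alt_map] knows only addition. Linearity over K and over the x_j, needed to return to cochains,
    is recorded separately. *)
Record conf_map n (H : seq X -> X) : Prop := ConfMap {
  conf_alt : alt_map (qmap gE) n H;
  conf_scale : forall a, slotlin (qmap ( *:%R a)) H;
  conf_qx : forall j, slotlin (qx j) H }.

Lemma linear_scale (V W : lmodType K) (g : V -> W) a x : linear g -> g (a *: x) = a *: g x.
Proof.
by move=> h; have := h a x 0; rewrite (addf0 (addf_linear h)) !addr0.
Qed.

Lemma hat_conf n (f : raw n E E) : is_cochain dE dE gE gE f ->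
  conf_map n (hat f).
Proof.
move=> hf; have hA := hitem_add (N := N) dlin hf; have hT := hitem_tau (N := N) dlin hf.
have aD a : addf ( *:%R a : E -> E) by exact: addf_scale.
have aS (a : K) c : a *: dE c = dE (a *: c) by exact: scale_d.
split.
- split.
  + exact: (hat_add hf).
  + exact: (hat_alt hf).
  + by move=> s; rewrite addn0 => hs; exact: hat_size.
  + move=> s; apply: (multiadd_ext (F := fun s => qmap gE (hat f s))
      (F' := fun s => hat f (map (qmap gE) s))) => [s1 x y s2|s1 x y s2|t].
    * by rewrite (hat_add hf) addf_qmap.
    * by rewrite !map_cat /= addf_qmap // (hat_add hf).
    * rewrite (hat_item _ hf) -map_comp.
      rewrite (eq_map (g := (pr \o @item _ _) \o (fun p => (gE p.1, p.2)))); last first.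
        by move=> [c k] /=; rewrite qmapU.
      rewrite map_comp (hat_item _ hf) /hitem size_map; case: eqP => _; last exact: (addf0 (addf_qmap _ _)).
      rewrite at_keys_mapc // (coch_twist hf); congr (ak _ (f _)).
        by rewrite /unzip2 -map_comp.
      apply/ffunP => i; rewrite !ffunE /unzip1 -map_comp.
      case: (ltnP i (size t)) => h; last by rewrite !nth_default ?size_map // (addf0 gD).
      by rewrite !(nth_map (0, kzero N)).
- move=> a; apply: (descend_slot hA hT).
  + exact: addf_cmap.
  + by move=> u; apply: tau_cmap.
  + exact: addf_qmap.
  + move=> t1 c k t2; rewrite cmapU // lextU; last by move=> k' c' c''; exact: hA.
    case: (boolP (size t1 + size t2 == n)%N) => hs; last first.
      by rewrite !hitem_size ?(addf0 (addf_qmap _ _)) // size_cat /= addnS eqSS.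
    have [i hi] := slot_ord hs.
    rewrite !hitem_cat // at_keys_mapc //; congr (ak _ _).
    rewrite (vec_upd (a *: c) _ hi) (vec_upd c _ hi).
    exact: (linear_scale _ _ (coch_linear hf _ _)).
- move=> j; apply: (descend_slot hA hT).
  + exact: addf_xmul.
  + by move=> u; apply: tau_xmul.
  + exact: addf_qx.
  + move=> t1 c k t2; rewrite xmulU // lextU; last by move=> k' c' c''; exact: hA.
    case: (boolP (size t1 + size t2 == n)%N) => hs; last first.
      by rewrite !hitem_size ?(addf0 (addf_qx j)) // size_cat /= addnS eqSS.
    by rewrite !hitem_cat // at_keys_xkey.
Qed.
End Reading.

(** * Insertion of cochains *)

Section Transfer.
Variables (K : fieldType) (E : lmodType K) (dE gE : E -> E).
Hypotheses (dlin : linear dE) (glin : linear gE).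
Hypothesis gd : forall c, gE (dE c) = dE (gE c).
Let dD : addf dE := addf_linear dlin.
Let gD : addf gE := addf_linear glin.

Section Level.
Variable N : nat.
Local Notation key := (key N).
Local Notation X := (coinv N dD).
Local Notation pr := (pr (N := N) dD).
Local Notation lform := (@lform K E dE N dD).
Local Notation qx := (@qx K E dE N dD).
Local Notation qmap := (@qmap K E dE N dD).
Local Notation hat f := (@hat K E dE dlin N _ f).
Local Notation ak := (@at_keys K E dE dlin N _).
Local Notation rd := (@rd K E dE dlin N).
Local Notation conf_map := (@conf_map K E dE dlin N gE).
Local Notation cochain f := (is_cochain dE dE gE gE f).

Definition args n (k : 'I_n.+1 -> key) (v : 'I_n.+1 -> E) : seq X :=
  word (fun i => pr (mono (k i) (v i))).

Lemma argsE n (k : 'I_n.+1 -> key) (v : 'I_n.+1 -> E) :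
  args k v = map (pr \o @item _ _) (word (fun i => (v i, k i))).
Proof. by rewrite map_word. Qed.

Lemma vec_word n (v : {ffun 'I_n.+1 -> E}) : vec n (word v) = v.
Proof. by apply/ffunP => i; rewrite ffunE nth_word. Qed.

Lemma hat_args n (f : raw n E E) (k : 'I_n.+1 -> key) (v : {ffun 'I_n.+1 -> E}) :
  cochain f -> hat f (args k v) = ak (word k) (f v).
Proof.
move=> hf; rewrite argsE (hat_item _ hf) /hitem size_word eqxx.
have -> : unzip2 (word (fun i => (v i, k i))) = word k.
  by rewrite /unzip2 map_word.
have -> : unzip1 (word (fun i => (v i, k i))) = word v.
  by rewrite /unzip1 map_word.
by rewrite vec_word.
Qed.

Lemma word_upd (T : Type) n (z : 'I_n.+1 -> T) (i : 'I_n.+1) : exists s1 s2, forall x,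
  word (fun j => if j == i then x else z j) = s1 ++ x :: s2.
Proof.
exists (take i (word (fun j => z (lift i j)))), (drop i (word (fun j => z (lift i j)))).
move=> x; rewrite (word_lift _ i) eqxx.
rewrite (@word_ext _ _ (fun j => if lift i j == i then x else z (lift i j))
   (fun j => z (lift i j))) // => j.
by rewrite eq_sym (negPf (neq_lift _ _)).
Qed.

Lemma args_upd n (k : 'I_n.+1 -> key) (v : {ffun 'I_n.+1 -> E}) i : exists s1 s2, forall x,
  args k (upd v i x) = s1 ++ pr (mono (k i) x) :: s2.
Proof.
have [s1 [s2 h]] := word_upd (fun j => pr (mono (k j) (v j))) i.
exists s1, s2 => x; rewrite -h; apply: word_ext => j.
by rewrite ffunE; case: eqP => [->|].
Qed.

(** Each cochain axiom is the image under [rd] of a property of [H] at arguments v_i y_i. Arbitrary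
    keys are needed because alternation permutes the y_i without the slots. *)
Lemma cochain_of_conf (h : raw N E E) (H : seq X -> X) : conf_map N H ->
  (forall (k : 'I_N.+1 -> key) (v : {ffun 'I_N.+1 -> E}),
     H (args k v) = ak (word k) (h v)) ->
  cochain h.
Proof.
move=> [[HD HA _ HG] HS HX] hE.
have hrd v : h v = rd (H (args (@ykey N) v)) by rewrite hE rd_at_keys.
have slot v i : exists s1 s2, forall x,
    h (upd v i x) = rd (H (s1 ++ pr (mono (ykey i) x) :: s2)).
  have [s1 [s2 e]] := args_upd (@ykey N) v i.
  by exists s1, s2 => x; rewrite hrd e.
have aD a : addf ( *:%R a : E -> E) by exact: addf_scale.
have aS (a : K) c : a *: dE c = dE (a *: c) by exact: scale_d.
have slot_d v i : h (upd v i (dE (v i))) = - lam dE i (h v).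
  have [s1 [s2 e]] := slot v i.
  have -> : h v = h (upd v i (v i)).
    by congr h; apply/ffunP => j; rewrite ffunE; case: eqP => [->|].
  rewrite !e pr_d lform_delta -rd_qx -HX -(addfN (@addf_rd _ _ _ dlin _)).
  by rewrite -(addfN (f := fun x => H (s1 ++ x :: s2))) // => x y.
split.
- move=> v i a x y; have [s1 [s2 e]] := slot v i.
  rewrite !e addf_mono_pr HD addf_rd; congr (_ + _).
  rewrite -(qmapU dD (aD a) (aS a)) HS rd_qmap //; exact: aD.
- move=> v; rewrite !hrd -(rd_qmap _ gD gd) HG; congr (rd (H _)).
  rewrite /args map_word; apply: word_ext => i.
  by rewrite qmapU // ffunE.
- move=> v i /=; rewrite slot_d /lam liftK //.
- move=> v; rewrite slot_d /lam unlift_none; rewrite opprB opprK addrC.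
  by [].
- move=> t v; rewrite scale_sg hrd.
  have := altern_perm (fun i => pr (mono (ykey i) (v i))) t HA.
  rewrite -/(args _ _) => e.
  have {}e : H (args (@ykey N) v) = sg (odd_perm t)
     (H (args (fun i => ykey (t i)) [ffun i => v (t i)])).
    rewrite -[LHS]/(sg false _) -(addbb (odd_perm t)) -sgA -e; congr sg; congr H.
    by apply: word_ext => i; rewrite ffunE.
  rewrite e (addf_sg (@addf_rd _ _ _ dlin _)) hE; congr sg.
  rewrite -(at_keys_perm dlin (t := t) (ks := ykeys N)) ?rd_at_keys ?size_word //.
  + by rewrite /ksum !big_word [RHS](reindex_inj (@perm_inj _ t)).
  + by move=> i; rewrite !nth_word.
Qed.

Lemma lform_slot (F : seq X -> X) a x rest : multiadd F -> (forall j, slotlin (qx j) F) ->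
  F (lform a x :: rest) = lform a (F (x :: rest)).
Proof.
move=> FD FX; apply: (lform_comm a (m := fun x => F (x :: rest))) => [y z|j y].
  exact: (FD [::]).
exact: (FX j [::]).
Qed.

Lemma iter_qmap m k c : iter m (qmap gE) (pr (mono k c)) = pr (mono k (iter m gE c)).
Proof. by elim: m => //= m ->; rewrite qmapU. Qed.

(** The value of [g] carries the sum of the keys of its arguments. The form of this sum is λ_{τ(1)}
    + ... + λ_{τ(n+1)}, the parameter that ⊚ assigns to the first slot of [f]; all other parameters
    are forms of single keys on both sides. *)
Lemma circ_at_keys M m n (f : raw m E E) (g : raw n E E) (k : 'I_M.+1 -> key)
    (v : {ffun 'I_M.+1 -> E}) : M = (m + n)%N -> cochain f -> cochain g ->
  ak (word k) (@circ K E dE gE M m n f g v) = pcirc (qmap gE) n (hat f) (hat g) (args k v).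
Proof.
move=> eM hf hg.
have eM1 : M.+1 = (n.+1 + m)%N by rewrite eM addnC addSn.
have [[FD FA _ _] _ FX] := hat_conf dlin N glin gd hf.
rewrite /pcirc -[~~ odd n]/(odd n.+1) -shuffle_comp //; last 2 first.
- by rewrite eM1 leq_addr.
- exact: hat_size.
rewrite /circ (addf_sum (addf_at_keys _ _)); apply: eq_bigr => t _.
rewrite scale_sg (addf_sg (addf_at_keys _ _)); congr sg.
rewrite (take_word _ eM1) (drop_word _ eM1).
set kI := fun i : 'I_n.+1 => k (t (inord i)).
have -> : word (fun i : 'I_n.+1 => pr (mono (k (t (inord i))) (v (t (inord i))))) =
    args kI [ffun i : 'I_n.+1 => v (t (inord i))].
  by apply: word_ext => i; rewrite ffunE.
rewrite hat_args //; set P := g _.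
(* The variables in the value of [g] have become linear forms in the x_j, and these pass through the
   first slot of [hat f]. *)
rewrite {2}/at_keys (subst_morph (m := fun x => hat f (x :: _))
  (A' := fun i : 'I_n => lform (nth (kzero N) (word kI) i).2)); last 2 first.
- by move=> x y; apply: (FD [::]).
- by move=> i u; apply: lform_slot.
rewrite (subst_morph (m := ak (word k))
  (A' := fun i : 'I_n => lform (nth (kzero N) (word kI) i).2)); last 2 first.
- exact: addf_at_keys.
- move=> i u; rewrite at_keys_lam ?size_word // nth_word.
  by have -> := nth_word kI (kzero N) (widen_ord (leqnSn n) i).
apply: subst_ext => // c.
pose kJ (j : 'I_m.+1) := if j == 0 :> nat then ksum (word kI) else k (t (inord (n + j))).
pose vJ : {ffun 'I_m.+1 -> E} :=
  [ffun j : 'I_m.+1 => if j == 0 :> nat then c else iter n gE (v (t (inord (n + j))))].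
rewrite -[finfun _]/vJ.
rewrite map_word.
have -> : pr (mono (ksum (word kI)) c) ::
   word (fun i : 'I_m => iter n (qmap gE)
     (pr (mono (k (t (inord (n.+1 + i)))) (v (t (inord (n.+1 + i))))))) = args kJ vJ.
  have eJ j : vJ j = if j == 0 :> nat then c else iter n gE (v (t (inord (n + j)))) by rewrite ffunE.
  rewrite /args [RHS]word_lift0 /= eJ /kJ /=; congr (_ :: _); apply: word_ext => i.
  by rewrite eJ lift0 /= addnS addSn iter_qmap.
rewrite hat_args //; set Q := f vJ.
rewrite /eval (subst_morph (m := ak (word k))
  (A' := fun j : 'I_m => lform (nth (kzero N) (word kJ) j).2)); last 2 first.
- exact: addf_at_keys.
- move=> j u.
  rewrite -[nat_of_ord j]/(nat_of_ord (widen_ord (leqnSn m) j)) (nth_word kJ) /kJ /=.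
  case: eqP => _; last by rewrite at_keys_lam ?size_word // nth_word.
  rewrite (addf_sum (addf_at_keys _ _)) lform_ksum big_word; apply: eq_bigr => i _.
  by rewrite at_keys_lam ?size_word // nth_word.
apply: subst_ext => // c'; rewrite at_keys_polC; congr (pr (mono _ _)).
have -> : word kJ = ksum (word kI) :: word (fun i : 'I_m => k (t (inord (n.+1 + i)))).
  by rewrite word_lift0; congr (_ :: _); apply: word_ext => i; rewrite /kJ lift0 /= addnS addSn.
rewrite /kI -(take_word (fun i => k (t i)) eM1) -(drop_word (fun i => k (t i)) eM1).
rewrite [RHS]/ksum big_cons -big_cat cat_take_drop /ksum !big_word.
by rewrite [LHS](reindex_inj (@perm_inj _ t)).
Qed.
Lemma hat_eq M (h : raw M E E) (F : seq X -> X) : cochain h -> conf_map M F ->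
  (forall (k : 'I_M.+1 -> key) (v : {ffun 'I_M.+1 -> E}), F (args k v) = ak (word k) (h v)) ->
  forall s, hat h s = F s.
Proof.
move=> hh [[FD _ FZ _] _ _] hF s; apply: multiadd_ext => //; first exact: (hat_add hh).
move=> t; case: (boolP (size t == M.+1)) => sz; last first.
  by rewrite hat_size ?size_map // FZ // addn0 size_map.
pose z (i : 'I_M.+1) := nth (0, kzero N) t i.
have -> : t = word z.
  apply: (@eq_from_nth _ (0, kzero N)) => [|m hi]; first by rewrite size_word (eqP sz).
  have hi' : (m < M.+1)%N by rewrite -(eqP sz).
  by rewrite -[m]/(nat_of_ord (Ordinal hi')) nth_word.
have -> : map (pr \o @item _ _) (word z) = args (fun i => (z i).2) [ffun i => (z i).1].
  by rewrite map_word; apply: word_ext => i; rewrite ffunE.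
by rewrite hat_args // hF.
Qed.

Lemma qmap_scaleC a x : qmap gE (qmap ( *:%R a) x) = qmap ( *:%R a) (qmap gE x).
Proof.
have aD : addf ( *:%R a : E -> E) by exact: addf_scale.
have aS c : a *: dE c = dE (a *: c) by exact: scale_d.
apply: (coinv_ext (f := fun x => qmap gE (qmap ( *:%R a) x))
  (f' := fun x => qmap ( *:%R a) (qmap gE x))) => [||c k].
- by apply: addf_comp'; exact: addf_qmap.
- by apply: addf_comp'; exact: addf_qmap.
by rewrite !qmapU // linear_scale.
Qed.

Lemma iter_comm (m p : X -> X) n x : (forall y, p (m y) = m (p y)) ->
  iter n p (m x) = m (iter n p x).
Proof. by move=> h; elim: n => //= n ->. Qed.

Lemma addf_qscale a : addf (qmap ( *:%R a)).
Proof.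
by apply: addf_qmap => [|c]; [exact: addf_scale | exact: scale_d].
Qed.

Lemma conf_pcirc m n F G : conf_map m F -> conf_map n G ->
  conf_map (m + n) (pcirc (qmap gE) n F G).
Proof.
move=> [hF sF xF] [hG sG xG]; split.
- exact: (pcirc_alt (addf_qmap gD gd)).
- move=> a; apply: comp_slotlin => //; first exact: addf_qscale.
  by move=> x; apply: iter_comm; exact: qmap_scaleC.
- move=> j; apply: comp_slotlin => //; first exact: addf_qx.
  by move=> x; apply: iter_comm => y; apply: qmap_qx.
Qed.

Lemma conf_sg b m F : conf_map m F -> conf_map m (fun s => sg b (F s)).
Proof.
move=> [hF sF xF]; split; first exact: (alt_map_sg (addf_qmap gD gd)).
- by move=> a s1 x s2; rewrite sF (addf_sg (addf_qscale a)).
- by move=> j s1 x s2; rewrite xF (addf_sg (addf_qx j)).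
Qed.

Lemma confD m F G : conf_map m F -> conf_map m G -> conf_map m (fun s => F s + G s).
Proof.
move=> [hF sF xF] [hG sG xG]; split; first exact: (alt_mapD (addf_qmap gD gd)).
- by move=> a s1 x s2; rewrite sF sG (addf_qscale a).
- by move=> j s1 x s2; rewrite xF xG (addf_qx j).
Qed.

Lemma conf0 m : conf_map m (fun=> 0).
Proof.
split; first exact: (alt_map0 (addf_qmap gD gd)).
- by move=> a s1 x s2; rewrite (addf0 (addf_qscale a)).
- by move=> j s1 x s2; rewrite (addf0 (addf_qx j)).
Qed.

Lemma conf_scaleF a m F : conf_map m F -> conf_map m (fun s => qmap ( *:%R a) (F s)).
Proof.
move=> [[h1 h2 h3 h4] sF xF]; have aD := addf_qscale a; split; first split.
- by move=> s1 x y s2; rewrite h1 aD.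
- by move=> s1 x y s2; rewrite h2 (addfN aD).
- by move=> s hs; rewrite h3 ?(addf0 aD).
- by move=> s; rewrite qmap_scaleC h4.
- move=> b s1 x s2; rewrite sF.
  have hD c : addf ( *:%R c : E -> E) by exact: addf_scale.
  have hS (c : K) e : c *: dE e = dE (c *: e) by exact: scale_d.
  apply: (coinv_ext (f := fun x => qmap ( *:%R a) (qmap ( *:%R b) x))
    (f' := fun x => qmap ( *:%R b) (qmap ( *:%R a) x))) => [||c k].
  + by apply: addf_comp'; exact: addf_qscale.
  + by apply: addf_comp'; exact: addf_qscale.
  by rewrite !qmapU // !scalerA mulrC.
- move=> j s1 x s2; rewrite xF qmap_qx //; first exact: addf_scale.
  by move=> c; exact: scale_d.
Qed.

Lemma conf_pnr m n F G : conf_map m F -> conf_map n G ->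
  conf_map (m + n) (pnr (qmap gE) m n F G).
Proof.
move=> hF hG; apply: confD; first exact: conf_pcirc.
have h : conf_map (m + n) (pcirc (qmap gE) m G F) by rewrite addnC; exact: conf_pcirc.
exact: (conf_sg true (conf_sg _ h)).
Qed.

Lemma hat_faithful (h h' : raw N E E) : cochain h -> cochain h' ->
  (forall s, hat h s = hat h' s) -> h = h'.
Proof.
move=> c c' e; apply/funext => v.
rewrite -(rd_at_keys dlin (h v)) -(rd_at_keys dlin (h' v)).
by rewrite -(hat_args (@ykey N) v c) -(hat_args (@ykey N) v c') e.
Qed.

End Level.

Local Notation cochain f := (is_cochain dE dE gE gE f).
Local Notation hat N f := (@hat K E dE dlin N _ f).
Local Notation qm N T := (@qmap K E dE N dD T).

(** Level N = M gives the cochain axioms; the other levels are needed when [h] enters a further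
    bracket. *)
Lemma transfer M (h : raw M E E) (H : forall N, seq (coinv N dD) -> coinv N dD) :
  (forall N, @conf_map K E dE dlin N gE M (H N)) ->
  (forall N (k : 'I_M.+1 -> key N) (v : {ffun 'I_M.+1 -> E}),
     H N (args k v) = at_keys dlin (word k) (h v)) ->
  cochain h /\ forall N s, hat N h s = H N s.
Proof.
move=> hH e; have hh : cochain h by apply: (cochain_of_conf (hH M)) => k v; exact: e.
by split=> // N; apply: hat_eq.
Qed.

Lemma nr_transfer M m n (f : raw m E E) (g : raw n E E) : M = (m + n)%N ->
  cochain f -> cochain g ->
  cochain (@nr K E dE gE M m n f g) /\
  forall N s, hat N (@nr K E dE gE M m n f g) s = pnr (qm N gE) m n (hat N f) (hat N g) s.
Proof.
move=> eM hf hg; apply: (transfer (H := fun N => pnr (qm N gE) m n (hat N f) (hat N g))).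
  by move=> N; rewrite eM; apply: conf_pnr; exact: hat_conf.
move=> N k v; rewrite /pnr -!circ_at_keys //; last by rewrite addnC.
rewrite /nr (addf_at_keys dlin) (addfN (addf_at_keys dlin _)) -signr_odd scale_sg.
by rewrite (addf_sg (addf_at_keys dlin _)) oddM.
Qed.

Lemma comb_transfer n a (f g : raw n E E) : cochain f -> cochain g ->
  cochain (a *: f + g) /\
  forall N s, hat N (a *: f + g) s = qm N ( *:%R a) (hat N f s) + hat N g s.
Proof.
move=> hf hg; apply: (transfer (H := fun N s => qm N ( *:%R a) (hat N f s) + hat N g s)).
  by move=> N; apply: confD; [apply: conf_scaleF|]; exact: hat_conf.
move=> N k v; rewrite !hat_args // (at_keys_mapc dlin); last 2 first.
- exact: addf_scale.
- by move=> c; exact: scale_d.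
by rewrite -(addf_at_keys dlin).
Qed.

Lemma zero_transfer n : cochain (0 : raw n E E) /\ forall N s, hat N (0 : raw n E E) s = 0.
Proof.
apply: (transfer (H := fun N _ => 0)) => [N|N k v]; first exact: conf0.
by rewrite (addf0 (addf_at_keys dlin _)).
Qed.

Lemma sign_transfer n p (f : raw n E E) : cochain f ->
  cochain ((-1) ^+ p *: f) /\ forall N s, hat N ((-1) ^+ p *: f) s = sg (odd p) (hat N f s).
Proof.
move=> hf; apply: (transfer (H := fun N s => sg (odd p) (hat N f s))).
  by move=> N; apply: conf_sg; exact: hat_conf.
move=> N k v; rewrite hat_args // -(addf_sg (addf_at_keys dlin _)) -scale_sg signr_odd.
by [].
Qed.
End Transfer.

(** * The cochain m_c + ρ *)

Section Flip.
Variable K : fieldType.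

Lemma linear_mapc n (W W' : lmodType K) (F : W -> W') : linear F -> linear (@mapc K n W W' F).
Proof.
move=> FL a P Q; have FD := addf_linear FL.
rewrite (addf_mapc FD); congr (_ + _); rewrite -[a *: P]/(mapc ( *:%R a) P).
rewrite -[RHS]/(mapc ( *:%R a) (mapc F P)) !mapc_comp //; try exact: addf_scale.
by apply: mapc_ext => c /=; rewrite linear_scale.
Qed.

Lemma subst_natural n n' (W W' : lmodType K) (m : W -> W')
    (A : 'I_n -> pol n' W -> pol n' W) (A' : 'I_n -> pol n' W' -> pol n' W') (P : pol n W) :
  addf m -> (forall i, addf (A' i)) ->
  (forall i Q, mapc m (A i Q) = A' i (mapc m Q)) ->
  mapc m (eval A P) = eval A' (mapc m P).
Proof.
move=> mD AD' h; rewrite /eval subst_mapc //; last exact: addf_polC.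
rewrite (subst_morph (m := mapc m) (A' := A')) //; last exact: addf_mapc.
by apply: subst_ext => // c; rewrite mapc_polC.
Qed.

Lemma lam_natural n (W W' : lmodType K) (m : W -> W') (dW : W -> W) (dW' : W' -> W') i
    (P : pol n W) : addf m -> addf dW -> addf dW' -> (forall c, m (dW c) = dW' (m c)) ->
  mapc m (lam dW i P) = lam dW' i (mapc m P).
Proof.
move=> mD dD dD' h; have MD := addf_mapc (n := n) mD.
rewrite /lam; case: unlift => [j|]; first exact: mulX_mapc.
rewrite MD !(addfN MD) (addf_sum MD); congr (- _ - _).
  by apply: eq_bigr => j _; exact: mulX_mapc.
by rewrite !mapc_comp //; apply: mapc_ext => c; exact: h.
Qed.

Lemma flip_natural (W W' : lmodType K) (m : W -> W') (dW : W -> W) (dW' : W' -> W')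
    (P : pol 1 W) : addf m -> addf dW -> addf dW' -> (forall c, m (dW c) = dW' (m c)) ->
  mapc m (flip dW P) = flip dW' (mapc m P).
Proof.
move=> mD dD dD' h; apply: subst_natural => // [i|i Q]; first exact: addf_lam.
exact: lam_natural.
Qed.

Variables (W : lmodType K) (dW : W -> W).
Hypothesis dlin : linear dW.
Let dD : addf dW := addf_linear dlin.

Lemma addf_flip : addf (flip dW).
Proof. by apply: addf_subst => [i|]; [exact: addf_lam | exact: addf_polC]. Qed.

Lemma linear_flip : linear (flip dW).
Proof.
move=> a P Q; rewrite addf_flip; congr (_ + _).
rewrite -[a *: P]/(mapc ( *:%R a) P) -[RHS]/(mapc ( *:%R a) (flip dW P)).
by rewrite (flip_natural (dW' := dW)) //; [exact: addf_scale | move=> c; exact: scale_d].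
Qed.

Lemma flip_mulX i (P : pol 1 W) : flip dW (mulX i P) = lam dW ord_max (flip dW P).
Proof.
rewrite /flip /eval1 /eval subst_mulX //; last exact: addf_polC.
by move=> j; exact: addf_lam.
Qed.

Lemma lam_max (P : pol 1 W) : lam dW ord_max P = - mulX ord0 P - mapc dW P.
Proof. by rewrite /lam unlift_none big_ord1. Qed.

Lemma flip_d (P : pol 1 W) : flip dW (mapc dW P) = mapc dW (flip dW P).
Proof. by rewrite (flip_natural (dW' := dW)). Qed.

Lemma flipK (P : pol 1 W) : flip dW (flip dW P) = P.
Proof.
rewrite {2}/flip /eval1 /eval.
rewrite (subst_morph (m := flip dW) (A' := fun i : 'I_1 => @mulX K 1 W i)).
- rewrite -[RHS]subst_mulX_id; apply: subst_ext => // c.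
  rewrite /flip /eval1 /eval subst_polC //; last exact: addf_polC.
  by move=> i; exact: addf_lam.
- exact: addf_flip.
(* The flip of - λ - ∂ is - (- λ - ∂) - ∂ = λ. *)
move=> i u; rewrite lam_max addf_flip !(addfN addf_flip) flip_mulX flip_d lam_max.
by rewrite opprB opprK addrAC subrr add0r (ord1 i).
Qed.
End Flip.

Section DirectSum.
Variables (K : fieldType) (L M : lmodType K).
Variables (dL : {linear L -> L}) (dM : {linear M -> M}).
Variables (br : L -> L -> pol 1 L) (alpha : {linear L -> L}).
Variables (rho : L -> M -> pol 1 M) (beta : {linear M -> M}).
Hypothesis hL : is_hom_lie_conformal dL br alpha.
Hypothesis hmult : is_multiplicative br alpha.
Hypothesis hrho : is_representation dL dM br alpha rho beta.

Local Notation E := (L * M)%type.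
Local Notation dE := (dsum dL dM).
Local Notation gE := (dsum alpha beta).
Local Notation mc := (mc_rho dM br rho).

Definition injL (x : L) : E := (x, 0).
Definition injM (a : M) : E := (0, a).

Lemma addf_lin (U V : lmodType K) (f : {linear U -> V}) : addf f.
Proof. by move=> x y; rewrite linearD. Qed.

Lemma linear_lin (U V : lmodType K) (f : {linear U -> V}) : linear f.
Proof. by move=> a x y; rewrite linearP. Qed.

Lemma linear_dsum (f : {linear L -> L}) (g : {linear M -> M}) : linear (dsum f g).
Proof. by move=> a [x b] [y c]; rewrite /dsum /= !linearP. Qed.

Lemma gd c : gE (dE c) = dE (gE c).
Proof.
by rewrite /dsum /= (hlc_alpha_d hL) (rep_beta_d hrho).
Qed.

Lemma linear_inL : linear injL.
Proof. by move=> a x y; rewrite /injL; congr pair; rewrite /= scaler0 addr0. Qed.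
Lemma linear_inM : linear injM.
Proof. by move=> a x y; rewrite /injM; congr pair; rewrite /= scaler0 addr0. Qed.
Lemma inL_d x : injL (dL x) = dE (injL x).
Proof. by rewrite /injL /dsum /= linear0. Qed.
Lemma inM_d x : injM (dM x) = dE (injM x).
Proof. by rewrite /injM /dsum /= linear0. Qed.

Definition mcp (e e' : E) : pol 1 E :=
  mapc injL (br e.1 e'.1) + mapc injM (rho e.1 e'.2 - flip dM (rho e'.1 e.2)).

Lemma mcE v : mc v = mcp (v ord0) (v ord_max).
Proof. by rewrite /mc_rho /mcp; case: (v ord0); case: (v ord_max). Qed.

Lemma mcp_linearl e' : linear (mcp^~ e').
Proof.
move=> a e1 e2; rewrite /mcp /= (hlc_linearl hL) (rep_linear hrho).
have [lin _] := rep_gc hrho e'.1.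
rewrite lin (linear_flip (linear_lin dM)) (linear_mapc linear_inL).
rewrite opprD -scalerN addrACA -scalerDr (linear_mapc linear_inM).
by rewrite scalerDr addrACA.
Qed.

Lemma mcp_linearr e : linear (mcp e).
Proof.
move=> a e1 e2; rewrite /mcp /= (hlc_linearr hL) (rep_linear hrho).
have [lin _] := rep_gc hrho e.1.
rewrite lin (linear_flip (linear_lin dM)) (linear_mapc linear_inL).
rewrite opprD -scalerN addrACA -scalerDr (linear_mapc linear_inM).
by rewrite scalerDr addrACA.
Qed.

Lemma mcp_twist e e' : mapc gE (mcp e e') = mcp (gE e) (gE e').
Proof.
have iL := addf_linear linear_inL; have iM := addf_linear linear_inM.
have gD := addf_linear (linear_dsum alpha beta).
have bD := addf_lin beta; have dD := addf_lin dM.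
rewrite /mcp (addf_mapc gD) !mapc_comp //; congr (_ + _).
  rewrite -hmult mapc_comp //; last exact: addf_lin.
  by apply: mapc_ext => c; rewrite /= /dsum /injL /= linear0.
have -> : rho (gE e).1 (gE e').2 - flip dM (rho (gE e').1 (gE e).2) =
   mapc beta (rho e.1 e'.2 - flip dM (rho e'.1 e.2)).
  rewrite (addf_mapc bD) (addfN (addf_mapc bD)) (flip_natural (dW' := dM)) //.
    by rewrite !(rep_beta hrho).
  by move=> c; rewrite (rep_beta_d hrho).
rewrite mapc_comp //.
by apply: mapc_ext => c; rewrite /= /dsum /injM /= linear0.
Qed.

Lemma mcp_dl e e' : mcp (dE e) e' = - mulX ord0 (mcp e e').
Proof.
have iL := addf_linear linear_inL; have iM := addf_linear linear_inM.
have XD (W : lmodType K) := @addf_mulX K 1 W ord0.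
have fD := addf_flip (linear_lin dM).
rewrite /mcp /dsum /= (hlc_dl hL) (rep_d hrho).
have [_ ->] := rep_gc hrho e'.1.
rewrite fD (flip_d (linear_lin dM)) (flip_mulX (linear_lin dM)) lam_max.
set f := flip dM _.
(* The flip changes ∂ + λ into ∂ + (- λ - ∂) = - λ, so the flipped term obeys the rule of a first
   argument. *)
rewrite (_ : mapc dM f + _ = - mulX ord0 f); last by zmodule.
rewrite XD -!mulX_mapc // opprD -!(addfN (addf_mapc iL)) -!(addfN (addf_mapc iM)).
congr (_ + mapc _ _).
by rewrite XD (addfN (XD M)) opprD.
Qed.

Lemma mcp_dr e e' : mcp e (dE e') = mapc dE (mcp e e') + mulX ord0 (mcp e e').
Proof.
have iL := addf_linear linear_inL; have iM := addf_linear linear_inM.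
have XD (W : lmodType K) := @addf_mulX K 1 W ord0.
have fD := addf_flip (linear_lin dM).
have dD := addf_linear (linear_dsum dL dM).
have dLD := addf_lin dL; have dMD := addf_lin dM.
rewrite /mcp /dsum /= (hlc_dr hL) (rep_d hrho).
have [_ ->] := rep_gc hrho e.1.
rewrite (addfN fD) (flip_mulX (linear_lin dM)) lam_max opprK.
have cL (P : pol 1 L) : mapc dE (mapc injL P) = mapc injL (mapc dL P).
  by rewrite !mapc_comp //; apply: mapc_ext => c; rewrite /= inL_d.
have cM (P : pol 1 M) : mapc dE (mapc injM P) = mapc injM (mapc dM P).
  by rewrite !mapc_comp //; apply: mapc_ext => c; rewrite /= inM_d.
rewrite (XD (L * M)%type) -!mulX_mapc // (addf_mapc dD) cL cM [RHS]addrACA.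
rewrite -(addf_mapc iL) -(addf_mapc iM); congr (_ + mapc _ _).
rewrite (addf_mapc dMD) (addfN (addf_mapc dMD)) XD (addfN (XD M)).
by zmodule.
Qed.

Lemma mcp_flip e e' : flip dE (mcp e' e) = - mcp e e'.
Proof.
have iL := addf_linear linear_inL; have iM := addf_linear linear_inM.
have dD := addf_linear (linear_dsum dL dM).
have dLD := addf_lin dL; have dMD := addf_lin dM.
have fM := addf_flip (linear_lin dM).
rewrite /mcp (addf_flip (linear_dsum dL dM)) opprD.
rewrite -(flip_natural _ iL dLD dD inL_d) -(flip_natural _ iM dMD dD inM_d).
rewrite -!(addfN (addf_mapc iL)) -!(addfN (addf_mapc iM)). congr (_ + _); congr (mapc _ _).
  by rewrite (hlc_skew hL e.1) opprK.
by rewrite fM (addfN fM) (flipK (linear_lin dM)) opprB.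
Qed.

Lemma mc_cochain : is_cochain dE dE gE gE mc.
Proof.
have u0 (v : {ffun 'I_2 -> E}) x : mc (upd v ord0 x) = mcp x (v ord_max).
  by rewrite mcE !ffunE.
have u1 (v : {ffun 'I_2 -> E}) x : mc (upd v ord_max x) = mcp (v ord0) x.
  by rewrite mcE !ffunE.
have ord2 (i : 'I_2) : i = ord0 \/ i = ord_max.
  by case: i => [[|[|m]] hm] //; [left | right]; apply: val_inj.
split.
- move=> v i a x y; case: (ord2 i) => ->.
    by rewrite !u0 mcp_linearl.
  by rewrite !u1 mcp_linearr.
- by move=> v; rewrite !mcE mcp_twist !ffunE.
- move=> v i i'; have -> : i' = ord0 by apply: val_inj; rewrite /i' ord1.
  by rewrite u0 mcp_dl -mcE (ord1 i).
- by move=> v; rewrite u1 mcp_dr -mcE big_ord1.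
- move=> t v.
  (* A permutation of two letters is determined by the preimage of 0: it is the identity or the
     transposition. *)
  have [t' et] := @lift_permP _ (t^-1%g ord0) ord0 t (permKV t ord0).
  move: et; rewrite (permS1 t'); case: (ord2 (t^-1%g ord0)) => -> ->.
    rewrite lift_perm1 odd_perm1 scale1r.
    have -> : [ffun i => v ((1%g : 'S_2) i)] = v by apply/ffunP => i; rewrite ffunE perm1.
    rewrite -[LHS]subst_mulX_id; apply: subst_ext => // i u.
    by rewrite perm1 /lam liftK.
  have e1 : lift_perm ord_max ord0 (1%g : 'S_1) ord_max = ord0 :> 'I_2 by rewrite lift_perm_id.
  have e0 (i : 'I_2) : i = 0 :> nat ->
      lift_perm ord_max ord0 (1%g : 'S_1) i = ord_max :> 'I_2.
    move=> i0; have -> : i = lift ord_max ord0 by apply: val_inj; rewrite /= i0.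
    by rewrite lift_perm_lift; apply: val_inj; rewrite /= perm1.
  rewrite odd_lift_perm odd_perm1 /= expr1 scaleN1r.
  transitivity (- flip dE (mc [ffun i => v (lift_perm ord_max ord0 (1%g : 'S_1) i)])).
    by rewrite !mcE !ffunE e1 e0 // mcp_flip opprK.
  by congr (- _); apply: subst_ext => // i u; rewrite e0 // lift_max (ord1 i).
Qed.

End DirectSum.

(** * The square of m_c + ρ *)

Section Jacobi.
Variables (K : fieldType) (L M : lmodType K).
Variables (dL : {linear L -> L}) (dM : {linear M -> M}).
Variables (br : L -> L -> pol 1 L) (alpha : {linear L -> L}).
Variables (rho : L -> M -> pol 1 M) (beta : {linear M -> M}).
Hypothesis hL : is_hom_lie_conformal dL br alpha.
Hypothesis hmult : is_multiplicative br alpha.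
Hypothesis hrho : is_representation dL dM br alpha rho beta.

Local Notation E := (L * M)%type.
Local Notation dE := (dsum dL dM).
Local Notation gE := (dsum alpha beta).
Local Notation mc := (mc_rho dM br rho).
Local Notation inL := (@injL K L M).
Local Notation inM := (@injM K L M).
Let dlin : linear dE := linear_dsum dL dM.
Let glin : linear gE := linear_dsum alpha beta.
Let dD : addf dE := addf_linear dlin.
Let gD : addf gE := addf_linear glin.
Let ged := gd hL hrho.
Let mcC := mc_cochain hL hmult hrho.
Let iL : addf inL := addf_linear (@linear_inL K L M).
Let iM : addf inM := addf_linear (@linear_inM K L M).

(* the action of [x : L] on [L + M], without the flipped term of [mc_rho] *)
Definition mcl (x : L) (e : E) : pol 1 E := mapc inL (br x e.1) + mapc inM (rho x e.2).

Lemma rho0 x : rho x 0 = 0.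
Proof. by have [lin _] := rep_gc hrho x; exact: (addf0 (addf_linear lin)). Qed.

Lemma br0 x : br x 0 = 0.
Proof. exact: (addf0 (addf_linear (hlc_linearr hL x))). Qed.

Lemma mcp_inL x e : mcp dM br rho (inL x) e = mcl x e.
Proof.
by rewrite /mcp /mcl /= rho0 (addf0 (addf_flip (linear_lin dM))) subr0.
Qed.

Lemma addf_mcl x : addf (mcl x).
Proof.
move=> e e'; rewrite -!mcp_inL; exact: (addf_linear (mcp_linearr hL hrho (inL x))).
Qed.

Section Operators.
Variables (A B : forall W : lmodType K, pol 2 W -> pol 2 W).
Hypotheses (AD : forall W, addf (A (W := W))) (BD : forall W, addf (B (W := W))).
Hypothesis Amap : forall (W W' : lmodType K) (m : W -> W') P, addf m -> mapc m (A P) = A (mapc m P).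
Hypothesis Bmap : forall (W W' : lmodType K) (m : W -> W') P, addf m -> mapc m (B P) = B (mapc m P).

Lemma addf_eval1 (W : lmodType K) : addf (eval1 (@B W)).
Proof. by apply: addf_subst => [i|]; [exact: BD | exact: addf_polC]. Qed.

Lemma eval1_map (W W' : lmodType K) (m : W -> W') (P : pol 1 W) : addf m ->
  mapc m (eval1 (@B W) P) = eval1 (@B W') (mapc m P).
Proof.
move=> mD; apply: subst_natural => // i Q; exact: Bmap.
Qed.

Lemma subst_map (V W W' : lmodType K) (m : W -> W') (F : V -> pol 2 W) (P : pol 1 V) : addf m ->
  mapc m (subst (fun=> @A W) F P) = subst (fun=> @A W') (fun c => mapc m (F c)) P.
Proof.
move=> mD; apply: (subst_morph (m := mapc m)); first exact: addf_mapc.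
by move=> i u; exact: Amap.
Qed.

(** [A] and [B] stand for multiplication by λ, μ or λ + μ. As these are natural in the module, a
    double action splits into its components in L and M, where the axioms apply. *)
Lemma subst_mcl x y e :
  subst (fun=> @A E) (fun c => eval1 (@B E) (mcl x c)) (mcl y e) =
  mapc inL (subst (fun=> @A L) (fun c => eval1 (@B L) (br x c)) (br y e.1)) +
  mapc inM (subst (fun=> @A M) (fun c => eval1 (@B M) (rho x c)) (rho y e.2)).
Proof.
have FD : addf (fun c => eval1 (@B E) (mcl x c)).
  exact: (addf_comp' (@addf_eval1 E) (addf_mcl x)).
have ADE (i : 'I_1) := @AD E.
rewrite {2}/mcl (addf_subst ADE FD) !subst_mapc // !subst_map //; congr (_ + _);
  apply: subst_ext => // c; rewrite eval1_map //; congr eval1.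
  by rewrite /mcl /= rho0 (addf0 (addf_mapc iM)) addr0.
by rewrite /mcl /= br0 (addf0 (addf_mapc iL)) add0r.
Qed.

Lemma subst_mcl_br e (P : pol 1 L) :
  subst (fun=> @A E) (fun w => eval1 (@B E) (mcl w e)) P =
  mapc inL (subst (fun=> @A L) (fun w => eval1 (@B L) (br w e.1)) P) +
  mapc inM (subst (fun=> @A M) (fun w => eval1 (@B M) (rho w e.2)) P).
Proof.
rewrite !subst_map // -substDl; last by move=> i; exact: AD.
by apply: subst_ext => // w; rewrite !eval1_map // -(@addf_eval1 E).
Qed.
End Operators.

Lemma mulX_map (i : 'I_2) (W W' : lmodType K) (m : W -> W') (P : pol 2 W) : addf m ->
  mapc m (mulX i P) = mulX i (mapc m P).
Proof. exact: mulX_mapc. Qed.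

Lemma addf_lamu (W : lmodType K) : addf (@lamu K W).
Proof. by apply: addf_add; exact: addf_mulX. Qed.

Lemma lamu_map (W W' : lmodType K) (m : W -> W') (P : pol 2 W) : addf m ->
  mapc m (lamu P) = lamu (mapc m P).
Proof. by move=> mD; rewrite /lamu (addf_mapc mD) !mulX_mapc. Qed.

(** The Jacobi identity of L and the bracket axiom of the representation are the two components of
    this one. *)
Lemma mcl_jacobi x y e :
  subst (fun=> @mu K E) (fun c => eval1 (@la K E) (mcl (alpha x) c)) (mcl y e) =
  subst (fun=> @la K E) (fun w => eval1 (@lamu K E) (mcl w (gE e))) (br x y) +
  subst (fun=> @la K E) (fun c => eval1 (@mu K E) (mcl (alpha y) c)) (mcl x e).
Proof.
have X0 (W : lmodType K) : addf (@la K W) by exact: addf_mulX.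
have X1 (W : lmodType K) : addf (@mu K W) by exact: addf_mulX.
rewrite (subst_mcl (A := @mu K) (B := @la K)) //; try exact: mulX_map.
rewrite (subst_mcl (A := @la K) (B := @mu K)) //; try exact: mulX_map.
rewrite (subst_mcl_br (A := @la K) (B := @lamu K)) //; try exact: mulX_map;
  try exact: addf_lamu; try exact: lamu_map.
rewrite addrACA -!(addf_mapc iL) -!(addf_mapc iM).
rewrite (hlc_jacobi hL) /= (rep_bracket hrho).
by rewrite subrK.
Qed.

Section Level.
Variable N : nat.
Local Notation key := (key N).
Local Notation X := (coinv N dD).
Local Notation pr := (pr (N := N) dD).
Local Notation lform := (@lform K E dE N dD).
Local Notation qx := (@qx K E dE N dD).
Local Notation qmap := (@qmap K E dE N dD).
Local Notation hat f := (@hat K E dE dlin N _ f).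
Local Notation ak := (@at_keys K E dE dlin N _).
Local Notation Pi := (hat mc).
Let PiC := hat_conf dlin N glin ged mcC.

Lemma Pi2 k e k' e' : Pi [:: pr (mono k e); pr (mono k' e')] = ak [:: k; k'] (mcp dM br rho e e').
Proof.
pose v : {ffun 'I_2 -> E} := [ffun i : 'I_2 => nth 0 [:: e; e'] i].
pose kk (i : 'I_2) := nth (kzero N) [:: k; k'] i.
have -> : [:: pr (mono k e); pr (mono k' e')] = args dlin kk v.
  by rewrite /args !word_lift0 word_nil /kk !ffunE.
rewrite (hat_args _ _ _ mcC) mcE !ffunE; congr ak.
by rewrite !word_lift0 word_nil.
Qed.

Lemma mapPi2 (F : X -> X) ks (P : pol 1 E) : addf F -> (forall j x, F (qx j x) = qx j (F x)) ->
  F (ak ks P) = subst (fun=> lform (nth (kzero N) ks 0).2)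
    (fun c => F (pr (mono (ksum ks) c))) P.
Proof.
move=> FD FX; rewrite /at_keys (subst_morph (m := F)
  (A' := fun i : 'I_1 => lform (nth (kzero N) ks i).2)) //.
  by apply: subst_ext => // i u; rewrite (ord1 i).
by move=> i u; exact: (lform_comm _ (m := F)).
Qed.

Lemma prho_subst ks (A B : pol 2 E -> pol 2 E) (a b : X -> X) (V : lmodType K)
    (F : V -> pol 1 E) (P : pol 1 V) :
  (forall Q, ak ks (A Q) = a (ak ks Q)) -> (forall Q, ak ks (B Q) = b (ak ks Q)) ->
  ak ks (subst (fun=> A) (fun c => eval1 B (F c)) P) =
  subst (fun=> a) (fun c => subst (fun=> b) (fun c' => pr (mono (ksum ks) c')) (F c)) P.
Proof.
move=> hA hB; rewrite (subst_morph (m := ak ks) (A' := fun=> a)) //; last exact: addf_at_keys.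
apply: subst_ext => // c; rewrite /eval1 /eval.
rewrite (subst_morph (m := ak ks) (A' := fun=> b)) //; last exact: addf_at_keys.
by apply: subst_ext => // c'; rewrite at_keys_polC.
Qed.

Lemma Pi_slot1 u : addf (fun x => Pi [:: x; u]) /\ (forall j x, Pi [:: qx j x; u] = qx j (Pi [:: x; u])).
Proof.
have [[PD _ _ _] _ PX] := PiC.
by split=> [x y|j x]; [exact: (PD [::]) | exact: (PX j [::])].
Qed.

Lemma Pi_slot2 u : addf (fun x => Pi [:: u; x]) /\ (forall j x, Pi [:: u; qx j x] = qx j (Pi [:: u; x])).
Proof.
have [[PD _ _ _] _ PX] := PiC.
by split=> [x y|j x]; [exact: (PD [:: u]) | exact: (PX j [:: u])].
Qed.

Lemma gE_inL x : gE (inL x) = inL (alpha x).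
Proof. by rewrite /dsum /injL /= linear0. Qed.

Lemma qgU k e : qmap gE (pr (mono k e)) = pr (mono k (gE e)).
Proof. exact: qmapU. Qed.

Lemma kaddr0 (k : key) : kadd k (kzero N) = k.
Proof. by rewrite kaddC kadd0. Qed.

Lemma ksumS (k : key) ks : ksum (k :: ks) = kadd k (ksum ks).
Proof. by rewrite /ksum big_cons. Qed.

Lemma ksum_nil : ksum [::] = kzero N.
Proof. by rewrite /ksum big_nil. Qed.

(** This is the image of [mcl_jacobi] under [at_keys]: the forms of the keys k0, k1 and k0 + k1 are
    the values of λ, μ and λ + μ. *)
Lemma Pi_jacobi k0 k1 k2 x y e :
  let a := pr (mono k0 (inL x)) in let b := pr (mono k1 (inL y)) in
  let c := pr (mono k2 e) in
  Pi [:: qmap gE a; Pi [:: b; c]] =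
  Pi [:: Pi [:: a; b]; qmap gE c] + Pi [:: qmap gE b; Pi [:: a; c]].
Proof.
move=> a b c; pose ks := [:: k0; k1; k2].
have h0 (Q : pol 2 E) : ak ks (@la K E Q) = lform k0.2 (ak ks Q) by exact: at_keys_mulX.
have h1 (Q : pol 2 E) : ak ks (@mu K E Q) = lform k1.2 (ak ks Q) by exact: at_keys_mulX.
have h01 (Q : pol 2 E) : ak ks (@lamu K E Q) = lform (kadd k0 k1).2 (ak ks Q).
  by rewrite /lamu addf_at_keys h0 h1 -lformD.
have e1 : Pi [:: qmap gE a; Pi [:: b; c]] =
    ak ks (subst (fun=> @mu K E) (fun c => eval1 (@la K E) (mcl (alpha x) c)) (mcl y e)).
  rewrite (prho_subst _ _ h1 h0) Pi2 mcp_inL qgU gE_inL.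
  have [D C] := Pi_slot2 (pr (mono k0 (inL (alpha x)))).
  rewrite (mapPi2 _ _ D C); apply: subst_ext => // w; rewrite Pi2 mcp_inL.
  apply: subst_ext => [i u|w']; first by rewrite (ord1 i).
  by congr (pr (mono _ _)); rewrite !ksumS !ksum_nil !kaddr0.
have e2 : Pi [:: qmap gE b; Pi [:: a; c]] =
    ak ks (subst (fun=> @la K E) (fun c => eval1 (@mu K E) (mcl (alpha y) c)) (mcl x e)).
  rewrite (prho_subst _ _ h0 h1) Pi2 mcp_inL qgU gE_inL.
  have [D C] := Pi_slot2 (pr (mono k1 (inL (alpha y)))).
  rewrite (mapPi2 _ _ D C); apply: subst_ext => // w; rewrite Pi2 mcp_inL.
  apply: subst_ext => [i u|w']; first by rewrite (ord1 i).
  by congr (pr (mono _ _)); rewrite !ksumS !ksum_nil !kaddr0 !kaddA (kaddC k1).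
have e3 : Pi [:: Pi [:: a; b]; qmap gE c] =
    ak ks (subst (fun=> @la K E) (fun w => eval1 (@lamu K E) (mcl w (gE e))) (br x y)).
  rewrite (prho_subst _ _ h0 h01) Pi2 mcp_inL qgU.
  have [D C] := Pi_slot1 (pr (mono k2 (gE e))).
  have -> : mcl x (inL y) = mapc inL (br x y).
    by rewrite /mcl /= rho0 (addf0 (addf_mapc iM)) addr0.
  rewrite (mapPi2 _ _ D C) subst_mapc //; last first.
  - by apply: (addf_comp' D); exact: addf_mono_pr.
  - by move=> i; exact: addf_lform.
  apply: subst_ext => // w; rewrite Pi2 mcp_inL.
  apply: subst_ext => [i u|w'].
    by rewrite (ord1 i) [nth _ _ _]/= !ksumS ksum_nil kaddr0.
  by congr (pr (mono _ _)); rewrite !ksumS !ksum_nil !kaddr0 -!kaddA.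
by rewrite e1 e2 e3 mcl_jacobi addf_at_keys.
Qed.

Definition prL (e : E) : E := (e.1, 0).
Definition prM (e : E) : E := (0, e.2).

Lemma prL_add : addf prL.
Proof. by move=> [x a] [y b]; rewrite /prL; congr pair; rewrite /= addr0. Qed.
Lemma prM_add : addf prM.
Proof. by move=> [x a] [y b]; rewrite /prM; congr pair; rewrite /= addr0. Qed.
Lemma prL_d c : prL (dE c) = dE (prL c).
Proof. by rewrite /prL /dsum /= linear0. Qed.
Lemma prM_d c : prM (dE c) = dE (prM c).
Proof. by rewrite /prM /dsum /= linear0. Qed.

Local Notation pL := (qmap prL).
Local Notation pM := (qmap prM).

Lemma pLD : addf pL. Proof. exact: (addf_qmap prL_add prL_d). Qed.
Lemma pMD : addf pM. Proof. exact: (addf_qmap prM_add prM_d). Qed.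

Lemma pLM u : pL u + pM u = u.
Proof.
apply: (coinv_ext (f := fun u => pL u + pM u) (f' := id)) => // [|c k].
  by apply: addf_add; [exact: pLD | exact: pMD].
rewrite (qmapU _ prL_add prL_d) (qmapU _ prM_add prM_d) -addf_mono_pr.
by congr (pr (mono _ _)); case: c => x a; congr pair; rewrite /= ?addr0 ?add0r.
Qed.

Lemma pLpM u : pL (pM u) = 0.
Proof.
apply: (coinv_ext (f := fun u => pL (pM u)) (f' := fun=> 0)) => [||c k].
- exact: addf_comp' pLD pMD.
- by move=> x y; rewrite addr0.
rewrite (qmapU _ prM_add prM_d) (qmapU _ prL_add prL_d).
exact: (addf0 (addf_mono_pr _ _)).
Qed.

Lemma pMpL u : pM (pL u) = 0.
Proof.
apply: (coinv_ext (f := fun u => pM (pL u)) (f' := fun=> 0)) => [||c k].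
- exact: addf_comp' pMD pLD.
- by move=> x y; rewrite addr0.
rewrite (qmapU _ prL_add prL_d) (qmapU _ prM_add prM_d).
exact: (addf0 (addf_mono_pr _ _)).
Qed.

(* L has weighted 0 and M has weighted 1 *)
Definition weighted (k : int) (u : X) : Prop :=
  if k == 0 then pM u = 0 else if k == 1 then pL u = 0 else u = 0.

Lemma weight0 k : weighted k 0.
Proof. by rewrite /weighted (addf0 pLD) (addf0 pMD); case: eqP => // _; case: eqP. Qed.

Lemma weightB k u v : weighted k u -> weighted k v -> weighted k (u - v).
Proof.
rewrite /weighted !(addfN pLD, addfN pMD, pLD, pMD).
by case: eqP => [_ -> ->|_]; [|case: eqP => [_ -> ->|_ -> ->]]; rewrite subrr.
Qed.

Lemma weight_gE k u : weighted k u -> weighted k (qmap gE u).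
Proof.
have hL' v : pL (qmap gE v) = qmap gE (pL v).
  apply: (coinv_ext (f := fun v => pL (qmap gE v)) (f' := fun v => qmap gE (pL v))) => [||c j].
  - by apply: addf_comp'; [exact: pLD | exact: addf_qmap].
  - by apply: addf_comp'; [exact: addf_qmap | exact: pLD].
  rewrite qgU !(qmapU _ prL_add prL_d) qgU; congr (pr (mono _ _)).
  by rewrite /prL /dsum /= linear0.
have hM' v : pM (qmap gE v) = qmap gE (pM v).
  apply: (coinv_ext (f := fun v => pM (qmap gE v)) (f' := fun v => qmap gE (pM v))) => [||c j].
  - by apply: addf_comp'; [exact: pMD | exact: addf_qmap].
  - by apply: addf_comp'; [exact: addf_qmap | exact: pMD].
  rewrite qgU !(qmapU _ prM_add prM_d) qgU; congr (pr (mono _ _)).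
  by rewrite /prM /dsum /= linear0.
have g0 : qmap gE 0 = 0 by apply: addf0; exact: addf_qmap.
rewrite /weighted hL' hM'; case: eqP => [_ -> //|_].
by case: eqP => [_ -> //|_ ->].
Qed.

Lemma weight_iter m k u : weighted k u -> weighted k (iter m (qmap gE) u).
Proof. by move=> h; elim: m => //= m; exact: weight_gE. Qed.

Lemma pLU k e : pL (pr (mono k e)) = pr (mono k (inL e.1)).
Proof. exact: (qmapU _ prL_add prL_d). Qed.
Lemma pMU k e : pM (pr (mono k e)) = pr (mono k (inM e.2)).
Proof. exact: (qmapU _ prM_add prM_d). Qed.

Lemma bilinear_ext (G : X -> X -> X) : (forall v, addf (G^~ v)) -> (forall u, addf (G u)) ->
  (forall k e k' e', G (pr (mono k e)) (pr (mono k' e')) = 0) -> forall u v, G u v = 0.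
Proof.
move=> G1 G2 G0 u v; have z : addf (fun _ : X => 0 : X) by move=> x y; rewrite addr0.
apply: (coinv_ext (f := G^~ v) (f' := fun=> 0)) => // c k.
apply: (coinv_ext (f := G (pr (mono k c))) (f' := fun=> 0)) => // c' k'.
Qed.

Lemma PiDl v : addf (fun u => Pi [:: u; v]).
Proof. by have [] := Pi_slot1 v. Qed.
Lemma PiDr u : addf (fun v => Pi [:: u; v]).
Proof. by have [] := Pi_slot2 u. Qed.
Lemma PiC2 u v : Pi [:: u; v] = - Pi [:: v; u].
Proof. by have [[_ PA _ _] _ _] := PiC; exact: (PA [::]). Qed.

Lemma pM_at_keys_inL n ks (P : pol n L) : pM (ak ks (mapc inL P)) = 0.
Proof.
rewrite (at_keys_mapc _ _ _ prM_add prM_d) mapc_comp //; last exact: prM_add.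
rewrite (_ : mapc _ P = 0) ?(addf0 (addf_at_keys _ _)) //.
by apply/malgP => j; rewrite mapcE // mcoeff0.
Qed.

Lemma pL_at_keys_inM n ks (P : pol n M) : pL (ak ks (mapc inM P)) = 0.
Proof.
rewrite (at_keys_mapc _ _ _ prL_add prL_d) mapc_comp //; last exact: prL_add.
rewrite (_ : mapc _ P = 0) ?(addf0 (addf_at_keys _ _)) //.
by apply/malgP => j; rewrite mapcE // mcoeff0.
Qed.

Lemma br0l x : br 0 x = 0.
Proof. exact: (addf0 (addf_linear (hlc_linearl hL x))). Qed.
Lemma rho0l a : rho 0 a = 0.
Proof. exact: (addf0 (addf_linear (rep_linear hrho a))). Qed.

Lemma Pi_LL u v : pM (Pi [:: pL u; pL v]) = 0.
Proof.
apply: (bilinear_ext (G := fun u v => pM (Pi [:: pL u; pL v]))) => [v'|u'|k e k' e'].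
- exact: (addf_comp' pMD (addf_comp' (PiDl _) pLD)).
- exact: (addf_comp' pMD (addf_comp' (PiDr _) pLD)).
rewrite !pLU Pi2 mcp_inL /mcl /= rho0 (addf0 (addf_mapc iM)) addr0.
exact: pM_at_keys_inL.
Qed.

Lemma Pi_LM u v : pL (Pi [:: pL u; pM v]) = 0.
Proof.
apply: (bilinear_ext (G := fun u v => pL (Pi [:: pL u; pM v]))) => [v'|u'|k e k' e'].
- exact: (addf_comp' pLD (addf_comp' (PiDl _) pLD)).
- exact: (addf_comp' pLD (addf_comp' (PiDr _) pMD)).
rewrite pLU pMU Pi2 mcp_inL /mcl /= br0 (addf0 (addf_mapc iL)) add0r.
exact: pL_at_keys_inM.
Qed.

Lemma Pi_MM u v : Pi [:: pM u; pM v] = 0.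
Proof.
apply: (bilinear_ext (G := fun u v => Pi [:: pM u; pM v])) => [v'|u'|k e k' e'].
- exact: (addf_comp' (PiDl _) pMD).
- exact: (addf_comp' (PiDr _) pMD).
rewrite !pMU Pi2 /mcp /= br0 !rho0l (addf0 (addf_flip (linear_lin dM))) subr0.
by rewrite (addf0 (addf_mapc iL)) (addf0 (addf_mapc iM)) addr0 (addf0 (addf_at_keys _ _)).
Qed.

Lemma weight_case k u : weighted k u ->
  [\/ k = 0 /\ u = pL u, k = 1 /\ u = pM u | u = 0].
Proof.
rewrite /weighted; case: eqP => [-> h|_].
  by apply: Or31; split=> //; rewrite -[LHS]pLM h addr0.
case: eqP => [-> h|_ h]; last exact: Or33.
by apply: Or32; split=> //; rewrite -[LHS]pLM h add0r.
Qed.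

Lemma Pi_shifts : shifts weighted 0 Pi.
Proof.
have [[_ _ PZ _] _ _] := PiC.
case=> [|[k1 u1] [|[k2 u2] [|p ps]]] h; try by rewrite PZ //; exact: weight0.
have h1 : weighted k1 u1 by apply: (h (k1, u1)); rewrite mem_head.
have {}h1 := weight_case h1.
have h2 : weighted k2 u2 by apply: (h (k2, u2)); rewrite !inE eqxx orbT.
have {}h2 := weight_case h2.
rewrite !big_cons big_nil subr0 addr0 /=.
case: h1 => [[-> ->]|[-> ->]|->]; last by rewrite (addf0 (PiDl _)); exact: weight0.
  case: h2 => [[-> ->]|[-> ->]|->]; last by rewrite (addf0 (PiDr _)); exact: weight0.
    exact: Pi_LL.
  exact: Pi_LM.
case: h2 => [[-> ->]|[-> ->]|->]; last by rewrite (addf0 (PiDr _)); exact: weight0.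
  by rewrite /weighted /= PiC2 (addfN pLD) Pi_LM oppr0.
by rewrite Pi_MM; exact: weight0.
Qed.

(** Of three homogeneous arguments two lie in L or two lie in M, and alternation moves these to the
    front. Two in L is [Pi_jacobi]; with two in M the value has weight at least 2, where only 0
    lives. *)
Lemma Pi_square s : pcirc (qmap gE) 1 Pi Pi s = 0.
Proof.
have [PA _ _] := PiC; have gX : addf (qmap gE) := addf_qmap gD ged.
have [JD JA JZ _] := pcirc_alt gX PA PA.
set J := pcirc _ _ _ _ in JD JA JZ *.
have Jsh : shifts weighted (0 + 0) J.
  apply: (comp_shifts weight0 weightB (~~ odd 1) _ Pi_shifts Pi_shifts).
  exact: weight_gE.
rewrite addr0 in Jsh.
case: s => [|a [|b [|c [|d s]]]]; try exact: JZ.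
have J1 v w : addf (fun u => J [:: u; v; w]) by move=> x y; exact: (JD [::]).
have J2 u w : addf (fun v => J [:: u; v; w]) by move=> x y; exact: (JD [:: u]).
have J3 u v : addf (fun w => J [:: u; v; w]) by move=> x y; exact: (JD [:: u; v]).
have JLL u v w : J [:: pL u; pL v; w] = 0.
  apply: (bilinear_ext (G := fun u v => J [:: pL u; pL v; w])) => [v'|u'|k e k' e'].
  - exact: (addf_comp' (J1 _ _) pLD).
  - exact: (addf_comp' (J2 _ _) pLD).
  apply: (coinv_ext (f := fun w => J [:: pL _; pL _; w]) (f' := fun=> 0)) => // [x y|e'' k''].
    by rewrite addr0.
  rewrite !pLU /J pcirc_pair // (PiC2 _ (qmap gE (pr (mono k (inL e.1))))) Pi_jacobi.
  rewrite (PiC2 (qmap gE _)); zmodule.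
have w0 u : weighted 0 (pL u) by exact: pMpL.
have w1 u : weighted 1 (pM u) by exact: pLpM.
have JMM u v w : J [:: pM u; pM v; w] = 0.
  rewrite -[w]pLM J3.
  have h k x : weighted k x -> weighted (1 + (1 + k)) (J [:: pM u; pM v; x]).
    move=> hx; have := Jsh [:: (1, pM u); (1, pM v); (k, x)].
    rewrite !big_cons big_nil /= subr0 addr0; apply=> p; rewrite !inE.
    by move=> /or3P[] /eqP -> //=; exact: w1.
  have := h 0 _ (w0 w); have := h 1 _ (w1 w); rewrite /weighted /= => -> ->.
  by rewrite addr0.
have JLM u v w : J [:: pL u; pM v; w] = 0.
  rewrite -[w]pLM J3 (JA [:: pL u]) JLL oppr0 add0r (JA [::]) /=.
  by rewrite (JA [:: pM v]) JMM !oppr0.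
rewrite -[a]pLM -[b]pLM J1 !J2 JLL JLM JMM (JA [::]) /= JLM oppr0 !addr0.
by [].
Qed.
End Level.
End Jacobi.

(** * Cochains from M to L *)

Section Embed.
Variables (K : fieldType) (L M : lmodType K).
Variables (dL : {linear L -> L}) (dM : {linear M -> M}).
Variables (alpha : {linear L -> L}) (beta : {linear M -> M}).
Local Notation E := (L * M)%type.
Local Notation dE := (dsum dL dM).
Local Notation gE := (dsum alpha beta).
Local Notation inL := (@injL K L M).
Local Notation inM := (@injM K L M).
Let dlin : linear dE := linear_dsum dL dM.
Let iL : addf inL := addf_linear (@linear_inL K L M).

Definition snds n (e : {ffun 'I_n.+1 -> E}) : {ffun 'I_n.+1 -> M} := [ffun i => (e i).2].
Definition inMs n (v : {ffun 'I_n.+1 -> M}) : {ffun 'I_n.+1 -> E} := [ffun i => inM (v i)].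

Lemma embedE n (f : raw n M L) e : embed f e = mapc inL (f (snds e)).
Proof. by []. Qed.

Lemma snds_upd n (e : {ffun 'I_n.+1 -> E}) i x : snds (upd e i x) = upd (snds e) i x.2.
Proof. by apply/ffunP => j; rewrite !ffunE; case: eqP. Qed.

Lemma inMsK n (v : {ffun 'I_n.+1 -> M}) : snds (inMs v) = v.
Proof. by apply/ffunP => j; rewrite !ffunE. Qed.

Lemma mapc_inL_inj n : injective (@mapc K n L E inL).
Proof.
move=> P Q e; apply/malgP => k.
have := congr1 (fun R : pol n E => R@_k) e; by rewrite !mapcE // => -[].
Qed.

Lemma gE_inL' n (P : pol n L) : mapc gE (mapc inL P) = mapc inL (mapc alpha P).
Proof.
have gD := addf_linear (linear_dsum alpha beta).
rewrite !mapc_comp //; last exact: addf_lin.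
by apply: mapc_ext => c; rewrite /= /dsum /injL /= linear0.
Qed.

Lemma dE_inL n (P : pol n L) : mapc dE (mapc inL P) = mapc inL (mapc dL P).
Proof.
have dD := addf_linear dlin.
rewrite !mapc_comp //; last exact: addf_lin.
by apply: mapc_ext => c; rewrite /= (inL_d dL dM).
Qed.

Lemma eval_lam_inL n (t : 'I_n -> 'I_n.+1) (P : pol n L) :
  mapc inL (eval (fun i => lam dL (t i)) P) = eval (fun i => lam dE (t i)) (mapc inL P).
Proof.
have dLD := addf_lin dL; have dD := addf_linear dlin.
apply: subst_natural => // [i|i Q]; first exact: addf_lam.
by apply: lam_natural => // c; rewrite (inL_d dL dM).
Qed.

Lemma embed_cochain n (f : raw n M L) :
  is_cochain dM dL beta alpha f <-> is_cochain dE dE gE gE (embed f).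
Proof.
have XL (i : 'I_n) P : mapc inL (mulX i P) = mulX i (mapc inL P) by exact: mulX_mapc.
have mD := addf_mapc (n := n) iL.
split=> [] [h1 h2 h3 h4 h5]; split.
- move=> v i a x y; rewrite !embedE !snds_upd /=.
  by rewrite h1 (linear_mapc (@linear_inL K L M)).
- move=> v; rewrite !embedE gE_inL' h2; congr (mapc _ (f _)).
  by apply/ffunP => i; rewrite !ffunE.
- move=> v i /=; rewrite !embedE snds_upd -XL -(addfN mD) -h3 /=; congr (mapc _ (f (upd _ _ _))).
  by rewrite !ffunE.
- move=> v; rewrite !embedE snds_upd dE_inL.
  under eq_bigr => i _ do rewrite -XL.
  rewrite -(addf_sum mD) -mD -h4; congr (mapc _ (f (upd _ _ _))).
  by rewrite !ffunE.
- move=> t v; rewrite !embedE (h5 t) !scale_sg (addf_sg mD) eval_lam_inL.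
  congr (sg _ (eval _ (mapc _ (f _)))).
  by apply/ffunP => i; rewrite !ffunE.
- move=> v i a x y; apply: mapc_inL_inj; rewrite (linear_mapc (@linear_inL K L M)).
  have := h1 (inMs v) i a (inM x) (inM y).
  by rewrite -(linear_inM L a x y) !embedE !snds_upd !inMsK.
- move=> v; apply: mapc_inL_inj; rewrite -gE_inL'.
  have := h2 (inMs v); rewrite !embedE inMsK => ->; congr (mapc _ (f _)).
  by apply/ffunP => i; rewrite !ffunE.
- move=> v i /=; apply: mapc_inL_inj; rewrite (addfN mD) XL.
  have /= := h3 (inMs v) i; rewrite !embedE snds_upd inMsK => <-.
  by rewrite !ffunE.
- move=> v; apply: mapc_inL_inj; rewrite mD (addf_sum mD) -dE_inL.
  under eq_bigr => i _ do rewrite XL.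
  have := h4 (inMs v); rewrite !embedE snds_upd inMsK => <-.
  by rewrite !ffunE.
- move=> t v; apply: mapc_inL_inj; rewrite scale_sg (addf_sg mD) eval_lam_inL -scale_sg.
  have := h5 t (inMs v); rewrite !embedE inMsK => ->.
  congr (_ *: eval _ (mapc _ (f _))).
  by apply/ffunP => i; rewrite !ffunE.
Qed.

Hypothesis gd : forall c, gE (dE c) = dE (gE c).

(** * Weight arguments for cochains from M to L *)

Section Level.
Variable N : nat.
Let dD : addf dE := addf_linear dlin.
Let glin : linear gE := linear_dsum alpha beta.
Local Notation X := (coinv N dD).
Local Notation pr := (pr (N := N) dD).
Local Notation qmap := (@qmap K E dE N dD).
Local Notation hat f := (@hat K E dE dlin N _ f).
Local Notation ak := (@at_keys K E dE dlin N _).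
Local Notation pL := (qmap (@prL K L M)).
Local Notation pM := (qmap (@prM K L M)).
Local Notation weight := (@weighted K L M dL dM N).

Lemma pure_ext (U : zmodType) (F F' : seq X -> U) s : multiadd F -> multiadd F' ->
  (forall ps : seq (bool * X),
     let t := map (fun p => if p.1 then pM p.2 else pL p.2) ps in F t = F' t) ->
  F s = F' s.
Proof.
elim: s F F' => [|x s IHs] F F' FD FD' e; first exact: (e [::]).
rewrite -(pLM x) (FD [::]) (FD' [::]) /=; congr (_ + _).
- apply: (IHs (fun s => F (_ :: s)) (fun s => F' (_ :: s))).
  + by move=> s1; apply: (FD (_ :: s1)).
  + by move=> s1; apply: (FD' (_ :: s1)).
  + by move=> ps; apply: (e ((false, x) :: ps)).
- apply: (IHs (fun s => F (_ :: s)) (fun s => F' (_ :: s))).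
  + by move=> s1; apply: (FD (_ :: s1)).
  + by move=> s1; apply: (FD' (_ :: s1)).
  + by move=> ps; apply: (e ((true, x) :: ps)).
Qed.

Lemma shifts_pure w F (ps : seq (bool * X)) : shifts weight w F ->
  weight ((count (fun p => p.1) ps)%:Z - w) (F (map (fun p => if p.1 then pM p.2 else pL p.2) ps)).
Proof.
move=> hF.
have := hF [seq ((nat_of_bool p.1)%:Z, if p.1 then pM p.2 else pL p.2) | p <- ps].
rewrite -map_comp big_map /=.
have -> : \sum_(p <- ps) (nat_of_bool p.1)%:Z = (count (fun p => p.1) ps)%:Z.
  by elim: ps => [|p ps IHps]; rewrite ?big_nil // big_cons IHps /= PoszD.
apply=> p /mapP[[b x] _ ->] /=.
by case: b; [exact: pLpM | exact: pMpL].
Qed.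

Lemma weight_neg k u : (k < 0)%R -> weight k u -> u = 0.
Proof. by rewrite /weighted => hk; case: eqP => [e|_]; [|case: eqP => [e|_]] => //; lia. Qed.

(** Arguments have weight at most 1, so [a] of them cannot reach the weight [w] that [F] removes. *)
Lemma shifts_vanish a (w : nat) F s : (a < w)%N -> multiadd F -> arity 0 a F ->
  shifts weight w F -> F s = 0.
Proof.
move=> aw FD FZ hF; apply: (pure_ext (F' := fun=> 0)) => // [s1 x y s2|ps t].
  by rewrite addr0.
case: (eqVneq (size t) a) => st; last by apply: FZ; rewrite addn0.
apply: weight_neg (shifts_pure ps hF).
have := count_size (fun p => p.1) ps.
have -> : size ps = a by rewrite -st size_map.
by move=> ca; lia.
Qed.

(* The arguments have weight at most 1, so their total weight reaches the arity
   only on [M]-components. *)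
Lemma shifts_full a F s : multiadd F -> arity 0 a F -> shifts weight a F ->
  F s = F (map pM s) /\ pM (F s) = 0.
Proof.
move=> FD FZ hF.
(* One argument in L makes the total weight smaller than [a], so the value has negative weight. *)
have small ps : ~~ all (fun p => p.1) ps ->
    F (map (fun p => if p.1 then pM p.2 else pL p.2) ps) = 0.
  move=> nall; case: (eqVneq (size ps) a) => st; last by apply: FZ; rewrite addn0 size_map.
  apply: weight_neg (shifts_pure ps hF).
  rewrite Num.Theory.subr_lt0 ltz_nat -st ltn_neqAle count_size andbT.
  by rewrite -all_count.
have full ps : all (fun p => p.1) ps ->
    pM (F (map (fun p => if p.1 then pM p.2 else pL p.2) ps)) = 0.
  move=> hall; case: (eqVneq (size ps) a) => st; last first.
    by rewrite FZ ?addn0 ?size_map // (addf0 (@pMD _ _ _ _ _ _)).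
  have := shifts_pure ps hF; move: hall; rewrite all_count => /eqP ->.
  by rewrite st subrr.
split.
  apply: (pure_ext (F' := fun s => F (map pM s))) => // [s1 x y s2|ps t].
    by rewrite !map_cat /= pMD FD.
  case: (boolP (all (fun p => p.1) ps)) => hall.
    congr F; rewrite /t -map_comp; apply/esym/eq_in_map => p hp /=.
    rewrite (allP hall p hp).
    by rewrite -[RHS](pLM (pM p.2)) pLpM add0r.
  rewrite small // /t -map_comp.
  have {hall} [p hp np] := allPn hall.
  have [s1 [s2 ->]] : exists s1 s2, ps = s1 ++ p :: s2.
    by case/splitPr: hp => s1 s2; exists s1, s2.
  rewrite map_cat /= (negPf np) pMpL.
  by rewrite (@addf0 _ _ (fun x => F (_ ++ x :: _))) // => x y; exact: FD.
apply: (pure_ext (F := fun s => pM (F s)) (F' := fun=> 0)) => [s1 x y s2|s1 x y s2|ps t].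
- by rewrite FD pMD.
- by rewrite addr0.
case: (boolP (all (fun p => p.1) ps)) => hall; first exact: full.
by rewrite /t small // (addf0 (@pMD _ _ _ _ _ _)).
Qed.

(** On n + 1 arguments of weight 1 the value lies in L, of weight 0. An argument of any other weight
    has no M-component, and then the value is 0. *)
Lemma embed_shifts n (f : raw n M L) : is_cochain dM dL beta alpha f ->
  shifts weight n.+1 (hat (embed f)).
Proof.
move=> /embed_cochain hf ps hps.
have [[FD FA FZ _] _ _] := hat_conf dlin N glin gd hf.
case: (boolP (all (fun p => p.1 == 1) ps)) => hall.
  case: (eqVneq (size ps) n.+1) => sz; last first.
    by rewrite FZ ?addn0 ?size_map //; exact: weight0.
  have -> : \sum_(p <- ps) p.1 = (size ps)%:Z.
    elim: ps {hps sz} hall => [|p ps IHps]; rewrite ?big_nil // big_cons /=.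
    by case/andP => /eqP -> /IHps ->.
  rewrite sz subrr /weighted eqxx.
  apply: (multiadd_ext (F := fun s => pM (hat (embed f) s)) (F' := fun=> 0)) => [s1 x y s2|s1 x y s2|t].
  - by rewrite FD pMD.
  - by rewrite addr0.
  rewrite (hat_item _ hf) /hitem; case: eqP => _; last by rewrite (addf0 (@pMD _ _ _ _ _ _)).
  by rewrite embedE; exact: pM_at_keys_inL.
have [p hp np] := allPn hall.
suff -> : hat (embed f) (map snd ps) = 0 by exact: weight0.
have Fsnd s : hat (embed f) s = hat (embed f) (map pM s).
  apply: (multiadd_ext (F := hat (embed f)) (F' := fun s => hat (embed f) (map pM s))) => // [s1 x y s2|t].
    by rewrite !map_cat /= pMD FD.
  have -> : map pM (map (pr \o @item _ _) t) = map (pr \o @item _ _) (map (fun p => (inM p.1.2, p.2)) t).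
    by rewrite -!map_comp; apply: eq_map => -[e k] /=; exact: pMU.
  rewrite !(hat_item _ hf) /hitem size_map; case: eqP => // _.
  rewrite !embedE; congr (ak _ (mapc _ (f _))).
    by rewrite /unzip2 -map_comp.
  apply/ffunP => i; rewrite !ffunE /unzip1 -map_comp.
  case: (ltnP i (size t)) => h; last by rewrite !nth_default ?size_map.
  by rewrite !(nth_map (0, kzero N)).
have [s1 [s2 ->]] : exists s1 s2, ps = s1 ++ p :: s2.
  by case/splitPr: hp => s1 s2; exists s1, s2.
rewrite Fsnd !map_cat /=.
suff -> : pM p.2 = 0.
  by rewrite (@addf0 _ _ (fun x => hat (embed f) (_ ++ x :: _))) // => x y; exact: FD.
have := hps p hp; rewrite /weighted (negPf np).
by case: eqP => // _ ->; rewrite (addf0 (@pMD _ _ _ _ _ _)).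
Qed.

End Level.
End Embed.

(** * The derived bracket *)

Section Zero.
Variables (K : fieldType).

Lemma subst0r n (W : lmodType K) (U : zmodType) (A : 'I_n -> U -> U) (F : W -> U) :
  subst A F 0 = 0.
Proof. by rewrite substE /lext msupp0 big_seq_fset0. Qed.

Variables (E : lmodType K) (dE gE : E -> E).
Hypothesis dlin : linear dE.

(** In degree 0 only the zero map is allowed. The transfer to alternating maps needs positive
    degrees, so brackets with 0 are computed directly. *)
Lemma circ0r N m n (f : raw m E E) : @circ K E dE gE N m n f 0 = 0.
Proof.
apply/funext => e; rewrite /circ big1 // => t _.
by rewrite [X in subst _ _ X](_ : _ = 0) // subst0r scaler0.
Qed.

Lemma circ0l N m n (g : raw n E E) : @circ K E dE gE N m n 0 g = 0.
Proof.
apply/funext => e; rewrite /circ big1 // => t _.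
rewrite (@subst_ext _ _ _ _ _ (fun i : 'I_n => lam dE (t (inord i))) _ (fun=> 0)) //.
  by rewrite subst0l ?scaler0 // => i; exact: (addf_lam (addf_linear dlin)).
by move=> c; rewrite /eval [X in subst _ _ X](_ : _ = 0) // subst0r.
Qed.

Lemma nr0r N m n (f : raw m E E) : @nr K E dE gE N m n f 0 = 0.
Proof.
by apply/funext => e; rewrite /nr circ0r circ0l -[LHS]/(0 - (-1) ^+ (m * n) *: 0) scaler0 subr0.
Qed.

Lemma nr0l N m n (g : raw n E E) : @nr K E dE gE N m n 0 g = 0.
Proof.
by apply/funext => e; rewrite /nr circ0r circ0l -[LHS]/(0 - (-1) ^+ (m * n) *: 0) scaler0 subr0.
Qed.
End Zero.

Section Main.
Variables (K : fieldType) (L M : lmodType K).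
Variables (dL : {linear L -> L}) (dM : {linear M -> M}).
Variables (br : L -> L -> pol 1 L) (alpha : {linear L -> L}).
Variables (rho : L -> M -> pol 1 M) (beta : {linear M -> M}).
Hypothesis hL : is_hom_lie_conformal dL br alpha.
Hypothesis hmult : is_multiplicative br alpha.
Hypothesis hrho : is_representation dL dM br alpha rho beta.
Hypothesis two : (2%:R : K) != 0.

Local Notation E := (L * M)%type.
Local Notation dE := (dsum dL dM).
Local Notation gE := (dsum alpha beta).
Local Notation mc := (mc_rho dM br rho).
Local Notation inL := (@injL K L M).
Local Notation inMs := (@inMs K L M _).
Local Notation b := (dbr dL dM br alpha rho beta).
Local Notation C := (cochains dL dM alpha beta).
Local Notation drv f g := (@derived K L M dL dM br alpha rho beta _ _ f g).
Let dlin : linear dE := linear_dsum dL dM.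
Let glin : linear gE := linear_dsum alpha beta.
Let dD : addf dE := addf_linear dlin.
Let gD : addf gE := addf_linear glin.
Let ged := gd hL hrho.
Let mcC := mc_cochain hL hmult hrho.
Local Notation coch f := (is_cochain dM dL beta alpha f).
Local Notation cochE f := (is_cochain dE dE gE gE f).
Local Notation hat N f := (@hat K E dE dlin N _ f).
Local Notation qm N T := (@qmap K E dE N dD T).
Local Notation U := (fun p => (raw p.-1 M L : lmodType K)).

Lemma embed0 n : embed (0 : raw n M L) = 0.
Proof. by apply/funext => e; rewrite embedE (addf0 (addf_mapc (addf_linear (@linear_inL K L M)))). Qed.

Lemma embed_comb n a (f g : raw n M L) : embed (a *: f + g) = a *: embed f + embed g.
Proof.
apply/funext => e; rewrite embedE.
by rewrite [LHS](_ : _ = mapc inL (a *: f (snds e) + g (snds e))) // (linear_mapc (@linear_inL K L M)).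
Qed.

Lemma embed_inj n : injective (@embed K L M n).
Proof.
move=> f g e; apply/funext => v; apply: (@mapc_inL_inj K L M).
by have := congr1 (fun h : raw n E E => h (inMs v)) e; rewrite !embedE inMsK.
Qed.

Lemma dbr0l p q (g : raw q.-1 M L) : b p q (0 : raw p.-1 M L) g = 0.
Proof.
apply/funext => a; rewrite /dbr /derived /nrE embed0 nr0r // nr0l //.
by rewrite scaler0 [LHS](_ : _ = mapc (fun e : E => e.1) 0) // (addf0 (addf_mapc _)).
Qed.

Lemma dbr0r p q (f : raw p.-1 M L) : b p q f (0 : raw q.-1 M L) = 0.
Proof.
apply/funext => a; rewrite /dbr /derived /nrE embed0 nr0r //.
by rewrite scaler0 [LHS](_ : _ = mapc (fun e : E => e.1) 0) // (addf0 (addf_mapc _)).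
Qed.

Lemma cochains_pos p (f : raw p.-1 M L) : (0 < p)%N -> C p f <-> coch f.
Proof. by case: p f. Qed.

Lemma derived_transfer p q (f : raw p.-1 M L) (g : raw q.-1 M L) : (0 < p)%N -> (0 < q)%N ->
  coch f -> coch g ->
  cochE (drv f g) /\
  forall N s, hat N (drv f g) s =
    pder (qm N gE) (hat N mc) p q (hat N (embed f)) (hat N (embed g)) s.
Proof.
case: p f => // p f; case: q g => // q g _ _ /embed_cochain hf /embed_cochain hg.
have [c1 h1] := nr_transfer (M := p.+1) dlin glin ged (esym (add1n p)) mcC hf.
have eM : (p.+1 + q.+1).-1 = (p.+1 + q)%N by rewrite addnS.
have [c2 h2] := nr_transfer dlin glin ged eM c1 hg.
have [c3 h3] := sign_transfer dlin glin ged p.+1 c2.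
split; first exact: c3.
by move=> N s; rewrite [LHS]h3 h2 /pder; congr sg; apply: pnr_ext.
Qed.

Section Level.
Variable N : nat.
Local Notation X := (coinv N dD).
Local Notation pr := (pr (N := N) dD).
Local Notation weight := (@weighted K L M dL dM N).
Local Notation pnrX := (pnr (qm N gE)).
Local Notation Pi := (hat N mc).
Let gX : addf (qm N gE) := addf_qmap gD ged.

Lemma shifts_pnr w w' m n F G : shifts weight w F -> shifts weight w' G ->
  shifts weight (w + w') (pnrX m n F G).
Proof.
move=> hF hG ps hps; apply: weightB.
  by apply: (comp_shifts (@weight0 _ _ _ _ _ _) (@weightB _ _ _ _ _ _) _ _ hF hG) => // k x; exact: (weight_iter hL hrho).
have h : weight (\sum_(p <- ps) p.1 - (w + w')) (pcirc (qm N gE) m G F (map snd ps)).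
  rewrite (addrC w).
  by apply: (comp_shifts (@weight0 _ _ _ _ _ _) (@weightB _ _ _ _ _ _) _ _ hG hF) => // k x; exact: (weight_iter hL hrho).
case: (_ && _) => //=; rewrite -sub0r; apply: weightB => //; exact: weight0.
Qed.

(** 1/2 acts on X through the coefficients. *)
Lemma coinv_two (x : X) : x + x = 0 -> x = 0.
Proof.
have aD : addf ( *:%R (2%:R^-1) : E -> E) by exact: addf_scale.
have aS (c : E) : 2%:R^-1 *: dE c = dE (2%:R^-1 *: c) by exact: scale_d.
move=> x2; have <- : qm N ( *:%R 2%:R^-1) (x + x) = x.
  rewrite addf_qmap //.
  apply: (coinv_ext (f := fun x => qm N ( *:%R 2%:R^-1) x + qm N ( *:%R 2%:R^-1) x) (f' := id)) => // [|c k].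
    by apply: addf_add; exact: addf_qmap.
  rewrite qmapU // -addf_mono_pr; congr (pr (mono _ _)).
  by rewrite -scalerDl -mulr2n -[X in X *: _]mulr_natl divff // scale1r.
by rewrite x2; apply: addf0; exact: addf_qmap.
Qed.

Lemma Pi_alt : alt_map (qm N gE) 1 Pi.
Proof. by case: (hat_conf dlin N glin ged mcC). Qed.

Lemma embed_alt n (f : raw n M L) : coch f -> alt_map (qm N gE) n (hat N (embed f)).
Proof. by move=> /embed_cochain hf; case: (hat_conf dlin N glin ged hf). Qed.

Lemma Pi_pnr s : pnrX 1 1 Pi Pi s = 0.
Proof. by rewrite /pnr !(Pi_square hL hmult hrho) sg0 subr0. Qed.

(** The bracket takes m + n + 1 arguments but lowers the weight by m + n + 2. *)
Lemma embed_commute m n (f : raw m M L) (g : raw n M L) s : coch f -> coch g ->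
  pnrX m n (hat N (embed f)) (hat N (embed g)) s = 0.
Proof.
move=> hf hg; have [h1 _ h3 _] := pnr_alt gX (embed_alt hf) (embed_alt hg).
apply: (shifts_vanish (w := (m.+1 + n.+1)%N) s _ h1 h3); first by rewrite addnS addSn ltnSn.
by rewrite PoszD; apply: shifts_pnr; exact: embed_shifts.
Qed.
End Level.

(** m_c + ρ preserves the weight, and [f] and [g] lower it by p and q. The sum p + q is also the
    number of arguments, which is the extreme case treated by [shifts_full]. *)
Lemma derived_full p q (f : raw p.-1 M L) (g : raw q.-1 M L) : (0 < p)%N -> (0 < q)%N ->
  coch f -> coch g -> embed (b p q f g) = drv f g.
Proof.
move=> p0 q0 hf hg; have [c h] := derived_transfer p0 q0 hf hg.
set N := (p + q).-1; apply/funext => v.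
have alt : alt_map (qm N gE) N (hat N (drv f g)) by case: (hat_conf dlin N glin ged c).
have sh : shifts (@weighted K L M dL dM N) N.+1 (hat N (drv f g)).
  have -> : hat N (drv f g) = pder (qm N gE) (hat N mc) p q (hat N (embed f)) (hat N (embed g)).
    by apply/funext => s; rewrite h.
  move=> ps hps; have eN : N.+1%:Z = (0 + p%:Z) + q%:Z by rewrite /N; clear -p0 q0; lia.
  have : shifts (@weighted K L M dL dM N) (0 + p%:Z + q%:Z)
      (pnr (qm N gE) p q.-1 (pnr (qm N gE) 1 p.-1 (hat N mc) (hat N (embed f))) (hat N (embed g))).
    apply: shifts_pnr; first (apply: shifts_pnr; first exact: (Pi_shifts hL hmult hrho)).
      by have := @embed_shifts _ _ _ _ _ _ _ ged N _ _ hf; rewrite prednK.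
    by have := @embed_shifts _ _ _ _ _ _ _ ged N _ _ hg; rewrite prednK.
  move=> /(_ ps hps); rewrite -eN /pder; case: (odd p) => //= hw.
  by rewrite -sub0r; apply: weightB => //; exact: weight0.
have [hD _ hZ _] := alt.
have full s := shifts_full s hD hZ sh.
have hrd e : drv f g e = rd (hat N (drv f g) (args dlin (@ykey N) e)).
  by rewrite (hat_args _ _ _ c) rd_at_keys.
have eM e : drv f g e = drv f g (inMs (snds e)).
  rewrite !hrd (full _).1; congr (rd (hat N _ _)).
  rewrite /args map_word; apply: word_ext => i.
  by rewrite pMU !ffunE.
have vM e : mapc (@prM K L M) (drv f g e) = 0.
  rewrite hrd -(rd_qmap _ (@prM_add K L M) (prM_d dL dM)) (full _).2.
  exact: addf0 (@addf_rd _ _ _ dlin _).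
rewrite embedE /dbr.
rewrite -[finfun _]/(inMs (snds v)) -eM mapc_comp; last 2 first.
- exact: (addf_linear (@linear_inL K L M)).
- by move=> x y.
have := vM v; move: (drv f g v) => P hP; apply/malgP => k.
rewrite mapcE //=.
have := congr1 (fun R : pol N E => R@_k) hP; rewrite mapcE // mcoeff0 /prM.
by case: (P@_k) => x a [->].
Qed.

Lemma dbr_hat p q (f : raw p.-1 M L) (g : raw q.-1 M L) N : (0 < p)%N -> (0 < q)%N ->
  coch f -> coch g ->
  hat N (embed (b p q f g)) =
    pder (qm N gE) (hat N mc) p q (hat N (embed f)) (hat N (embed g)).
Proof.
move=> p0 q0 hf hg; rewrite derived_full //.
by have [_ h] := derived_transfer p0 q0 hf hg; apply/funext => s; rewrite h.
Qed.

Lemma dbr_cochain p q (f : raw p.-1 M L) (g : raw q.-1 M L) : (0 < p)%N -> (0 < q)%N ->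
  coch f -> coch g -> coch (b p q f g).
Proof.
move=> p0 q0 hf hg; apply/embed_cochain; rewrite derived_full //.
by have [] := derived_transfer p0 q0 hf hg.
Qed.

Lemma raw_eq n (x y : raw n M L) : coch x -> coch y ->
  (forall s, hat n (embed x) s = hat n (embed y) s) -> x = y.
Proof.
move=> /embed_cochain hx /embed_cochain hy e; apply: embed_inj.
exact: (hat_faithful hx hy e).
Qed.

Lemma comb_hat n a (x y : raw n M L) : coch x -> coch y ->
  coch (a *: x + y) /\ forall N, hat N (embed (a *: x + y)) =
    fun s => qm N ( *:%R a) (hat N (embed x) s) + hat N (embed y) s.
Proof.
move=> /embed_cochain hx /embed_cochain hy.
have [c h] := comb_transfer dlin glin ged a hx hy.
split; first by apply/embed_cochain; rewrite embed_comb.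
by move=> N; apply/funext => s; rewrite embed_comb h.
Qed.

Lemma sign_hat n m (x : raw n M L) : coch x ->
  coch (- ((-1) ^+ m *: x)) /\ forall N, hat N (embed (- ((-1) ^+ m *: x))) =
    fun s => - sg (odd m) (hat N (embed x) s).
Proof.
move=> /embed_cochain hx.
have [c h] := sign_transfer dlin glin ged m.+1 hx.
have e : embed (- ((-1) ^+ m *: x)) = (-1) ^+ m.+1 *: embed x.
  rewrite -scaleNr exprS mulN1r.
  by have := embed_comb (- (-1) ^+ m) x 0; rewrite embed0 !addr0.
split; first by apply/embed_cochain; rewrite e.
by move=> N; apply/funext => s; rewrite e h /= -(sgA true).
Qed.

Lemma coch0 n : coch (0 : raw n M L).
Proof.
by apply/embed_cochain; rewrite embed0; case: (zero_transfer dlin glin ged n).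
Qed.

Lemma gcast_cochain p q (e : p = q) (x : raw p.-1 M L) : coch x -> coch (gcast (U := U) e x).
Proof. by case: q / e. Qed.

Lemma gcast_hat N p q (e : p = q) (x : raw p.-1 M L) :
  hat N (embed (gcast (U := U) e x)) = hat N (embed x).
Proof. by case: q / e. Qed.

Lemma gcast0 p q (e : p = q) : gcast (U := U) e 0 = 0.
Proof. by case: q / e. Qed.

Lemma embed_conf N n (x : raw n M L) : coch x ->
  conf_map (dlin := dlin) gE n (hat N (embed x)).
Proof. by move=> /embed_cochain hx; exact: hat_conf. Qed.

Lemma dbr_linearr p q a (x : raw p.-1 M L) (y y' : raw q.-1 M L) : (0 < p)%N -> (0 < q)%N ->
  coch x -> coch y -> coch y' ->
  b p q x (a *: y + y') = a *: b p q x y + b p q x y'.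
Proof.
move=> p0 q0 hx hy hy'.
have [c h] := comb_hat a hy hy'.
have H1 := fun N => dbr_hat N p0 q0 hx c.
have H2 := fun N => dbr_hat N p0 q0 hx hy.
have H3 := fun N => dbr_hat N p0 q0 hx hy'.
have c1 := dbr_cochain p0 q0 hx c.
have c2 := dbr_cochain p0 q0 hx hy; have c3 := dbr_cochain p0 q0 hx hy'.
move: c1 c2 c3 H1 H2 H3.
move: (b p q x (a *: y + y')) => w; move: (b p q x y) => u; move: (b p q x y') => u'.
move=> cw cu cu' H1 H2 H3.
have [c2 h2] := comb_hat a cu cu'; apply: (raw_eq cw c2) => s.
rewrite h2 H1 H2 H3 h /pder.
have [hD sD _] := conf_pnr glin ged (hat_conf dlin (p + q).-1 glin ged mcC) (embed_conf (p + q).-1 hx).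
have aD : addf (qm (p + q).-1 ( *:%R a)) by exact: addf_qscale.
rewrite pnrDr; last by case: hD.
rewrite (pnr_morphr _ _ _ _ _ aD (sD a)) sgD.
by rewrite -(addf_sg aD).
Qed.

Lemma dbr_skew p q (x : raw p.-1 M L) (y : raw q.-1 M L) : (0 < p)%N -> (0 < q)%N ->
  coch x -> coch y ->
  b p q x y = - ((-1) ^+ (p * q) *: gcast (U := U) (addnC q p) (b q p y x)).
Proof.
move=> p0 q0 hx hy.
have cyx := gcast_cochain (addnC q p) (dbr_cochain q0 p0 hy hx).
have [c h] := sign_hat (p * q) cyx.
apply: (raw_eq (dbr_cochain p0 q0 hx hy) c) => s.
rewrite h gcast_hat (dbr_hat _ p0 q0 hx hy) (dbr_hat _ q0 p0 hy hx) oddM.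
have gX : addf (qm (p + q).-1 gE) := addf_qmap gD ged.
apply: (pder_skew gX (Pi_alt _)) => //; try exact: embed_alt.
by move=> t; exact: embed_commute.
Qed.

Lemma dbr_jacobi p q r (x : raw p.-1 M L) (y : raw q.-1 M L) (z : raw r.-1 M L) :
  (0 < p)%N -> (0 < q)%N -> (0 < r)%N -> coch x -> coch y -> coch z ->
  b p (q + r)%N x (b q r y z) =
    gcast (U := U) (esym (addnA p q r)) (b (p + q)%N r (b p q x y) z)
    + (-1) ^+ (p * q) *:
        gcast (U := U) (addnCA q p r) (b q (p + r)%N y (b p r x z)).
Proof.
move=> p0 q0 r0 hx hy hz.
have pq : (0 < p + q)%N by rewrite addn_gt0 p0.
have qr : (0 < q + r)%N by rewrite addn_gt0 q0.
have pr : (0 < p + r)%N by rewrite addn_gt0 p0.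
have cyz := dbr_cochain q0 r0 hy hz; have cxy := dbr_cochain p0 q0 hx hy.
have cxz := dbr_cochain p0 r0 hx hz.
have c1 := gcast_cochain (esym (addnA p q r)) (dbr_cochain pq r0 cxy hz).
have c2 := gcast_cochain (addnCA q p r) (dbr_cochain q0 pr hy cxz).
rewrite addrC; have [c h] := comb_hat ((-1) ^+ (p * q)) c2 c1.
apply: (raw_eq (dbr_cochain p0 qr hx cyz) c) => s.
rewrite h !gcast_hat (dbr_hat _ p0 qr hx cyz) (dbr_hat _ q0 r0 hy hz).
rewrite (dbr_hat _ q0 pr hy cxz) (dbr_hat _ p0 r0 hx hz).
rewrite (dbr_hat _ pq r0 cxy hz) (dbr_hat _ p0 q0 hx hy).
set N := (p + (q + r)).-1.
(* The Jacobi identity for alternating maps is stated with signs, so the scalar (-1)^(pq) on the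
   coefficients is traded for one. *)
have -> : forall u, qm N ( *:%R ((-1) ^+ (p * q))) u = sg (odd (p * q)) u.
  have aD : addf ( *:%R ((-1) ^+ (p * q)) : E -> E) by exact: addf_scale.
  have aS (w : E) : (-1) ^+ (p * q) *: dE w = dE ((-1) ^+ (p * q) *: w) by exact: scale_d.
  move=> u; apply: (coinv_ext (f := fun u => qm N _ u) (f' := fun u => sg (odd (p * q)) u)).
  - exact: addf_qmap.
  - exact: sg_addf.
  move=> e k; rewrite qmapU // -signr_odd scale_sg.
  by rewrite (addf_sg (addf_mono_pr dlin k)).
rewrite oddM addrC.
have gX : addf (qm N gE) := addf_qmap gD ged.
by apply: (pder_jacobi gX (Pi_alt _) (@Pi_pnr _) (@coinv_two _)) => //; exact: embed_alt.
Qed.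

Lemma bracket_graded_lie : is_graded_lie (U := U) C b.
Proof.
have Cc p (x : raw p.-1 M L) : C p x -> p = 0%N /\ x = 0 \/ (0 < p)%N /\ coch x.
  by case: p x => [|p] x h; [left | right].
have Cp p (x : raw p.-1 M L) : (0 < p)%N -> coch x -> C p x by case: p x.
split.
- by case=> [|p] //; exact: coch0.
- case=> [|p] a x y; first by move=> /= -> ->; rewrite scaler0 addr0.
  by move=> hx hy; case: (comb_hat a hx hy).
- move=> p q x y /Cc[[ep x0]|[p0 hx]].
    move=> _; rewrite x0 dbr0l; case: (posnP (p + q)) => [e|h]; last by apply: (Cp _ _ h); exact: coch0.
    by rewrite /cochains e.
  move=> /Cc[[eq y0]|[q0 hy]].
    by rewrite y0 dbr0r; apply: Cp; [rewrite addn_gt0 p0 | exact: coch0].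
  by apply: Cp; [rewrite addn_gt0 p0 | exact: dbr_cochain].
- move=> p q a x x' y /Cc[[ep x0]|[p0 hx]].
    move=> /Cc[[_ x0']|[p0 _]]; last by rewrite ep in p0.
    by move=> _; rewrite x0 x0' scaler0 addr0 !dbr0l scaler0 addr0.
  move=> /Cc[[e _]|[_ hx']]; first by rewrite e in p0.
  move=> /Cc[[eq y0]|[q0 hy]]; first by rewrite y0 !dbr0r scaler0 addr0.
  have [c _] := comb_hat a hx hx'.
  (* Linearity on the left follows from linearity on the right by skew symmetry. *)
  rewrite (dbr_skew p0 q0 c hy) dbr_linearr // (dbr_skew p0 q0 hx hy) (dbr_skew p0 q0 hx' hy).
  case: (p + q)%N / (addnC q p) => /=.
  by rewrite scalerDr opprD scalerN !scalerA mulrC.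
- move=> p q a x y y' /Cc[[ep x0]|[p0 hx]]; first by rewrite x0 !dbr0l scaler0 addr0.
  move=> /Cc[[eq y0]|[q0 hy]].
    move=> /Cc[[_ y0']|[q0 _]]; last by rewrite eq in q0.
    by rewrite y0 y0' scaler0 addr0 !dbr0r scaler0 addr0.
  move=> /Cc[[e _]|[_ hy']]; first by rewrite e in q0.
  exact: dbr_linearr.
- move=> p q x y /Cc[[ep x0]|[p0 hx]].
    by rewrite x0 dbr0l dbr0r gcast0 scaler0 oppr0.
  move=> /Cc[[eq y0]|[q0 hy]]; last exact: dbr_skew.
  by rewrite y0 dbr0l dbr0r gcast0 scaler0 oppr0.
- move=> p q r x y z /Cc[[ep x0]|[p0 hx]].
    by rewrite x0 !dbr0l !dbr0r !gcast0 scaler0 addr0.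
  move=> /Cc[[eq y0]|[q0 hy]].
    by rewrite y0 !dbr0l !dbr0r dbr0l !gcast0 scaler0 addr0.
  move=> /Cc[[er z0]|[r0 hz]]; last exact: dbr_jacobi.
  by rewrite z0 !dbr0r !gcast0 scaler0 addr0.
Qed.

End Main.

(** * O-operators *)

Section OOperator.
Variables (K : fieldType) (L M : lmodType K).
Variables (dL : {linear L -> L}) (dM : {linear M -> M}).
Variables (br : L -> L -> pol 1 L) (alpha : {linear L -> L}).
Variables (rho : L -> M -> pol 1 M) (beta : {linear M -> M}).
Hypothesis hL : is_hom_lie_conformal dL br alpha.
Hypothesis hmult : is_multiplicative br alpha.
Hypothesis hrho : is_representation dL dM br alpha rho beta.
Hypothesis two : (2%:R : K) != 0.
Variable T : {linear M -> L}.
Hypothesis Tab : forall m, alpha (T m) = T (beta m).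

Local Notation E := (L * M)%type.
Local Notation dE := (dsum dL dM).
Local Notation gE := (dsum alpha beta).
Local Notation inL := (@injL K L M).
Local Notation inM := (@injM K L M).
Local Notation inMs := (@inMs K L M _).
Local Notation b := (dbr dL dM br alpha rho beta).
Let dlin : linear dE := linear_dsum dL dM.
Let glin : linear gE := linear_dsum alpha beta.
Let dD : addf dE := addf_linear dlin.
Let gD : addf gE := addf_linear glin.
Let ged := gd hL hrho.
Local Notation coch f := (is_cochain dM dL beta alpha f).
Local Notation hat N f := (@hat K E dE dlin N _ f).
Local Notation qm N T := (@qmap K E dE N dD T).
Local Notation ak := (@at_keys K E dE dlin 1 _).
Let iL : addf inL := addf_linear (@linear_inL K L M).
Let iM : addf inM := addf_linear (@linear_inM K L M).
Let TD : addf T := addf_lin T.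

Lemma polC_inj n (W : lmodType K) : injective (@polC K n W).
Proof. by move=> x y; rewrite /polC; exact: (can_inj (@malgCK _ _)). Qed.

(** With one argument, which is also the last, sesquilinearity is commutation with ∂; linearity and
    the twist hold by assumption on [T], and alternation is void. *)
Lemma raw1_cochain : coch (raw1 T) <-> forall m, T (dM m) = dL (T m).
Proof.
split=> [h m|Td].
  have := coch_d_last h [ffun=> m]; rewrite big_ord0 addr0 /raw1 mapc_polC; last exact: addf_lin.
  by rewrite !ffunE => /polC_inj.
split.
- move=> v i a x y; rewrite /raw1 !ffunE (ord1 i) /= linearP.
  rewrite addf_polC; congr (_ + _).
  by rewrite -[RHS]/(mapc ( *:%R a) _) mapc_polC //; exact: addf_scale.
- by move=> v; rewrite /raw1 mapc_polC ?ffunE ?Tab //; exact: addf_lin.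
- by move=> v [].
- move=> v; rewrite big_ord0 addr0 /raw1 mapc_polC; last exact: addf_lin.
  rewrite -Td /upd ffunE /=.
  by have -> : ord_max = ord0 :> 'I_1 by apply: val_inj.
- move=> t v; rewrite (permS1 t) odd_perm1 scale1r /raw1 ffunE perm1.
  by rewrite /eval subst_polC; [|case|exact: addf_polC].
Qed.

Definition defect m n : pol 1 L :=
  mapc T (rho (T m) n - flip dM (rho (T n) m)) - br (T m) (T n).

(** [T] as an endomorphism of L ⊕ M. It kills L and maps into L, so its square is 0. *)
Definition gra (e : E) : E := inL (T e.2).

Lemma addf_gra : addf gra.
Proof. by move=> e e'; rewrite /gra -iL; congr inL; rewrite /= linearD. Qed.

Section Bracket.
Hypothesis Td : forall m, T (dM m) = dL (T m).
Let TC := (raw1_cochain.2 Td : coch (raw1 T)).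

Lemma gra_d e : gra (dE e) = dE (gra e).
Proof. by rewrite /gra /= Td (inL_d dL dM). Qed.

Local Notation pr := (pr (N := 1) dD).
Local Notation F := (hat 1 (embed (raw1 T))).

Lemma hat_raw1 x : F [:: x] = qm 1 gra x.
Proof.
have TCE := (embed_cochain dL dM alpha beta (raw1 T)).1 TC.
have [FD _ _ _] := embed_alt hL hrho 1 TC.
apply: (coinv_ext (f := fun x => F [:: x]) (f' := qm 1 gra)) => [y z||c k].
- exact: (FD [::]).
- exact: (addf_qmap addf_gra gra_d).
rewrite (qmapU _ addf_gra gra_d).
have -> : [:: pr (mono k c)] = args dlin (fun _ : 'I_1 => k) [ffun=> c].
  by rewrite /args word_lift0 word_nil ffunE.
rewrite (hat_args _ _ _ TCE) embedE /raw1 mapc_polC // at_keys_polC !ffunE.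
by rewrite word_lift0 word_nil ksumS ksum_nil kaddr0.
Qed.

Lemma gra_at_keys_inM ks n (P : pol n M) : qm 1 gra (ak ks (mapc inM P)) = ak ks (mapc inL (mapc T P)).
Proof.
rewrite (at_keys_mapc _ _ _ addf_gra gra_d) !mapc_comp //; exact: addf_gra.
Qed.

Lemma gra_gra x : qm 1 gra (qm 1 gra x) = 0.
Proof.
apply: (coinv_ext (f := fun x => qm 1 gra (qm 1 gra x)) (f' := fun=> 0)) => [||c k].
- by apply: addf_comp'; exact: (addf_qmap addf_gra gra_d).
- by move=> y z; rewrite addr0.
rewrite !(qmapU _ addf_gra gra_d) /gra /= linear0.
by rewrite [X in pr X](_ : _ = mono k 0) // (addf0 (addf_mono_pr dlin k)).
Qed.

Lemma graU k m : qm 1 gra (pr (mono k (inM m))) = pr (mono k (inL (T m))).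
Proof. exact: (qmapU _ addf_gra gra_d). Qed.

(** Terms that apply [T] twice in succession vanish, and each remaining term of [[P, T], T] occurs
    twice. *)
Lemma double_pnr (P F : seq (coinv 1 dD) -> coinv 1 dD) u v :
  alt_map (qm 1 gE) 1 P -> alt_map (qm 1 gE) 0 F -> (forall x, F [:: x] = qm 1 gra x) ->
  let D := P [:: qm 1 gra u; qm 1 gra v] - qm 1 gra (P [:: qm 1 gra u; v])
    - qm 1 gra (P [:: u; qm 1 gra v]) in
  pnr (qm 1 gE) 1 0 (pnr (qm 1 gE) 1 0 P F) F [:: u; v] = D + D.
Proof.
move=> aP aF hF D.
have gX : addf (qm 1 gE) := addf_qmap gD ged.
have aD := pnr_alt gX aP aF; rewrite addn0 in aD.
rewrite (pnr_pair u v aD aF) !(pnr_pair _ _ aP aF) !hF !gra_gra.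
have gDD : addf (qm 1 gra) := addf_qmap addf_gra gra_d.
have [PD _ _ _] := aP.
rewrite (@addf0 _ _ (fun x => P [:: x; v])) => [|x y]; last exact: (PD [::]).
rewrite (@addf0 _ _ (fun x => P [:: u; x])) => [|x y]; last exact: (PD [:: u]).
rewrite !(gDD, addfN gDD) gra_gra /D.
by zmodule.
Qed.

Lemma bracket_raw1 a : b 1 1 (raw1 T) (raw1 T) a =
  defect (a ord0) (a ord_max) + defect (a ord0) (a ord_max).
Proof.
apply: (@mapc_inL_inj K L M).
(* Placing the arguments in M ⊂ L ⊕ M makes the left side a value of [embed], to which the transfer
   applies. *)
have -> : a = snds (inMs a) by rewrite inMsK.
have bC := dbr_cochain hL hmult hrho (p := 1) (q := 1) isT isT TC TC.
have bE := (embed_cochain dL dM alpha beta _).1 bC.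
rewrite -[LHS]/(embed (b 1 1 (raw1 T) (raw1 T)) (inMs a)).
rewrite -(rd_at_keys dlin (embed _ _)) -(hat_args _ (@ykey 1) _ bE).
have dh := dbr_hat hL hmult hrho (p := 1) (q := 1) 1 isT isT TC TC.
rewrite dh.
(* The sign (-1)^p with p = 1 turns the expression of [double_pnr] into [defect], where the bracket
   of L comes with a minus. *)
rewrite /pder /=.
have -> : args dlin (@ykey 1) (inMs a) =
    [:: pr (mono (ykey ord0) (inM (a ord0))); pr (mono (ykey ord_max) (inM (a ord_max)))].
  rewrite /args !word_lift0 word_nil !ffunE.
  by have -> : lift ord0 ord0 = ord_max :> 'I_2 by apply: val_inj.
set u := pr _; set w := pr _; set m := a ord0; set n := a ord_max.
have aP := Pi_alt hL hmult hrho 1; have aF := embed_alt hL hrho 1 TC.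
rewrite (double_pnr u w aP aF hat_raw1).
rewrite /u /w !graU.
rewrite (Pi2 hL hmult hrho _ (inL (T m))) (Pi2 hL hmult hrho _ (inL (T m)) _ (inM n)) (Pi2 hL hmult hrho _ (inM m)).
have iLD := addf_mapc (n := 1) iL; have iMD := addf_mapc (n := 1) iM.
have fD : addf (flip dM) := addf_flip (linear_lin dM).
have -> : mcp dM br rho (inL (T m)) (inL (T n)) = mapc inL (br (T m) (T n)).
  rewrite /mcp /= !(rho0 hrho) (addf0 fD) subrr.
  by rewrite (addf0 iMD) addr0.
have -> : mcp dM br rho (inL (T m)) (inM n) = mapc inM (rho (T m) n).
  by rewrite /mcp /= (br0 hL) (rho0 hrho) (addf0 fD) subr0 (addf0 iLD) add0r.
have -> : mcp dM br rho (inM m) (inL (T n)) = mapc inM (- flip dM (rho (T n) m)).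
  by rewrite /mcp /= (br0l hL) (rho0 hrho) sub0r (addf0 iLD) add0r.
rewrite !gra_at_keys_inM inMsK.
have ks : [:: ykey (ord0 : 'I_2); ykey ord_max] = word (@ykey 1).
  rewrite !word_lift0 word_nil.
  by have -> : lift ord0 ord0 = ord_max :> 'I_2 by apply: val_inj.
have RD : addf (fun P : pol 1 E => ak (word (@ykey 1)) P) := addf_at_keys dlin (word (@ykey 1)) (n := 1).
rewrite -[mapc inL (_ + _)](rd_at_keys dlin) ks; congr rd.
rewrite /defect -/m -/n !((addf_mapc TD), (addfN (addf_mapc TD)), iLD, (addfN iLD), RD, addfN RD).
zmodule.
Qed.
End Bracket.

Lemma O_operatorP :
  is_O_operator dL dM br alpha rho beta T <-> coch (raw1 T) /\ b 1 1 (raw1 T) (raw1 T) = 0.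
Proof.
split=> [[Td _ hT]|[hT h0]].
  split; first exact/raw1_cochain.
  apply/funext => a; rewrite bracket_raw1 // /defect hT subrr addr0 //.
have Td := raw1_cochain.1 hT; split=> // m n.
have := congr1 (fun f : raw 1 M L => f [ffun i => if i == ord0 then m else n]) h0.
rewrite /= (bracket_raw1 Td) !ffunE /= -mulr2n -scaler_nat => /eqP.
by rewrite -[X in _ == X]/0 scaler_eq0 (negPf two) subr_eq0 => /eqP.
Qed.
End OOperator.

Theorem theorem4p8 (R : realType) (L M : lmodType R[i])
    (dL : {linear L -> L}) (dM : {linear M -> M})
    (br : L -> L -> pol 1 L) (alpha : {linear L -> L})
    (rho : L -> M -> pol 1 M) (beta : {linear M -> M})
    (hL : is_hom_lie_conformal dL br alpha)
    (hmult : is_multiplicative br alpha)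
    (hrho : is_representation dL dM br alpha rho beta) :
  let b := dbr dL dM br alpha rho beta in
  let C := cochains dL dM alpha beta in
  [/\ forall p q (f : raw p.-1 M L) (g : raw q.-1 M L),
        (0 < p)%N -> (0 < q)%N -> C p f -> C q g ->
        embed (b p q f g) = derived dL dM br alpha rho beta f g,
      is_graded_lie (U := fun p => (raw p.-1 M L : lmodType R[i])) C b
    & forall T : {linear M -> L}, (forall m, alpha (T m) = T (beta m)) ->
        is_O_operator dL dM br alpha rho beta T <->
        C 1%N (raw1 T) /\ b 1%N 1%N (raw1 T) (raw1 T) = 0].
Proof.
move=> b C; have two : (2%:R : R[i]) != 0 by rewrite Num.Theory.pnatr_eq0.
split=> [p q f g p0 q0 hf hg||T hT].
- by apply: (derived_full hL hmult hrho p0 q0); [move: hf | move: hg]; rewrite /C cochains_pos.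
- exact: (bracket_graded_lie hL hmult hrho two).
- exact: (O_operatorP hL hmult hrho two hT).
Qed.
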